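(* Let $p$ be an odd prime and let $\alpha=[0,b_1,b_2,b_3,\ldots]$ be a non-periodic (infinite) Browkin $p$-adic continued fraction such that the sequence $(\lvert b_i\rvert_p)_{i\ge1}$ is bounded, and put $D=\max_i\lvert b_i\rvert_p$. Let $(n_i)_{i\ge0}$, $(k_i)_{i\ge0}$, $(\lambda_i)_{i\ge0}$ be sequences of positive integers such that: (1) the $k_i$ are bounded; (2) $n_{i+1}\ge n_i+\lambda_ik_i$ for all $i$, and there exists $C>4\frac{\log D}{\log p}-1$ with $\lambda_i>Cn_i$ for all sufficiently large $i$; (3) $b_{h+k_i}=b_h$ for all $h$ with $n_i\le h\le n_i+(\lambda_i-1)k_i-1$, for every $i$; (4) for every $i$, the finite sequence $(b_1,\ldots,b_m)$ with $m=n_i$ satisfies the following condition: each $b_j=\hat b_j/p^{a_j}$ with $a_j,\hat b_j\in\mathbb{Z}$, $a_j>0$, and for every $j\le m$ with $b_j\neq p^{-1}$, $$\lvert\hat b_j\rvert_\infty<\sqrt{\tfrac{3}{14}}\cdot\frac{p^{a}}{F_{m+1}},\qquad a=\min\{a_j:1\le j\le m,\ a_j\neq1\},$$ where $(F_j)_{j\ge0}=(0,1,1,2,3,5,\ldots)$ is the Fibonacci sequence. Then $\alpha$ is either transcendental or a quadratic irrational.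
   Context: Every $x\in\mathbb{Q}_p$ has a unique expansion $x=\sum_{i\ge r}a_ip^i$ with $r\in\mathbb{Z}$ and digits in $\{-\frac{p-1}{2},\ldots,\frac{p-1}{2}\}$; Browkin's function is $s(x)=\sum_{i=r}^{0}a_ip^i$. The Browkin continued fraction $[b_0,b_1,\ldots]$ of $\alpha_0\in\mathbb{Q}_p$ is obtained by iterating $b_i=s(\alpha_i)$, $\alpha_{i+1}=1/(\alpha_i-b_i)$ as long as $\alpha_i\neq b_i$. ''Periodic'' means eventually periodic sequence of partial quotients. *)

(* Defs.v *)
From HB Require Import structures.
From mathcomp Require Import all_boot all_order all_algebra.
Set Implicit Arguments. Unset Strict Implicit. Unset Printing Implicit Defensive.
Import Order.TTheory GRing.Theory Num.Theory.
Local Open Scope ring_scope.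

Definition padic_abs (p : nat) (q : rat) : rat :=
  if q == 0 then 0
  else (p%:R ^+ logn p `|denq q|%N) / (p%:R ^+ logn p `|numq q|%N).

(* (K, v) is a model of Q_p: a field containing Q (via ratr) with a
   non-archimedean multiplicative absolute value extending |.|_p,
   in which Q is dense and which is complete.  This determines K
   up to isometric isomorphism as Q_p. *)
Definition Qp_model (p : nat) (K : fieldType) (v : K -> rat) : Prop :=
  [/\ forall x, 0 <= v x,
      forall x, v x = 0 -> x = 0,
      forall x y, v (x * y) = v x * v y,
      forall x y, v (x + y) <= Num.max (v x) (v y)
    & [/\ forall q : rat, v (ratr q) = padic_abs p q,
          forall (x : K) (eps : rat), 0 < eps ->
            exists q : rat, v (x - ratr q) < eps
        &
          forall u : nat -> K,
            (forall eps : rat, 0 < eps -> exists N, forall m n,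
                (N <= m)%N -> (N <= n)%N -> v (u m - u n) < eps) ->
            exists l : K, forall eps : rat, 0 < eps -> exists N, forall n,
                (N <= n)%N -> v (u n - l) < eps]].

(* The image of Browkin's function s: the numbers sum_{i=r}^0 a_i p^i with
   digits in {-(p-1)/2,...,(p-1)/2}, i.e. the elements of Z[1/p] of real
   absolute value < p/2. *)
Definition browkin_digits_set (p : nat) (y : rat) : Prop :=
  (exists (a : int) (k : nat), y = a%:~R / (p%:R ^+ k)) /\ `|y| < p%:R / 2.

(* s(x) = y : y is in the image set and |x - y|_p < 1 (this determines y). *)
Definition browkin_s (p : nat) (K : fieldType) (v : K -> rat) (x : K) (y : rat)
  : Prop := browkin_digits_set p y /\ v (x - ratr y) < 1.

Definition browkin_cf (p : nat) (K : fieldType) (v : K -> rat) (alpha : K)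
  (b : nat -> rat) : Prop :=
  exists al : nat -> K,
    al 0%N = alpha /\
    forall i, [/\ browkin_s p v (al i) (b i),
                  al i != ratr (b i)
                & al i.+1 = (al i - ratr (b i))^-1].

Definition eventually_periodic (b : nat -> rat) : Prop :=
  exists N T : nat, (0 < T)%N /\ forall n, (N <= n)%N -> b (n + T)%N = b n.

Fixpoint fib (n : nat) : nat :=
  match n with
  | 0 => 0
  | S m => match m with 0 => 1 | S k => fib m + fib k end
  end.

(* For b_j in Z[1/p] with v_p(b_j) < 0: b_j = bhat_j / p^(a_j), p not | bhat_j. *)
Definition cf_a (b : nat -> rat) (p j : nat) : nat := logn p `|denq (b j)|%N.
Definition cf_bhat (b : nat -> rat) (j : nat) : int := numq (b j).

(* Condition (4) for (b_1,...,b_m):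
   every b_j = bhat_j/p^a_j with a_j > 0, and for j <= m, b_j <> 1/p,
   |bhat_j| < sqrt(3/14) p^a / F_(m+1), a = min{a_j : 1<=j<=m, a_j <> 1}
   (written squared: 14 bhat_j^2 F_(m+1)^2 < 3 p^(2a); vacuous if the set is empty). *)
Definition cond4 (p : nat) (b : nat -> rat) (m : nat) : Prop :=
  (forall j, (1 <= j <= m)%N ->
     (0 < cf_a b p j)%N /\
     b j = (cf_bhat b j)%:~R / (p%:R ^+ cf_a b p j)) /\
  (forall a : nat,
     (exists j0, [/\ (1 <= j0 <= m)%N, cf_a b p j0 != 1%N & a = cf_a b p j0]) ->
     (forall j', (1 <= j' <= m)%N -> cf_a b p j' != 1%N -> (a <= cf_a b p j')%N) ->
     forall j, (1 <= j <= m)%N -> b j != (p%:R)^-1 ->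
       14%:R * ((cf_bhat b j)%:~R ^+ 2) * ((fib m.+1)%:R ^+ 2)
         < 3%:R * (p%:R ^+ (2 * a)) :> rat).

(* Main.v *)
Require Import Defs.
From HB Require Import structures.
From Stdlib Require Import Classical.
From mathcomp Require Import all_boot all_order all_algebra.
From mathcomp Require Import fingroup perm generic_quotient fraction.
From mathcomp.multinomials Require Import mpoly.
From mathcomp Require Import ring lra zify.
Import Order.TTheory GRing.Theory Num.Theory.
Local Open Scope ring_scope.
Set Implicit Arguments. Unset Strict Implicit. Unset Printing Implicit Defensive.

(* Since F_(m+1) tends to infinity while a stays bounded by any fixed a_j <> 1, condition (4) for
   all n_i forces a_j = 1 for every j >= 1. Hence D = p and C > 3, and every partial quotient
   is c/p with c prime to p and |c| < p^2/2.

   As the k_i are bounded, one and the same word w occurs as the repeated block for infinitely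
   many i. Let delta be the value of the purely periodic continued fraction of w. It is quadratic
   over Q, and irrational by a descent on rational values N/(pM). The numbers
   beta_i = [0, b_1, ..., b_(n_i - 1), delta] lie in Q(delta) and satisfy
   |beta_i - alpha| <= p^(-8 n_i), because lambda_i > 3 n_i and each partial quotient contracts
   distances by p^(-2). Numerator and denominator of beta_i have size O((3 p^2 / 4)^(n_i)),
   and beta_i <> alpha since alpha is not eventually periodic.

   Such approximations to an algebraic alpha are impossible, by Roth's argument. An integral
   polynomial P in m variables with index almost m/2 at (alpha, ..., alpha) exists by the pigeonhole
   principle modulo a power of p, Chebyshev's inequality counting the conditions. By Roth's
   lemma, proved with generalized Wronskians, some derivative of P of small index does not
   vanish at (beta_1, ..., beta_m) for rapidly increasing n_j. This value is p-adically too small for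
   an element of Q(delta) of its size. So alpha is transcendental. *)

(** * Multivariate polynomials: supports, divided derivatives, norms, index *)

(** The main exponents balance exactly. With [lambda > 3 n] even a block of length one supplies the
    [4 n] contractions behind the error [p^(-8 n)]. Degrees with [n_j r_j = R] and an index close to
    [m/2] turn this into [p^(-4 R)] per variable. On the other side the norm from Q(delta) squares
    sizes, so heights [p^(2 n)] would give [p^(4 R)] per variable: a tie. What decides is the factor
    [(3/4)^n] in the height, which comes from the bound [|c| < p^2/2] on Browkin numerators. With
    [q = 3 p^2] one has [(4/3)^q >= p^2]; this is recorded as a saving of [p^(n/q)], and the index
    parameters and the number of variables are chosen in terms of [q]. No number field is
    constructed. Elements of Q(delta) are handled through pairs of integer coordinates, heights are
    replaced by sums of absolute values of coefficients, and each lower bound comes from a norm or a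
    resultant that is a nonzero integer [z], for which the product of the real and the p-adic
    absolute value is at least 1. As [v] has rational values, all inequalities live in ordered
    fields such as Q, without logarithms. *)

Section Support.
Variables (n : nat) (R : comNzRingType).
Implicit Types (p q : {mpoly R[n]}) (A : pred 'I_n).

Definition onlyv A p := forall m, m \in msupp p -> forall i, ~~ A i -> m i = 0%N.
Definition degle (r : 'I_n -> nat) p := forall m, m \in msupp p -> forall i, (m i <= r i)%N.

Lemma onlyv0 A : onlyv A 0.
Proof. by move=> m; rewrite msupp0. Qed.

Lemma onlyvC A c : onlyv A c%:MP.
Proof. by move=> m; rewrite msuppC; case: eqP => // _; rewrite inE => /eqP -> i _; rewrite mnm0E. Qed.

Lemma onlyvX A (m : 'X_{1..n}) : (forall i, ~~ A i -> m i = 0%N) -> onlyv A 'X_[m].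
Proof. by move=> h k; rewrite msuppX inE => /eqP ->. Qed.

Lemma onlyvD A p q : onlyv A p -> onlyv A q -> onlyv A (p + q).
Proof. by move=> hp hq m /msuppD_le; rewrite mem_cat => /orP[/hp|/hq]. Qed.

Lemma onlyvM A p q : onlyv A p -> onlyv A q -> onlyv A (p * q).
Proof.
move=> hp hq m /msuppM_le /allpairsP[[a b] /= [/hp ha /hq hb ->]] i Ai.
by rewrite mnmDE ha ?hb.
Qed.

Lemma onlyvZ A c p : onlyv A p -> onlyv A (c *: p).
Proof. by move=> hp m /msuppZ_le /hp. Qed.

Lemma onlyv_sum A (I : Type) (s : seq I) (P : pred I) (F : I -> {mpoly R[n]}) :
  (forall i, P i -> onlyv A (F i)) -> onlyv A (\sum_(i <- s | P i) F i).
Proof. by move=> h; apply: big_ind => //; [exact: onlyv0 | exact: onlyvD]. Qed.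

Lemma onlyv_prod A (I : Type) (s : seq I) (P : pred I) (F : I -> {mpoly R[n]}) :
  (forall i, P i -> onlyv A (F i)) -> onlyv A (\prod_(i <- s | P i) F i).
Proof. by move=> h; apply: big_ind => //; [exact: onlyvC | exact: onlyvM]. Qed.

Lemma onlyv_exp A p k : onlyv A p -> onlyv A (p ^+ k).
Proof. by move=> h; elim: k => [|k ih]; [exact: onlyvC | rewrite exprS; exact: onlyvM]. Qed.

Lemma onlyv_derivm A p mu : onlyv A p -> onlyv A p^`M[mu].
Proof. by move=> hp m; rewrite mcoeff_msupp mcoeff_mderivm => h j Aj;
have : (mu + m)%MM \in msupp p; [rewrite mcoeff_msupp; apply: contraNneq h => ->; rewrite mul0rn
| move/hp/(_ j Aj); rewrite mnmDE addnC; case: (m j)]. Qed.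

Lemma onlyv_deriv0 A p i : onlyv A p -> ~~ A i -> p^`M(i) = 0.
Proof.
move=> hp Ai; apply/mpolyP=> m; rewrite mcoeff_deriv mcoeff0.
have [/hp/(_ i Ai)|/memN_msupp_eq0 -> //] := boolP ((m + U_(i))%MM \in msupp p); last by rewrite mul0rn.
by rewrite mnmDE mnm1E eqxx addn1.
Qed.

(* Exponents supported in [A] and outside [A] recombine uniquely. *)
Lemma mcoeffM_sep A p q (a b : 'X_{1..n}) : onlyv A p -> onlyv (predC A) q ->
  (forall i, ~~ A i -> a i = 0%N) -> (forall i, A i -> b i = 0%N) ->
  (p * q)@_(a + b) = p@_a * q@_b.
Proof.
move=> hp hq ha hb.
have key m1 m2 : m1 \in msupp p -> m2 \in msupp q -> (m1 + m2 = a + b)%MM -> m1 = a /\ m2 = b.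
  move=> /hp h1 /hq h2 /mnmP e; split; apply/mnmP=> i; have := e i; rewrite !mnmDE;
  have [Ai|Ai] := boolP (A i).
  - by rewrite (hb _ Ai) (h2 i) /= ?Ai // !addn0.
  - by rewrite h1 ?ha.
  - by rewrite (hb _ Ai) (h2 i) /= ?Ai.
  - by rewrite h1 ?ha.
rewrite mpolyME raddf_sum /= big_allpairs /=.
transitivity (\sum_(m1 <- msupp p) \sum_(m2 <- msupp q)
   (if (m1 == a) && (m2 == b) then p@_a * q@_b else 0)).
  apply: eq_big_seq => m1 h1; apply: eq_big_seq => m2 h2.
  rewrite mcoeffZ mcoeffX; case: ifP => [/andP[/eqP -> /eqP ->]|h]; first by rewrite eqxx mulr1.
  case: eqP => [/(key _ _ h1 h2)[e1 e2]|]; last by rewrite mulr0.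
  by rewrite e1 e2 !eqxx in h.
have [ap|/memN_msupp_eq0 ->] := boolP (a \in msupp p); last first.
  by rewrite mul0r big1 // => ? _; rewrite big1 // => ? _; case: ifP.
have [bq|/memN_msupp_eq0 ->] := boolP (b \in msupp q); last first.
  by rewrite mulr0 big1 // => ? _; rewrite big1 // => ? _; case: ifP.
rewrite (bigD1_seq a) ?msupp_uniq //= (bigD1_seq b) ?msupp_uniq //= !eqxx /=.
rewrite !big1 ?addr0 //.
  by move=> i /negPf ->; rewrite big1 // => ? _.
by move=> i /negPf ->.
Qed.

Lemma degle0 r : degle r 0.
Proof. by move=> m; rewrite msupp0. Qed.

Lemma degleD r p q : degle r p -> degle r q -> degle r (p + q).
Proof. by move=> hp hq m /msuppD_le; rewrite mem_cat => /orP[/hp|/hq]. Qed.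

Lemma degleZ r c p : degle r p -> degle r (c *: p).
Proof. by move=> hp m /msuppZ_le /hp. Qed.

Lemma degleM r1 r2 p q : degle r1 p -> degle r2 q -> degle (fun i => r1 i + r2 i)%N (p * q).
Proof.
move=> hp hq m /msuppM_le /allpairsP[[a b] /= [/hp ha /hq hb ->]] i.
by rewrite mnmDE leq_add.
Qed.

Lemma degle1 r : degle r 1.
Proof. by move=> m; rewrite msupp1 inE => /eqP -> i; rewrite mnm0E. Qed.

Lemma degle_derivm r p mu : degle r p -> degle r p^`M[mu].
Proof.
move=> hp m; rewrite mcoeff_msupp mcoeff_mderivm => h i.
have : (mu + m)%MM \in msupp p by rewrite mcoeff_msupp; apply: contraNneq h => ->; rewrite mul0rn.
by move/hp/(_ i); rewrite mnmDE; apply: leq_trans; rewrite leq_addl.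
Qed.

Lemma degle_sum r (I : Type) (s : seq I) (P : pred I) (F : I -> {mpoly R[n]}) :
  (forall i, P i -> degle r (F i)) -> degle r (\sum_(i <- s | P i) F i).
Proof. by move=> h; apply: big_ind => //; [exact: degle0 | exact: degleD]. Qed.

Lemma degle_prod r (I : finType) (F : I -> {mpoly R[n]}) :
  (forall i, degle r (F i)) -> degle (fun i => #|I| * r i)%N (\prod_i F i).
Proof.
move=> h; rewrite cardE; rewrite -[\prod_i _]big_enum /=.
elim: (enum I) => [|x s ih]; first by rewrite big_nil; exact: degle1.
rewrite big_cons => m hm i /=; rewrite mulSn.
by have := degleM (h x) ih hm i.
Qed.

Lemma degle_det r l (A : 'M[{mpoly R[n]}]_l) :
  (forall i j, degle r (A i j)) -> degle (fun i => l * r i)%N (\det A).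
Proof.
move=> h; apply: degle_sum => s _.
have hp : degle (fun i => l * r i)%N (\prod_i A i (s i)).
  by have := @degle_prod r 'I_l (fun i => A i (s i)) (fun i => h _ _); rewrite card_ord.
by case: (odd_perm s); rewrite ?expr1 ?expr0 ?mul1r // mulN1r -scaleN1r; apply: degleZ.
Qed.

End Support.

Section Hasse.
Variable n : nat.
Implicit Types (p q : {mpoly rat[n]}) (mu : 'X_{1..n}).

Definition mfact mu := (\prod_i (mu i)`!)%N.
(** Division by [mu!] turns the factors produced by differentiation into binomials, so integral
    polynomials stay integral and norms grow by at most a power of 2. *)
Definition hder mu p : {mpoly rat[n]} := (mfact mu)%:R^-1 *: p^`M[mu].
Definition mbin (m mu : 'X_{1..n}) := (\prod_i 'C(m i, mu i))%N.

Lemma mfact_neq0 mu : (mfact mu)%:R != 0 :> rat.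
Proof. by rewrite pnatr_eq0 -lt0n prodn_gt0 // => i; exact: fact_gt0. Qed.

Lemma ffact_mbin (m mu : 'X_{1..n}) :
  (\prod_i (m i) ^_ (mu i) = mbin m mu * mfact mu)%N.
Proof. by rewrite -big_split; apply: eq_bigr => i _ /=; rewrite bin_ffact. Qed.

Lemma mcoeff_hder mu p m : (hder mu p)@_m = (mbin (mu + m) mu)%:R * p@_(mu + m).
Proof.
rewrite mcoeffZ mcoeff_mderivm ffact_mbin mulrnA -(mulr_natl (_ *+ _) (mfact mu)) mulKf ?mfact_neq0 //.
by rewrite mulr_natl.
Qed.

Lemma hderE mu p :
  hder mu p = \sum_(m <- msupp p) ((mbin m mu)%:R * p@_m) *: 'X_[m - mu].
Proof.
rewrite /hder [in LHS](mpolyE p) raddf_sum scaler_sumr; apply: eq_bigr => m _ /=.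
rewrite mderivmZ mderivmX ffact_mbin !scalerA natrM; congr (_ *: _).
have := mfact_neq0 mu; set x := (mfact _)%:R => x0; field; exact: x0.
Qed.

Lemma hder_is_linear mu : linear (hder mu).
Proof. by move=> c p q; rewrite /hder mderivmD mderivmZ scalerDr !scalerA [c * _]mulrC. Qed.
HB.instance Definition _ mu := GRing.isLinear.Build rat {mpoly rat[n]} {mpoly rat[n]} _ (hder mu) (hder_is_linear mu).

Lemma mfactD1 mu i : mfact (mu + U_(i)) = ((mu i).+1 * mfact mu)%N.
Proof.
rewrite /mfact (bigD1 i) //= [in RHS](bigD1 i) //= mnmDE mnm1E eqxx addn1 factS mulnA; congr (_ * _)%N.
by apply: eq_bigr => j /negPf ji; rewrite mnmDE mnm1E eq_sym ji addn0.
Qed.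

Lemma mderiv_hder mu i p : (hder mu p)^`M(i) = (mu i).+1%:R *: hder (mu + U_(i)) p.
Proof.
rewrite /hder mderivZ scalerA mfactD1 natrM invfM mulrA mulfV ?pnatr_eq0 // mul1r.
by rewrite mderivmDm mderivmU1m.
Qed.

Lemma hder0 p : hder 0%MM p = p.
Proof.
rewrite /hder mderivm0m /mfact big1 ?invr1 ?scale1r // => i _.
by rewrite mnm0E.
Qed.

Lemma onlyv_hder A mu p : onlyv A p -> onlyv A (hder mu p).
Proof. by move=> h; apply/onlyvZ/onlyv_derivm. Qed.

Lemma degle_hder r mu p : degle r p -> degle r (hder mu p).
Proof. by move=> h; apply/degleZ/degle_derivm. Qed.

Lemma hder_eq0 A mu p i : onlyv A p -> ~~ A i -> (0 < mu i)%N -> hder mu p = 0.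
Proof.
move=> hp Ai mi; apply/mpolyP=> m; rewrite mcoeff_hder mcoeff0.
have [/hp/(_ i Ai)|/memN_msupp_eq0 -> //] := boolP ((mu + m)%MM \in msupp p); last by rewrite mulr0.
by rewrite mnmDE; case: (mu i) mi.
Qed.

Lemma mderivm_mul_sep A mu p q :
  (forall i, ~~ A i -> mu i = 0%N) -> onlyv (predC A) q -> (p * q)^`M[mu] = p^`M[mu] * q.
Proof.
move=> hmu hq.
have h1 i x : A i -> (x * q)^`M(i) = x^`M(i) * q.
  by move=> Ai; rewrite mderivM (onlyv_deriv0 hq) ?mulr0 ?addr0 //= negbK.
rewrite !mderivm_foldr /=.
have : all A (flatten [seq nseq (mu i) i | i <- enum 'I_n]).
  apply/allP=> i /flatten_mapP[j _ /nseqP[-> mj]].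
  by apply: contraLR mj => /hmu ->.
elim: flatten => //= i s ih /andP[Ai /ih ->]; exact: h1.
Qed.

Lemma hder_mul_sep A mu p q :
  (forall i, ~~ A i -> mu i = 0%N) -> onlyv (predC A) q -> hder mu (p * q) = hder mu p * q.
Proof. by move=> h1 h2; rewrite /hder (mderivm_mul_sep _ h1 h2) scalerAl. Qed.

End Hasse.

Section Norm.
Variable n : nat.
Implicit Types (p q : {mpoly rat[n]}) (mu : 'X_{1..n}).

(** The sum, not the maximum, of the absolute values: it is submultiplicative with constant 1,
    whatever the number of monomials. *)
Definition nrm p : rat := \sum_(m <- msupp p) `|p@_m|.
Definition intm p := forall m, p@_m \is a Num.int.

Lemma nrm_ge0 p : 0 <= nrm p.
Proof. exact: sumr_ge0. Qed.

Lemma nrm_sub p s : uniq s -> {subset msupp p <= s} -> nrm p = \sum_(m <- s) `|p@_m|.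
Proof.
move=> us ps; rewrite /nrm [in RHS](bigID (mem (msupp p)) predT) /=.
rewrite [in RHS]addrC [in RHS]big1 => [|m /memN_msupp_eq0 ->]; last by rewrite normr0.
rewrite add0r -[in RHS]big_filter; apply: perm_big; apply: uniq_perm.
- exact: msupp_uniq.
- exact: filter_uniq.
by move=> m; rewrite mem_filter andb_idr // => /ps.
Qed.

Lemma nrmD p q : nrm (p + q) <= nrm p + nrm q.
Proof.
pose s := undup (msupp p ++ msupp q).
have us : uniq s by exact: undup_uniq.
rewrite (@nrm_sub p s) ?(@nrm_sub q s) ?(@nrm_sub (p + q) s) //.
- by rewrite -big_split /=; apply: ler_sum => m _; rewrite mcoeffD ler_normD.
- by move=> m /msuppD_le; rewrite mem_undup.
- by move=> m hm; rewrite mem_undup mem_cat hm orbT.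
- by move=> m hm; rewrite mem_undup mem_cat hm.
Qed.

Lemma nrm0 : nrm 0 = 0.
Proof. by rewrite /nrm msupp0 big_nil. Qed.

Lemma nrmX mu : nrm 'X_[mu] = 1.
Proof. by rewrite /nrm msuppX big_seq1 mcoeffX eqxx normr1. Qed.

Lemma nrmZ c p : nrm (c *: p) = `|c| * nrm p.
Proof.
rewrite (@nrm_sub _ (msupp p)) ?msupp_uniq // => [|m /msuppZ_le //].
by rewrite /nrm mulr_sumr; apply: eq_bigr => m _; rewrite mcoeffZ normrM.
Qed.

Lemma nrmN p : nrm (- p) = nrm p.
Proof. by rewrite -[- p](@scaleN1r rat) nrmZ normrN1 mul1r. Qed.

Lemma nrm_sum (I : Type) (s : seq I) (P : pred I) (F : I -> {mpoly rat[n]}) :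
  nrm (\sum_(i <- s | P i) F i) <= \sum_(i <- s | P i) nrm (F i).
Proof.
elim/big_rec2: _ => [|i x p _ h]; first by rewrite nrm0.
by apply: le_trans (nrmD _ _) _; rewrite lerD2l.
Qed.

Lemma nrmM p q : nrm (p * q) <= nrm p * nrm q.
Proof.
rewrite mpolyME; apply: le_trans (nrm_sum _ _ _) _.
rewrite big_allpairs /nrm mulr_suml; apply: ler_sum => a _.
rewrite mulr_sumr; apply: ler_sum => b _.
by rewrite -/(nrm _) /= nrmZ nrmX mulr1 normrM.
Qed.

Lemma nrm1 : nrm 1 = 1.
Proof. by rewrite -mpolyX0 nrmX. Qed.

Lemma nrm_prod (I : finType) (F : I -> {mpoly rat[n]}) c :
  (forall i, nrm (F i) <= c) -> nrm (\prod_i F i) <= c ^+ #|I|.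
Proof.
move=> h; rewrite -prodr_const; elim/big_rec2: _ => [|i x p _ ih]; first by rewrite nrm1.
by apply: le_trans (nrmM _ _) _; rewrite ler_pM ?nrm_ge0.
Qed.

Lemma nrm_det l (A : 'M[{mpoly rat[n]}]_l) c :
  (forall i j, nrm (A i j) <= c) -> nrm (\det A) <= l`!%:R * c ^+ l.
Proof.
move=> h; apply: le_trans (nrm_sum _ _ _) _.
have e (s : 'S_l) : nrm ((-1) ^+ s * \prod_i A i (s i)) <= c ^+ l.
  have := @nrm_prod 'I_l (fun i => A i (s i)) c (fun i => h _ _); rewrite card_ord.
  by case: (odd_perm s); rewrite ?expr1 ?expr0 ?mul1r // mulN1r nrmN.
apply: le_trans (ler_sum _ (fun s _ => e s)) _.
by rewrite sumr_const card_Sn mulr_natl.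
Qed.

Lemma mbin_le r (m mu : 'X_{1..n}) : (forall i, m i <= r i)%N -> (mbin m mu <= 2 ^ \sum_i r i)%N.
Proof.
move=> h; rewrite expn_sum; apply: leq_prod => i _.
apply: (@leq_trans (2 ^ m i)); last by rewrite leq_exp2l.
have [hm|hm] := leqP (mu i) (m i); last by rewrite bin_small.
have := expnDn 1 1 (m i); rewrite addn1 /= => ->.
rewrite (bigD1 (Ordinal (hm : mu i < (m i).+1))%N) //= !exp1n !muln1.
exact: leq_addr.
Qed.

Lemma nrm_hder r mu p : degle r p -> nrm (hder mu p) <= 2 ^+ (\sum_i r i)%N * nrm p.
Proof.
move=> hr; rewrite hderE; apply: le_trans (nrm_sum _ _ _) _.
rewrite /nrm mulr_sumr big_seq [leRHS]big_seq; apply: ler_sum => m hm.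
rewrite -/(nrm _) nrmZ nrmX mulr1 normrM ler_wpM2r // normr_nat -natrX ler_nat.
exact: mbin_le (hr _ hm).
Qed.

Lemma intm_hder mu p : intm p -> intm (hder mu p).
Proof. by move=> h m; rewrite mcoeff_hder rpredM ?h // Num.Theory.natr_int. Qed.

Lemma intm_det l (A : 'M[{mpoly rat[n]}]_l) :
  (forall i j, intm (A i j)) -> intm (\det A).
Proof.
move=> h; rewrite /determinant; apply: big_ind => [m|p q hp hq m|s _].
- by rewrite mcoeff0 rpred0.
- by rewrite mcoeffD rpredD.
have hs : intm (\prod_i A i (s i)).
  apply: big_ind => // [m|p q hp hq m].
    by rewrite mcoeff1 Num.Theory.natr_int.
  by rewrite mcoeffM rpred_sum // => k _; rewrite rpredM.
by case: (odd_perm s) => m; rewrite ?expr1 ?expr0 ?mul1r // mulN1r mcoeffN rpredN.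
Qed.

End Norm.

Section Index.
Variables (n : nat) (K : fieldType) (iota : {rmorphism rat -> K}) (beta : 'I_n -> K).
Implicit Types (p q : {mpoly rat[n]}) (mu : 'X_{1..n}).

(* The expansion of [p] at the point [beta]: its coefficients are the values at [beta] of the
   divided derivatives [hder]. *)
Definition tay p : {mpoly K[n]} :=
  mmap (@mpolyC n K \o iota) (fun i => 'X_i + (beta i)%:MP) p.

HB.instance Definition _ := GRing.RMorphism.copy tay
  (mmap (@mpolyC n K \o iota) (fun i => 'X_i + (beta i)%:MP)).

Lemma tayZ c p : tay (c *: p) = iota c *: tay p.
Proof. by rewrite /tay mmapZ /= mul_mpolyC. Qed.

Lemma tayXU i : tay 'X_i = 'X_i + (beta i)%:MP.
Proof. by rewrite /tay mmapX mmap1U. Qed.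

Lemma tayC c : tay c%:MP = (iota c)%:MP.
Proof. by rewrite /tay mmapC. Qed.

Lemma mpoly_gen (Q : {mpoly rat[n]} -> Prop) :
  (forall c, Q c%:MP) -> (forall i, Q 'X_i) -> (forall p q, Q p -> Q q -> Q (p + q)) ->
  (forall p q, Q p -> Q q -> Q (p * q)) -> forall p, Q p.
Proof.
move=> hc hX hD hM p; rewrite (mpolyE p).
have h0 : Q 0 by rewrite -mpolyC0.
have h1 : Q 1 by rewrite -mpolyC1.
apply: big_ind => // m _; rewrite -mul_mpolyC; apply: (hM) => //.
rewrite mpolyXE_id; apply: (big_ind Q h1 hM) => i _.
by elim: (m i) => [|k ih]; rewrite ?expr0 // exprS; apply: (hM).
Qed.

Lemma tay_deriv i p : tay p^`M(i) = (tay p)^`M(i).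
Proof.
elim/mpoly_gen: p => [c|j|p q hp hq|p q hp hq].
- by rewrite mderivC tayC mderivC rmorph0.
- rewrite tayXU mderivD mderivC addr0 !mderivX scaler_nat raddfMn /=.
  rewrite mnm1E; case: eqP => [->|_]; last by rewrite mulr0n scale0r.
  have -> : (U_(i) - U_(i))%MM = 0%MM :> 'X_{1..n} by apply/mnmP=> k; rewrite mnmBE mnm0E subnn.
  by rewrite !mpolyX0 rmorph1 scale1r.
- by rewrite !raddfD /= hp hq.
- by rewrite mderivM rmorphD !rmorphM /= hp hq mderivM.
Qed.

Lemma tay_derivm mu p : tay p^`M[mu] = (tay p)^`M[mu].
Proof.
rewrite !mderivm_foldr /=; elim: flatten => //= i s ih.
by rewrite tay_deriv ih.
Qed.

Lemma mcoeff_tay_hder mu p m :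
  (tay (hder mu p))@_m = (mbin (mu + m) mu)%:R * (tay p)@_(mu + m).
Proof.
rewrite tayZ tay_derivm mcoeffZ mcoeff_mderivm ffact_mbin mulrnA fmorphV rmorph_nat.
rewrite -(mulr_natl (_ *+ _) (mfact mu)) mulKf ?mulr_natl //.
by rewrite -(rmorph_nat iota) fmorph_eq0 mfact_neq0.
Qed.

Lemma tay_hder0 mu p : (tay (hder mu p))@_0 = (tay p)@_mu.
Proof.
rewrite mcoeff_tay_hder addm0 /mbin big1 ?mul1r // => i _.
by rewrite binn.
Qed.

Lemma onlyv_tay A p : onlyv A p -> onlyv A (tay p).
Proof.
move=> hp; rewrite /tay /mmap big_seq; apply: onlyv_sum => m hm /=.
apply: onlyvM; first exact: onlyvC.
apply: onlyv_prod => i _; have [Ai|Ai] := boolP (A i).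
  apply/onlyv_exp/onlyvD; last exact: onlyvC.
  by apply: onlyvX => j; rewrite mnm1E; case: eqP => // <-; rewrite Ai.
by rewrite (hp m hm i Ai) expr0; exact: onlyvC.
Qed.

Lemma meval_tay (x : 'I_n -> K) p :
  (tay p).@[x] = \sum_(m <- msupp p) iota p@_m * \prod_i (x i + beta i) ^+ m i.
Proof.
rewrite /tay /mmap rmorph_sum; apply: eq_bigr => m _ /=.
rewrite rmorphM /= mevalC; congr (_ * _); rewrite /mmap1 rmorph_prod.
by apply: eq_bigr => i _; rewrite rmorphXn rmorphD /= mevalXU mevalC.
Qed.

Section Weight.
Variable r : 'I_n -> nat.

Definition wt mu : rat := \sum_i (mu i)%:R / (r i)%:R.
(* The index of [p] at [beta], relative to the degrees [r], is at least [th]. *)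
Definition indge th p := forall m, wt m < th -> (tay p)@_m = 0.

Lemma wtD m1 m2 : wt (m1 + m2) = wt m1 + wt m2.
Proof. by rewrite /wt -big_split; apply: eq_bigr => i _ /=; rewrite mnmDE natrD mulrDl. Qed.

Lemma wt_ge0 m : 0 <= wt m.
Proof. by apply: sumr_ge0 => i _; rewrite divr_ge0. Qed.

Lemma wt0 : wt 0 = 0.
Proof. by rewrite /wt big1 // => i _; rewrite mnm0E mul0r. Qed.

Lemma indge_neg th p : th <= 0 -> indge th p.
Proof. by move=> h m /lt_le_trans/(_ (le_trans h (wt_ge0 m))); rewrite ltxx. Qed.

Lemma indgeD th p q : indge th p -> indge th q -> indge th (p + q).
Proof. by move=> hp hq m h; rewrite rmorphD mcoeffD hp ?hq ?addr0. Qed.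

Lemma indgeN th p : indge th p -> indge th (- p).
Proof. by move=> hp m h; rewrite rmorphN mcoeffN hp ?oppr0. Qed.

Lemma indgeM th1 th2 p q : indge th1 p -> indge th2 q -> indge (th1 + th2) (p * q).
Proof.
move=> hp hq m h; rewrite rmorphM mcoeffM big1 // => -[a b] /= /eqP e.
have [ha|ha] := ltP (wt a) th1; first by rewrite hp ?mul0r.
rewrite [X in _ * X]hq ?mulr0 //.
have ew : wt m = wt a + wt b by rewrite -wtD -e.
by move: h; rewrite ew => h; lra.
Qed.

Lemma indge_prod (I : finType) (th : I -> rat) (F : I -> {mpoly rat[n]}) :
  (forall i, indge (th i) (F i)) -> indge (\sum_i th i) (\prod_i F i).
Proof.
move=> h; elim/big_rec2: _ => [|i p th' _ ih]; first exact: indge_neg.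
exact: indgeM.
Qed.

(** Every Leibniz term takes one entry from each row, so bounds that depend on the row alone add
    up. *)
Lemma indge_det l (th : 'I_l -> rat) (A : 'M[{mpoly rat[n]}]_l) :
  (forall i j, indge (th i) (A i j)) -> indge (\sum_i th i) (\det A).
Proof.
move=> h; rewrite /determinant; apply: big_ind => [m _|p q|s _].
- by rewrite rmorph0 mcoeff0.
- exact: indgeD.
have hs := indge_prod (fun i => h i (s i)).
by case: (odd_perm s); rewrite ?expr1 ?expr0 ?mul1r // mulN1r; apply: indgeN.
Qed.

Lemma indge_hder th mu p : indge th p -> indge (th - wt mu) (hder mu p).
Proof.
by move=> hp m h; rewrite mcoeff_tay_hder hp ?mulr0 // wtD -ltrBrDl.
Qed.

End Weight.
End Index.

Local Open Scope quotient_scope.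

Lemma fraction_num (R : idomainType) (x : {fraction R}) :
  exists2 d : R, d != 0 & exists a : R, FracField.tofrac d * x = FracField.tofrac a.
Proof.
elim/quotW: x => r; exists \d_r; first exact: denom_ratioP.
exists \n_r; unlock FracField.tofrac; rewrite -[LHS]FracField.pi_mul.
apply/eqmodP; rewrite /= FracField.equivfE /FracField.mulf.
by rewrite !numden_Ratio ?mul1r ?mulr1 ?oner_neq0 ?denom_ratioP // mulrC.
Qed.

Lemma fraction_common_denominator (R : idomainType) l (c : 'I_l -> {fraction R}) :
  exists2 d : R, d != 0 & exists a : 'I_l -> R, forall j,
    FracField.tofrac d * c j = FracField.tofrac (a j).
Proof.
have h j : exists da : R * R, da.1 != 0 /\ FracField.tofrac da.1 * c j = FracField.tofrac da.2.
  by have [d d0 [a e]] := fraction_num (c j); exists (d, a).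
have [f hf] := fin_all_exists h.
exists (\prod_j (f j).1); first by apply/prodf_neq0 => j _; have [] := hf j.
exists (fun j => (\prod_(i | i != j) (f i).1) * (f j).2) => j.
by rewrite (bigD1 j) //= mulrC !tofracM mulrCA -(hf j).2; ring.
Qed.

(** * Generalized Wronskians *)

Section Wronskian.
Variable n : nat.
Implicit Types (mu : 'X_{1..n}).

Lemma msize_deriv (R : comNzRingType) (p : {mpoly R[n]}) i : p != 0 -> (msize p^`M(i) < msize p)%N.
Proof.
move=> p0; rewrite (mpolySpred _ p0) ltnS msizeE; apply/bigmax_leqP_seq => m.
rewrite mcoeff_msupp mcoeff_deriv => h _.
have /msize_mdeg_lt : (m + U_(i))%MM \in msupp p.
  by rewrite mcoeff_msupp; apply: contraNneq h => ->; rewrite mul0rn.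
by rewrite mdegD mdeg1 addn1 (mpolySpred _ p0).
Qed.

Lemma mderiv_neq0 (p : {mpoly rat[n]}) : (1 < msize p)%N -> exists i, p^`M(i) != 0.
Proof.
move=> hp; have p0 : p != 0 by rewrite -msize_poly_eq0; case: (msize p) hp.
have e := mlead_deg p0.
have : mdeg (mlead p) != 0%N by rewrite -lt0n -ltnS e.
rewrite mdeg_eq0 => m0.
have [i hi] : exists i, (0 < mlead p i)%N.
  apply/existsP; apply: contraR m0 => /existsPn h; apply/eqP/mnmP=> i.
  by rewrite mnm0E; have := h i; rewrite -eqn0Ngt => /eqP.
exists i; apply/eqP => /mpolyP/(_ (mlead p - U_(i))%MM).
rewrite mcoeff_deriv mcoeff0 submK ?lep1mP -?lt0n // -mulr_natr => /eqP.
by rewrite mulf_eq0 mleadc_eq0 (negPf p0) pnatr_eq0.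
Qed.

(* If no row of order [<= k] extends the independent rows, the polynomial vectors annihilated by
   these rows are stable under all derivations, hence contain a nonzero constant vector. *)
Lemma wronskian_extend l k (phi : 'I_l -> {mpoly rat[n]}) (mu : nat -> 'X_{1..n}) :
  (forall c : 'I_l -> rat, \sum_j c j *: phi j = 0 -> forall j, c j = 0) ->
  (k < l)%N -> (forall i, (i < k)%N -> (mdeg (mu i) <= i)%N) ->
  exists2 m, (mdeg m <= k)%N &
   ~~ (\row_j FracField.tofrac (hder m (phi j)) <=
       \matrix_(i < k, j < l) FracField.tofrac (hder (mu i) (phi j)))%MS.
Proof.
move=> indep kl hmu; set A := \matrix_(i, j) _.
have [/existsP[m hm]|/existsPn hno] :=
    boolP [exists m : 'X_{1..n < k.+1}, ~~ (\row_j FracField.tofrac (hder m (phi j)) <= A)%MS].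
  by exists m => //; have := bmdeg m.
exfalso.
have hspan m : (mdeg m <= k)%N -> (\row_j FracField.tofrac (hder m (phi j)) <= A)%MS.
  by move=> hm; have := hno (BMultinom (hm : (mdeg m < k.+1)%N)); rewrite negbK.
pose X (c : 'I_l -> {mpoly rat[n]}) :=
  forall i, (i < k)%N -> \sum_j hder (mu i) (phi j) * c j = 0.
have hX c m : X c -> (mdeg m <= k)%N -> \sum_j hder m (phi j) * c j = 0.
  move=> Xc /hspan/submxP[D e]; apply/eqP; rewrite -tofrac_eq0 rmorph_sum /=.
  have Ac : A *m \col_j FracField.tofrac (c j) = 0.
    apply/matrixP=> i z; rewrite !mxE.
    transitivity (FracField.tofrac (\sum_j hder (mu i) (phi j) * c j)).
      by rewrite rmorph_sum; apply: eq_bigr => j _; rewrite /= rmorphM !mxE.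
    by rewrite Xc // tofrac0.
  have := congr1 (fun B => (B *m \col_j FracField.tofrac (c j)) 0 0) e.
  rewrite -mulmxA Ac mulmx0 !mxE => e'; apply/eqP; rewrite -[RHS]e'.
  by apply: eq_bigr => j _; rewrite /= rmorphM !mxE.
(* Differentiating the relation for [mu a] gives the relation for [mu a + U_(i)], of order at most
   [k] and hence valid by [hX], plus the relation for the differentiated vector. *)
have Xd c i : X c -> X (fun j => (c j)^`M(i)).
  move=> Xc a ak; have := congr1 (mderiv i) (Xc a ak).
  rewrite raddf_sum mderiv0 /= => e.
  have := hX c (mu a + U_(i))%MM Xc.
  rewrite mdegD mdeg1 addn1 => /(_ (leq_ltn_trans (hmu a ak) ak)) e2.
  transitivity (\sum_j (hder (mu a) (phi j) * c j)^`M(i) -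
      (mu a i).+1%:R *: \sum_j hder (mu a + U_(i)) (phi j) * c j).
    rewrite scaler_sumr -sumrB; apply: eq_bigr => j _.
    by rewrite mderivM mderiv_hder scalerAl [X in X - _]addrC addrK.
  by rewrite e e2 scaler0 subr0.
(* Fewer rows than columns give a nonzero kernel vector over the fraction field; its denominators
   are then cleared. *)
have [c Xc [j0 cj0]] : exists2 c, X c & exists j, c j != 0.
  have : cokermx A != 0.
    rewrite cokermx_eq0; apply: contraTneq kl => <-.
    by rewrite -leqNgt rank_leq_row.
  case/matrix0Pn => i0 [j1 h0].
  have [d d0 [c hc]] := fraction_common_denominator (fun i => cokermx A i j1).
  exists c; last first.
    exists i0; rewrite -tofrac_eq0 -hc mulf_neq0 // tofrac_eq0 //.
  move=> i ik; apply/eqP; rewrite -tofrac_eq0 rmorph_sum; apply/eqP.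
  have /matrixP/(_ (Ordinal ik) j1) := mulmx_coker A; rewrite !mxE => /(congr1 ( *%R (FracField.tofrac d))).
  rewrite mulr0 mulr_sumr => e; rewrite -[RHS]e; apply: eq_bigr => j _.
  by rewrite rmorphM /= -hc !mxE; ring.
(* Descent on the sum of the sizes: a nonconstant entry can be differentiated without killing the
   vector, so a constant vector is reached, and order 0 then contradicts the independence of
   [phi]. *)
have : exists N, (\sum_j msize (c j) <= N)%N by exists (\sum_j msize (c j))%N.
case=> N; elim: N c Xc j0 cj0 => [|N ih] c Xc j0 cj0 hN.
  by move: cj0 hN; rewrite leqn0 sum_nat_eq0 -msize_poly_eq0 => /negPf h /forallP/(_ j0); rewrite h.
have [/existsP[j1 hj1]|/existsPn hc] := boolP [exists j, 1 < msize (c j)]%N.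
  have [i hi] := mderiv_neq0 hj1.
  apply: (ih (fun j => (c j)^`M(i)) (Xd _ _ Xc) j1 hi).
  rewrite -ltnS; apply: leq_trans hN; rewrite (bigD1 j1) //= [X in (_ < X)%N](bigD1 j1) //=.
  rewrite -addSn; apply: leq_add.
    by apply: msize_deriv; apply: contraTneq hj1 => ->; rewrite msize0.
  apply: leq_sum => j _; have [->|nz] := eqVneq (c j) 0; first by rewrite mderiv0.
  exact/ltnW/msize_deriv.
have e j : c j = ((c j)@_0)%:MP by apply: msize1_polyC; rewrite leqNgt hc.
have := hX c 0%MM Xc; rewrite mdeg0 => /(_ isT) h0.
case/eqP: cj0; rewrite e (indep (fun j => (c j)@_0)) ?mpolyC0 // -[RHS]h0.
by apply: eq_bigr => j _; rewrite hder0 [in RHS]e mulrC mul_mpolyC.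
Qed.

(** Rows are added one at a time by [wronskian_extend]; the bound [i] on the order of row [i]
    controls the loss of index in Roth's induction. *)
Lemma generalized_wronskian l (phi : 'I_l -> {mpoly rat[n]}) :
  (forall c : 'I_l -> rat, \sum_j c j *: phi j = 0 -> forall j, c j = 0) ->
  exists2 mu : 'I_l -> 'X_{1..n}, (forall i, mdeg (mu i) <= i)%N &
    \det (\matrix_(i, j) hder (mu i) (phi j)) != 0.
Proof.
move=> indep.
have [mu hmu hfree] : exists2 mu : nat -> 'X_{1..n}, (forall i, (i < l)%N -> mdeg (mu i) <= i)%N &
    row_free (\matrix_(i < l, j < l) FracField.tofrac (hder (mu i) (phi j))).
  have : forall k, (k <= l)%N -> exists2 mu : nat -> 'X_{1..n}, (forall i, (i < k)%N -> mdeg (mu i) <= i)%N &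
      row_free (\matrix_(i < k, j < l) FracField.tofrac (hder (mu i) (phi j))).
    elim=> [|k ih] kl.
      by exists (fun=> 0%MM) => //; apply: inj_row_free => v _; apply/matrixP=> ? [].
    have [mu hmu hfree] := ih (ltnW kl).
    have [m hm hrow] := wronskian_extend indep kl hmu.
    pose mu' i := if (i < k)%N then mu i else m.
    exists mu' => [i ik|].
      rewrite /mu'; case: ltnP => [/hmu //|ki].
      exact: leq_trans hm ki.
    apply: inj_row_free => v hv.
    set A := \matrix_(i < k, j < l) _ in hfree hrow.
    pose w : 'rV_k := \row_i v 0 (widen_ord (leqnSn k) i).
    have e : w *m A + v 0 ord_max *: (\row_j FracField.tofrac (hder m (phi j))) = 0.
      apply/rowP=> j; have /rowP/(_ j) := hv; rewrite !mxE big_ord_recr /= => e; rewrite -[RHS]e.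
      congr (_ + _); last by rewrite !mxE /mu' ltnn.
      by apply: eq_bigr => i _; rewrite !mxE /mu' /= ltn_ord.
    have v0 : v 0 ord_max = 0.
      apply/eqP; apply: contraNT hrow => v0; apply/submxP; exists (- (v 0 ord_max)^-1 *: w).
      have /eqP := e; rewrite addrC addr_eq0 => /eqP e'.
      by rewrite -scalemxAl scaleNr -scalerN -e' scalerA mulVf // scale1r.
    have w0 : w = 0.
      by apply: (row_free_inj hfree); rewrite mul0mx -[RHS]e v0 scale0r addr0.
    apply/rowP=> i; rewrite mxE; have [ik|] := ltnP i k.
      have /rowP/(_ (Ordinal ik)) := w0; rewrite !mxE => e'; rewrite -[RHS]e'; congr (v _ _).
      exact: val_inj.
    move=> ki; rewrite -[RHS]v0; congr (v _ _); apply: val_inj => /=.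
    by apply/eqP; rewrite eqn_leq ki -ltnS ltn_ord.
  by apply.
exists (fun i : 'I_l => mu i) => [i|]; first exact: hmu.
rewrite -tofrac_eq0 -det_map_mx -unitfE -unitmxE -row_free_unit.
by congr (is_true (row_free _)): hfree; apply/matrixP=> i j; rewrite !mxE.
Qed.

End Wronskian.

(** * Decompositions separating one variable from the others *)

Section Decomposition.
Variables (n : nat).
Implicit Types (P : {mpoly rat[n]}) (G : {mpoly rat[n]} -> Prop).

Definition lin_closed G := forall c p q, G p -> G q -> G (p + c *: q).
Definition lin_indep l (phi : 'I_l -> {mpoly rat[n]}) :=
  forall c : 'I_l -> rat, \sum_j c j *: phi j = 0 -> forall j, c j = 0.

(** A linear relation expresses one [phi j0] through the others; substituting it drops a term and
    adds multiples of [psi j0] to the remaining [psi]. *)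
Lemma decomposition_shrink G1 G2 P l (phi psi : 'I_l.+1 -> {mpoly rat[n]}) :
  lin_closed G2 -> (forall j, G1 (phi j)) -> (forall j, G2 (psi j)) ->
  P = \sum_j phi j * psi j -> ~ lin_indep phi ->
  exists phi' psi' : 'I_l -> {mpoly rat[n]},
    [/\ forall j, G1 (phi' j), forall j, G2 (psi' j) & P = \sum_j phi' j * psi' j].
Proof.
move=> cl h1 h2 eP dep.
have [c hdep] := not_all_ex_not _ _ dep.
have [hc hn] := imply_to_and _ _ hdep.
have [j0 /eqP cj0] := not_all_ex_not _ _ hn.
exists (fun i => phi (lift j0 i)).
exists (fun i => psi (lift j0 i) + (- (c (lift j0 i) / c j0)) *: psi j0).
split=> [j|j|]; [exact: h1 | exact: cl|].
have e : phi j0 = - \sum_i (c (lift j0 i) / c j0) *: phi (lift j0 i).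
  apply/eqP; rewrite -addr_eq0; apply/eqP.
  have := congr1 (fun x => (c j0)^-1 *: x) hc; rewrite scaler0 (bigD1_ord j0) //=.
  rewrite scalerDr scalerA mulVf // scale1r => h; rewrite -[RHS]h; congr (_ + _).
  by rewrite scaler_sumr; apply: eq_bigr => i _; rewrite scalerA mulrC.
rewrite eP (bigD1_ord j0) //= e mulNr mulr_suml -sumrN -big_split /=.
by apply: eq_bigr => i _; rewrite mulrDr addrC scaleNr mulrN -scalerAl -scalerAr.
Qed.

(** Both families must be independent, because a Wronskian is taken of each. *)
Lemma decomposition_indep G1 G2 P l (phi psi : 'I_l -> {mpoly rat[n]}) :
  lin_closed G1 -> lin_closed G2 -> (forall j, G1 (phi j)) -> (forall j, G2 (psi j)) ->
  P = \sum_j phi j * psi j ->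
  exists l', exists phi' psi' : 'I_l' -> {mpoly rat[n]},
    [/\ (l' <= l)%N, forall j, G1 (phi' j), forall j, G2 (psi' j), P = \sum_j phi' j * psi' j
      & lin_indep phi' /\ lin_indep psi'].
Proof.
move=> c1 c2; elim: l phi psi => [|l ih] phi psi h1 h2 eP.
  by exists 0%N, phi, psi; split=> //; split=> c _ [].
case: (classic (lin_indep phi)) => hphi; last first.
  have [phi' [psi' [h1' h2' eP']]] := decomposition_shrink c2 h1 h2 eP hphi.
  have [l' [phi'' [psi'' [hl ? ? ? ?]]]] := ih _ _ h1' h2' eP'.
  by exists l', phi'', psi''; split=> //; exact: leq_trans hl _.
case: (classic (lin_indep psi)) => hpsi; last first.
  have eP2 : P = \sum_j psi j * phi j by rewrite eP; apply: eq_bigr => j _; rewrite mulrC.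
  have [psi' [phi' [h2' h1' eP']]] := decomposition_shrink c1 h2 h1 eP2 hpsi.
  have eP3 : P = \sum_j phi' j * psi' j by rewrite eP'; apply: eq_bigr => j _; rewrite mulrC.
  have [l' [phi'' [psi'' [hl ? ? ? ?]]]] := ih _ _ h1' h2' eP3.
  by exists l', phi'', psi''; split=> //; exact: leq_trans hl _.
by exists l.+1, phi, psi; split.
Qed.

(** Expansion in powers of [x]. The number [r x + 1] of terms later bounds the orders of the
    derivations in the Wronskians. *)
Lemma split_variable (A : pred 'I_n) (x : 'I_n) r P :
  onlyv (predU A (pred1 x)) P -> ~~ A x -> degle r P ->
  exists phi psi : 'I_(r x).+1 -> {mpoly rat[n]},
    [/\ forall j, onlyv A (phi j) /\ degle r (phi j),
        forall j, onlyv (pred1 x) (psi j) /\ degle r (psi j) & P = \sum_j phi j * psi j].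
Proof.
move=> hP Ax hr.
pose phi (j : 'I_(r x).+1) := \sum_(m <- msupp P | m x == j :> nat) P@_m *: 'X_[m - U_(x) *+ j].
exists phi, (fun j => 'X_[U_(x) *+ j]); split=> [j|j|].
- rewrite /phi big_seq_cond; split.
    apply: onlyv_sum => m /andP[hm /eqP mx]; apply/onlyvZ/onlyvX => i Ai.
    rewrite mnmBE mulmnE mnm1E; case: eqP => [<-|/eqP xi]; first by rewrite mul1n mx subnn.
    by rewrite (hP m hm i) //= negb_or Ai /= eq_sym.
  apply: degle_sum => m /andP[hm /eqP mx]; apply/degleZ => k; rewrite msuppX inE => /eqP -> i.
  by rewrite mnmBE (leq_trans (leq_subr _ _)) ?hr.
- split; first by apply: onlyvX => i /= ix; rewrite mulmnE mnm1E eq_sym (negPf ix) mul0n.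
  move=> k; rewrite msuppX inE => /eqP -> i; rewrite mulmnE mnm1E.
  by case: eqP => [<-|_]; rewrite ?mul0n // mul1n -ltnS.
transitivity (\sum_(m <- msupp P) \sum_(j < (r x).+1 | m x == j :> nat)
    P@_m *: 'X_[m - U_(x) *+ j] * 'X_[U_(x) *+ j]).
  rewrite [in LHS](mpolyE P) !big_seq; apply: eq_bigr => m hm.
  have mr : (m x < (r x).+1)%N by rewrite ltnS hr.
  rewrite (bigD1 (Ordinal mr)) //= big1 => [|j /andP[/eqP e /eqP ne]]; last first.
    by case: ne; apply: val_inj; rewrite /= e.
  rewrite addr0 -scalerAl -mpolyXD submK //; apply/mnm_lepP => i.
  by rewrite mulmnE mnm1E; case: eqP => [<-|_]; rewrite ?mul0n ?mul1n.
rewrite (exchange_big_dep predT) //=; apply: eq_bigr => j _.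
by rewrite /phi mulr_suml.
Qed.

End Decomposition.

(** * Order of vanishing in a single variable *)

Section OneVariable.
Variables (n : nat) (K : fieldType) (f : {rmorphism rat -> K}).

(* [2 ^ g] plays the role of a height of [b]: an integral polynomial of degree [<= r] and norm
   [<= 2 ^ s] vanishes at [b] to order at most [(2 r + s) / g]. *)
Definition vanish_bound (b : K) (g : nat) := forall (V : {poly rat}) (r s : nat),
  V != 0 -> (forall i, V`_i \is a Num.int) -> (size V <= r.+1)%N ->
  \sum_(i < r.+1) `|V`_i| <= 2 ^+ s ->
  exists2 k, (k * g <= 2 * r + s)%N & ((map_poly f V) \Po ('X + b%:P))`_k != 0.

Lemma mcoeff_horner (R : comNzRingType) (x : 'I_n) (Q : {poly R}) k :
  ((map_poly (@mpolyC n R) Q).['X_x])@_(U_(x) *+ k) = Q`_k.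
Proof.
rewrite horner_poly raddf_sum /=.
transitivity (\sum_(i < size Q) (if i == k :> nat then Q`_i else 0)).
  apply: eq_bigr => i _; rewrite mul_mpolyC mcoeffZ mpolyXn mcoeffX.
  have -> : (U_(x) *+ i == U_(x) *+ k :> 'X_{1..n})%MM = (i == k :> nat).
    apply/eqP/eqP => [/mnmP/(_ x)|-> //]; rewrite !mulmnE mnm1E eqxx !mul1n //.
  by case: eqP; rewrite ?mulr1 ?mulr0.
have [ks|ks] := ltnP k (size Q).
  rewrite (bigD1 (Ordinal ks)) //= eqxx big1 ?addr0 // => i.
  by rewrite -val_eqE /= => /negPf ->.
rewrite nth_default // big1 // => i _; case: eqP => // e.
by move: (ltn_ord i); rewrite e ltnNge ks.
Qed.

Lemma one_variable (beta : 'I_n -> K) (x : 'I_n) g r s (V : {mpoly rat[n]}) :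
  vanish_bound (beta x) g -> V != 0 -> onlyv (pred1 x) V -> intm V -> degle r V ->
  nrm V <= 2 ^+ s ->
  exists2 k, (k * g <= 2 * r x + s)%N & (tay f beta V)@_(U_(x) *+ k) != 0.
Proof.
move=> hb V0 oV iV dV nV.
pose q := \poly_(i < (r x).+1) V@_(U_(x) *+ i).
have suppV m : m \in msupp V -> m = (U_(x) *+ m x)%MM.
  move=> hm; apply/mnmP=> i; rewrite mulmnE mnm1E.
  by case: eqP => [<-|/eqP e]; rewrite ?mul1n // mul0n (oV m hm) //= eq_sym.
have eV : V = (map_poly (@mpolyC n rat) q).['X_x].
  apply/mpolyP => m; have [hm|hm] := eqVneq m (U_(x) *+ m x)%MM.
    rewrite hm mcoeff_horner coef_poly; case: ltnP => // hmx.
    rewrite -hm; apply/memN_msupp_eq0/negP => /dV/(_ x); by rewrite leqNgt hmx.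
  rewrite memN_msupp_eq0; last by apply: contraNN hm => /suppV ->; rewrite mulmnE mnm1E eqxx mul1n.
  apply/esym/memN_msupp_eq0; apply: contraNN hm => hm; apply/eqP/mnmP => i.
  have : onlyv (pred1 x) (map_poly (@mpolyC n rat) q).['X_x].
    rewrite horner_poly; apply: onlyv_sum => j _; apply: onlyvM; first exact: onlyvC.
    by apply/onlyv_exp/onlyvX => k /= kx; rewrite mnm1E eq_sym (negPf kx).
  move=> /(_ m hm i) /=; rewrite mulmnE mnm1E eq_sym.
  by case: eqP => [->|_ ->]; rewrite ?mul1n.
have q0 : q != 0.
  by apply: contraNneq V0 => e; rewrite eV e rmorph0 horner0.
have iq i : q`_i \is a Num.int by rewrite coef_poly; case: ifP => // _; apply: rpred0.
have nq : \sum_(i < (r x).+1) `|q`_i| <= 2 ^+ s.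
  apply: le_trans nV; pose t := [seq (U_(x) *+ i)%MM | i <- iota 0 (r x).+1].
  rewrite (@nrm_sub _ _ t).
  - rewrite big_map -[iota _ _]/(index_iota 0 (r x).+1) big_mkord.
    by apply: ler_sum => i _; rewrite coef_poly ltn_ord.
  - rewrite map_inj_uniq ?iota_uniq // => i j /mnmP/(_ x).
    by rewrite !mulmnE mnm1E eqxx !mul1n.
  - move=> m hm; rewrite (suppV m hm); apply/mapP; exists (m x) => //.
    by rewrite mem_iota ltnS dV.
have [k hk hk0] := hb q (r x) s q0 iq (size_poly _ _) nq.
exists k => //; apply: contraNneq hk0 => h.
rewrite -(mcoeff_horner x) -[X in _ == X]h eV; apply/eqP; congr (_@_ _).
rewrite [in RHS]horner_poly comp_polyE size_map_poly !rmorph_sum /= horner_sum.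
apply: eq_bigr => i _.
rewrite coef_map map_polyZ hornerZ rmorphXn rmorphD /= map_polyX map_polyC /= horner_exp.
by rewrite hornerD hornerX hornerC rmorphM rmorphXn /= tayC tayXU.
Qed.

End OneVariable.

Lemma onlyv_sub n (R : comNzRingType) (A B : pred 'I_n) (p : {mpoly R[n]}) :
  onlyv A p -> (forall i, A i -> B i) -> onlyv B p.
Proof. by move=> hp AB m /hp h i /(contra (AB i)) /h. Qed.

Lemma indge_le n (K : fieldType) (f : {rmorphism rat -> K}) b r (t t' : rat) (p : {mpoly rat[n]}) :
  indge f b r t p -> t' <= t -> indge f b r t' p.
Proof. by move=> hp h m hm; apply: hp; exact: lt_le_trans hm h. Qed.

Lemma nrm_ge_sum n (t : seq 'X_{1..n}) (W : {mpoly rat[n]}) :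
  uniq t -> \sum_(m <- t) `|W@_m| <= nrm W.
Proof.
move=> ut; rewrite (@nrm_sub _ _ (undup (t ++ msupp W))) ?undup_uniq //; last first.
  by move=> m hm; rewrite mem_undup mem_cat hm orbT.
rewrite [leRHS](bigID (mem t)) /= -[leLHS]addr0 lerD ?sumr_ge0 //.
rewrite -[leRHS]big_filter le_eqVlt; apply/orP; left; apply/eqP/perm_big/uniq_perm; rewrite ?filter_uniq ?undup_uniq //.
by move=> m; rewrite mem_filter mem_undup mem_cat andb_orr andbb orb_idr // => /andP[].
Qed.

Section SeparatedNorm.
Variables (n : nat) (A : pred 'I_n) (U V : {mpoly rat[n]}).
Hypotheses (hU : onlyv A U) (hV : onlyv (predC A) V).

(** As the two supports use disjoint variables, the coefficients of [V@_b *: U] are among those of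
    [U * V]. Integrality and norm thus pass from the product to a scalar multiple of a factor, which
    has the same index as the factor. *)
Lemma coef_factor_l b m : b \in msupp V -> (V@_b *: U)@_m = if m \in msupp U then (U * V)@_(m + b) else 0.
Proof.
move=> hb; rewrite mcoeffZ; case: ifP => [hm|/negbT/memN_msupp_eq0 ->]; last by rewrite mulr0.
rewrite (mcoeffM_sep hU hV) 1?mulrC //; first exact: hU.
by move=> i Ai; rewrite (hV hb) //= Ai.
Qed.

Lemma intm_factor_l b : b \in msupp V -> intm (U * V) -> intm (V@_b *: U).
Proof. by move=> hb hi m; rewrite coef_factor_l //; case: ifP => // _; rewrite rpred0. Qed.

Lemma nrm_factor_l b : b \in msupp V -> nrm (V@_b *: U) <= nrm (U * V).
Proof.
move=> hb; rewrite (@nrm_sub _ _ (msupp U)) ?msupp_uniq // => [|m /msuppZ_le //].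
apply: le_trans (@nrm_ge_sum _ [seq (m + b)%MM | m <- msupp U] _ _); last first.
  by rewrite map_inj_uniq ?msupp_uniq //; apply: addIm.
by rewrite [leRHS]big_map big_seq [leRHS]big_seq; apply: ler_sum => m hm; rewrite coef_factor_l // hm.
Qed.

End SeparatedNorm.

(** This bounds the index of the Wronskian from below. It is quadratic in [eta] because only about
    [eta * R] terms are positive when [l] is close to [R]. *)
Lemma sum_max_ge (R l : nat) (eta : rat) : (0 < R)%N -> (l <= R.+1)%N -> 0 < eta <= 1 ->
  l%:R * eta ^+ 2 / 8 <= \sum_(k < l) Num.max 0 (eta - k%:R / R%:R).
Proof.
move=> R0 lR /andP[e0 e1]; pose T l := \sum_(k < l) Num.max 0 (eta - k%:R / R%:R).
have R0' : 0 < R%:R :> rat by rewrite ltr0n.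
have TS j : T j.+1 = T j + Num.max 0 (eta - j%:R / R%:R) by rewrite /T big_ord_recr.
have T1 j : j%:R * eta - j%:R * (j%:R - 1) / (2 * R%:R) <= T j.
  elim: j => [|j ih]; first by rewrite /T big_ord0 !mul0r subr0.
  rewrite TS; apply: le_trans (lerD ih (_ : eta - j%:R / R%:R <= _)); last by rewrite le_max lexx orbT.
  rewrite -natr1 le_eqVlt; apply/orP; left; apply/eqP; field; lra.
(* While [j <= eta * R] the terms average at least [eta / 2]; past that point the sum has reached
   [R * eta ^+ 2 / 2] and cannot decrease. *)
have T2 j : j%:R * eta / 2 <= T j \/ R%:R * eta ^+ 2 / 2 <= T j.
  elim: j => [|j ih]; first by left; rewrite /T big_ord0 !mul0r.
  have [hj|hj] := leP (j%:R) (eta * R%:R).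
    left; apply: le_trans (T1 _); rewrite -natr1 addrK.
    have -> : (j%:R + 1) * eta - (j%:R + 1) * j%:R / (2 * R%:R) = (j%:R + 1) * (eta - j%:R / R%:R / 2) :> rat.
      by field; lra.
    rewrite -mulrA ler_wpM2l ?addr_ge0 //.
    have : j%:R / R%:R <= eta by rewrite ler_pdivrMr.
    lra.
  right; rewrite TS.
  have h0 : 0 <= Num.max 0 (eta - j%:R / R%:R) by rewrite le_max lexx.
  case: ih => ih; last by lra.
  have : eta * (eta * R%:R) <= eta * j%:R by rewrite ler_pM2l // ltW.
  rewrite expr2; lra.
have lR' : l%:R <= 2 * R%:R :> rat by rewrite -natrM ler_nat; lia.
have l0 : 0 <= l%:R :> rat by [].
have ee : eta ^+ 2 <= eta by rewrite expr2 ler_piMl // ltW.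
have e20 : 0 <= eta ^+ 2 by rewrite exprn_ge0 // ltW.
case: (T2 l) => h; apply: le_trans h.
  have h1 : l%:R * eta ^+ 2 <= l%:R * eta by rewrite ler_wpM2l.
  have h2 : 0 <= l%:R * eta by rewrite mulr_ge0 // ltW.
  lra.
have h1 : l%:R * eta ^+ 2 <= 2 * R%:R * eta ^+ 2 by rewrite ler_wpM2r.
have h2 : 0 <= R%:R * eta ^+ 2 by rewrite mulr_ge0.
lra.
Qed.

Lemma fact_le_exp2 l s : (l <= s.+1)%N -> (l`! <= 2 ^ (s * l))%N.
Proof.
elim: l => [|l ih] h; first by rewrite muln0.
rewrite factS mulnS expnD; apply: leq_mul; last exact: ih (ltnW h).
by apply: leq_trans h _; apply: ltn_expl.
Qed.

Lemma nrm_hder2 n (r : 'I_n -> nat) s mu nu (P : {mpoly rat[n]}) :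
  degle r P -> (\sum_i r i <= s)%N -> nrm P <= 2 ^+ s -> nrm (hder mu (hder nu P)) <= 2 ^+ (3 * s).
Proof.
move=> dP rs nP; have h2s : 2 ^+ (\sum_i r i)%N <= 2 ^+ s :> rat by rewrite ler_weXn2l.
have -> : (2 : rat) ^+ (3 * s) = 2 ^+ s * (2 ^+ s * 2 ^+ s) by rewrite -!exprD; congr (_ ^+ _); lia.
have h1 := nrm_hder mu (degle_hder (mu := nu) dP); have h2 := nrm_hder nu dP.
apply: le_trans h1 _; apply: (ler_pM _ _ h2s); rewrite ?nrm_ge0 ?exprn_ge0 //.
by apply: le_trans h2 _; apply: (ler_pM _ _ h2s nP); rewrite ?nrm_ge0 ?exprn_ge0.
Qed.

(** One [l * s] comes from [l!] and three from the entries, where two derivations and [P] itself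
    cost [2 ^+ s] each. This [4] is the one in [om' / 4]. *)
Lemma nrm_det_exp2 n l s (M : 'M[{mpoly rat[n]}]_l) :
  (l <= s.+1)%N -> (forall i j, nrm (M i j) <= 2 ^+ (3 * s)) -> nrm (\det M) <= 2 ^+ (4 * (l * s)).
Proof.
move=> ls hM; apply: le_trans (nrm_det hM) _.
have -> : (4 * (l * s) = s * l + 3 * s * l)%N by lia.
rewrite exprD -exprM ler_wpM2r ?exprn_ge0 // -natrX ler_nat.
exact: fact_le_exp2.
Qed.

Section WronskianProduct.
Variables (n l : nat) (A : pred 'I_n) (x : 'I_n) (phi psi : 'I_l -> {mpoly rat[n]}).
Variables (mu nu : 'I_l -> 'X_{1..n}).
Hypotheses (Ax : ~~ A x) (hphi : forall j, onlyv A (phi j)) (hpsi : forall j, onlyv (pred1 x) (psi j)).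

Let U := \det (\matrix_(i, j) hder (mu i) (phi j)).
Let V := \det (\matrix_(i, j) hder (nu i) (psi j)).

(** A derivation in a variable outside [B] would make its whole row vanish. *)
Lemma hder_det_supp (B : pred 'I_n) (ph : 'I_l -> {mpoly rat[n]}) (m : 'I_l -> 'X_{1..n}) :
  (forall j, onlyv B (ph j)) -> \det (\matrix_(i, j) hder (m i) (ph j)) != 0 ->
  forall i y, ~~ B y -> m i y = 0%N.
Proof.
move=> hB d0 i y By; apply/eqP; apply: contraNT d0 => my.
rewrite (expand_det_row _ i) big1 // => j _.
by rewrite mxE (hder_eq0 (hB j) By) ?mul0r // lt0n.
Qed.

(** The [mu] involve only variables of [A] and the [nu] only [x], so the derivations act on the two
    factors separately, and the matrix is that of [V] times the transpose of that of [U]. *)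
Lemma wronskian_product P : P = \sum_j phi j * psi j -> U != 0 -> V != 0 ->
  \det (\matrix_(k, i) hder (mu i) (hder (nu k) P)) = U * V.
Proof.
move=> eP U0 V0.
have smu := hder_det_supp hphi U0; have snu := hder_det_supp hpsi V0.
rewrite mulrC -[U]det_tr -det_mulmx; congr (\det _); apply/matrixP=> k i; rewrite !mxE.
rewrite eP !raddf_sum; apply: eq_bigr => j _; rewrite !mxE.
have h1 : hder (nu k) (phi j * psi j) = hder (nu k) (psi j) * phi j.
  rewrite mulrC; apply: (hder_mul_sep (A := pred1 x)); first exact: snu.
  by apply: (onlyv_sub (@hphi j)) => y Ay /=; apply: contraNneq Ax => <-.
have h2 : onlyv (predC A) (hder (nu k) (psi j)).
  by apply: onlyv_hder; apply: (onlyv_sub (@hpsi j)) => y /eqP ->.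
by rewrite /= h1 [X in hder _ X]mulrC (hder_mul_sep _ (smu i) h2) mulrC.
Qed.

End WronskianProduct.

Lemma onlyv_det n (R : comNzRingType) (A : pred 'I_n) l (M : 'M[{mpoly R[n]}]_l) :
  (forall i j, onlyv A (M i j)) -> onlyv A (\det M).
Proof.
move=> h; apply: onlyv_sum => s _; apply: onlyvM; last by apply: onlyv_prod => i _; exact: h.
by apply: onlyv_exp; rewrite -mulN1r -mpolyC1 -mpolyCN -mpolyCM; exact: onlyvC.
Qed.

Lemma scaled_degree_bound (F : realFieldType) (a b l om om' : F) :
  0 <= b -> 0 <= l -> 0 <= om' -> om <= om' / 4 -> a <= om * b -> l * a <= om' * (l * b).
Proof.
move=> b0 l0 o0 h1 h2; rewrite mulrCA; apply: ler_wpM2l => //; apply: le_trans h2 _.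
apply: ler_wpM2r => //; lra.
Qed.

Lemma scaled_height_bound (F : realFieldType) (s g r l om om' : F) :
  0 <= g -> 0 <= r -> 0 <= l -> om <= om' / 4 -> s <= om * (g * r) ->
  4 * (l * s) <= om' * (g * (l * r)).
Proof.
move=> g0 r0 l0 h1 h2; have gr : 0 <= g * r by exact: mulr_ge0.
have h3 : om * (g * r) <= om' / 4 * (g * r) by exact: ler_wpM2r.
have : l * s <= l * (om' / 4 * (g * r)) by apply: ler_wpM2l => //; exact: le_trans h2 h3.
lra.
Qed.

Lemma index_loss (F : realFieldType) (eps om a b t : F) :
  a <= t -> b <= om -> eps - om - t <= eps - a - b.
Proof. lra. Qed.

Lemma wt_single n (r : 'I_n -> nat) x (mu : 'X_{1..n}) :
  (forall y, y != x -> mu y = 0%N) -> wt r mu = (mu x)%:R / (r x)%:R.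
Proof.
move=> h; rewrite /wt (bigD1 x) //= big1; first by rewrite addr0.
by move=> y /h ->; rewrite mul0r.
Qed.

Lemma wt_le_mdeg n (r : 'I_n -> nat) (mu : 'X_{1..n}) (c : rat) :
  (forall y, mu y != 0%N -> (r y)%:R^-1 <= c) -> wt r mu <= (mdeg mu)%:R * c.
Proof.
move=> h; rewrite mdegE natr_sum mulr_suml; apply: ler_sum => y _.
have [->|my] := eqVneq (mu y) 0%N; first by rewrite !mul0r.
by apply: ler_wpM2l; [exact: ler0n | exact: h].
Qed.

Lemma ler_pM2r_nat (F : realFieldType) (a b c : nat) :
  (0 < c)%N -> (a <= b)%N -> a%:R / c%:R <= b%:R / c%:R :> F.
Proof. by move=> c0 ab; rewrite ler_pM2r ?invr_gt0 ?ltr0n ?ler_nat. Qed.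

Lemma inv_le_of_le (F : realFieldType) (a b c : F) : 0 < a -> 0 < b -> a <= c * b -> b^-1 <= c / a.
Proof. by move=> a0 b0 h; rewrite ler_pdivlMr // mulrC ler_pdivrMr. Qed.

Lemma mul_div_le (F : realFieldType) (a b c : F) : 0 < b -> 0 <= c -> a <= b -> a * (c / b) <= c.
Proof. by move=> b0 c0 h; rewrite mulrA ler_pdivrMr // mulrC ler_wpM2l. Qed.

Lemma order_ratio_bound (F : realFieldType) (k g r l s om : F) :
  0 < g -> 0 < r -> 0 < l -> k * g <= 12 * (l * s) -> s <= om * (g * r) -> k / r <= 12 * l * om.
Proof.
move=> g0 r0 l0 h1 h2; rewrite ler_pdivrMr // -(ler_pM2r g0).
have : l * s <= l * (om * (g * r)) by rewrite ler_pM2l.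
lra.
Qed.

Lemma eta_bounds (F : realFieldType) (eps om : F) :
  0 < eps -> eps <= 1 -> 0 <= om -> om <= eps ^+ 2 / 3000 -> 0 < eps - om <= 1.
Proof.
move=> e0 e1 o0 o1; have : eps ^+ 2 <= eps by rewrite expr2 ler_piMl // ltW.
by move=> h; apply/andP; split; lra.
Qed.

(** As [eps - om >= eps / 2], the left side is at least [l * eps ^+ 2 / 32], and
    [1/32 > 1/128 + 12/3000]: this dictates the constants [128] and [3000]. *)
Lemma index_contradiction (F : realFieldType) (l eps om : F) :
  0 < l -> 0 < eps -> eps <= 1 -> 0 <= om -> om <= eps ^+ 2 / 3000 ->
  l * (eps - om) ^+ 2 / 8 <= l * (eps ^+ 2 / 128) + 12 * l * om -> False.
Proof.
move=> l0 e0 e1 o0 o1 h.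
have h1 : eps ^+ 2 <= eps by rewrite expr2 ler_piMl // ltW.
have h2 : (eps / 2) ^+ 2 <= (eps - om) ^+ 2 by rewrite ler_sqr ?nnegrE; lra.
have h3 : l * (eps / 2) ^+ 2 <= l * (eps - om) ^+ 2 by rewrite ler_pM2l.
have h4 : l * om <= l * (eps ^+ 2 / 3000) by rewrite ler_pM2l.
have h5 : 0 < l * eps ^+ 2 by rewrite mulr_gt0 ?exprn_gt0.
rewrite expr_div_n in h3; lra.
Qed.

Lemma order_bound_nat l a s : (a <= s)%N -> (2 * (l * a) + 4 * (l * s) <= 12 * (l * s))%N.
Proof. by move=> h; have := leq_mul (leqnn l) h; lia. Qed.

Lemma sqr128_bounds (F : realFieldType) (eps : F) :
  0 < eps -> eps <= 1 -> 0 < eps ^+ 2 / 128 <= 1.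
Proof.
move=> e0 e1; have h1 : eps ^+ 2 <= eps by rewrite expr2 ler_piMl // ltW.
have h2 : 0 < eps ^+ 2 by rewrite exprn_gt0.
by apply/andP; split; lra.
Qed.

Lemma omega_exists (F : realFieldType) (eps om' : F) : 0 < eps -> 0 < om' -> om' <= 1 ->
  exists om, [/\ 0 < om, om <= 1, om <= om' / 4 & om <= eps ^+ 2 / 3000].
Proof.
move=> e0 o0 o1; exists (Num.min (om' / 4) (eps ^+ 2 / 3000)).
have h2 : 0 < eps ^+ 2 by rewrite exprn_gt0.
by rewrite lt_min !ge_min !lexx orbT; split=> //; [apply/andP; split | apply/orP; left]; lra.
Qed.

(** * Roth's lemma *)

Section RothLemma.
Variables (n : nat) (K : fieldType) (f : {rmorphism rat -> K}).

(* The induction on the number [m] of variables that occur takes place in a fixed polynomial ring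
   in [n >= m] variables. *)
Definition roth_hyp (m : nat) (om : rat) (beta : 'I_n -> K) (r g : 'I_n -> nat) (s : nat) :=
  [/\ forall i, (0 < r i)%N, (\sum_i r i <= s)%N,
      forall i j : 'I_n, (i < j)%N -> (j < m)%N -> (r j)%:R <= om * (r i)%:R,
      forall j : 'I_n, (j < m)%N -> s%:R <= om * (g j * r j)%:R
    & forall j : 'I_n, (j < m)%N -> vanish_bound f (beta j) (g j)].

Definition roth_concl (m : nat) (eps om : rat) := forall beta r g s (P : {mpoly rat[n]}),
  roth_hyp m om beta r g s -> P != 0 -> intm P -> onlyv [pred i : 'I_n | (i < m)%N] P ->
  degle r P -> nrm P <= 2 ^+ s ->
  exists2 mu, (tay f beta P)@_mu != 0 & wt r mu <= eps.

(** If all derivatives of [P] of weight at most [eps] vanished, the Wronskian [U * V] would have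
    index of order [l * eps ^+ 2]. But [U] has small index by the induction hypothesis and [V] by
    the one-variable bound, and in disjoint variables two nonzero Taylor coefficients multiply to a
    nonzero one. *)
Lemma roth_step (m : nat) (eps : rat) (x : 'I_n) (om om' : rat) :
  x = m :> nat -> 0 < eps <= 1 -> 0 < om' <= 1 -> 0 < om -> om <= om' / 4 ->
  om <= eps ^+ 2 / 3000 -> roth_concl m (eps ^+ 2 / 128) om' -> roth_concl m.+1 eps om.
Proof.
move=> xm /andP[e0 e1] /andP[o0 o1] omp om1 om2 IH beta r g s P [r0 rs rdec rg vb] P0 iP oP dP nP.
pose A := [pred i : 'I_n | (i < m)%N].
have Ax : ~~ A x by rewrite /= xm ltnn.
have oP' : onlyv (predU A (pred1 x)) P.
  by apply: (onlyv_sub oP) => i /=; rewrite ltnS leq_eqVlt orbC -xm.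
have [phi0 [psi0 [h1 h2 eP0]]] := split_variable oP' Ax dP.
have cl B : lin_closed (fun p : {mpoly rat[n]} => onlyv B p /\ degle r p).
  by move=> c p q [? ?] [? ?]; split; [apply: onlyvD; last apply: onlyvZ | apply: degleD; last apply: degleZ].
have [l [phi [psi [lr hphi hpsi eP [iphi ipsi]]]]] := decomposition_indep (cl A) (cl (pred1 x)) h1 h2 eP0.
have l0 : (0 < l)%N.
  by case: l phi psi lr hphi hpsi eP iphi ipsi => // phi psi _ _ _ eP; rewrite eP big_ord0 eqxx in P0.
have [mu hmu U0] := generalized_wronskian iphi.
have [nu hnu V0] := generalized_wronskian ipsi.
have oU : onlyv A (\det (\matrix_(i, j) hder (mu i) (phi j))).
  by apply: onlyv_det => i j; rewrite mxE; apply: onlyv_hder; case: (hphi j).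
have oV1 : onlyv (pred1 x) (\det (\matrix_(i, j) hder (nu i) (psi j))).
  by apply: onlyv_det => i j; rewrite mxE; apply: onlyv_hder; case: (hpsi j).
have dU : degle (fun i => l * r i)%N (\det (\matrix_(i, j) hder (mu i) (phi j))).
  by apply: degle_det => i j; rewrite mxE; apply: degle_hder; case: (hphi j).
have dV : degle (fun i => l * r i)%N (\det (\matrix_(i, j) hder (nu i) (psi j))).
  by apply: degle_det => i j; rewrite mxE; apply: degle_hder; case: (hpsi j).
have smu := hder_det_supp (fun j => (hphi j).1) U0.
have snu := hder_det_supp (fun j => (hpsi j).1) V0.
have eW := wronskian_product Ax (fun j => (hphi j).1) (fun j => (hpsi j).1) eP U0 V0.
move: oU oV1 dU dV U0 V0 eW.
set U := \det (\matrix_(i, j) hder (mu i) (phi j)).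
set V := \det (\matrix_(i, j) hder (nu i) (psi j)).
set M := \matrix_(k, i) hder (mu i) (hder (nu k) P).
move=> oU oV1 dU dV U0 V0 eW; clearbody U V.
have oV : onlyv (predC A) V by apply: (onlyv_sub oV1) => y /eqP ->.
have iW : intm (U * V).
  by rewrite -eW; apply: intm_det => i j; rewrite mxE; do 2 apply: intm_hder.
pose s' := (4 * (l * s))%N.
have rxs : (r x <= s)%N by apply: leq_trans rs; rewrite (bigD1 x) //= leq_addr.
have nW : nrm (U * V) <= 2 ^+ s'.
  rewrite -eW; apply: nrm_det_exp2 => [|i j]; first exact: leq_trans lr _.
  by rewrite mxE; exact: (nrm_hder2 _ _ dP rs nP).
have [b hb] : exists b, b \in msupp V.
  by exists (mlead V); apply: mlead_supp.
have [a ha] : exists a, a \in msupp U.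
  by exists (mlead U); apply: mlead_supp.
have oU2 : onlyv (predC (pred1 x)) U.
  by apply: (onlyv_sub oU) => y Ay /=; apply: contraNneq Ax => <-.
have Vb : V@_b != 0 by rewrite -mcoeff_msupp.
have Ua : U@_a != 0 by rewrite -mcoeff_msupp.
have l0' : 0 < l%:R :> rat by rewrite ltr0n.
(* The degrees grow by the factor [l] and the height by [4 * l], so the ratios in [roth_hyp] worsen
   by at most 4. *)
have [mu0 hmu0 wmu0] : exists2 mu0, (tay f beta (V@_b *: U))@_mu0 != 0 &
    wt (fun i => l * r i)%N mu0 <= eps ^+ 2 / 128.
  apply: (IH beta (fun i => l * r i)%N g s').
  - split=> [i||i j ij jm|j jm|j jm].
    + by rewrite muln_gt0 l0 r0.
    + rewrite -big_distrr /=; apply: leq_trans (leq_mul (leqnn l) rs) _.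
      by rewrite /s' leq_pmull.
    + rewrite !natrM; apply: (scaled_degree_bound _ _ _ om1 (rdec i j ij (ltnW jm))); rewrite ?ler0n //.
      exact: ltW.
    + rewrite /s' !natrM; have h := rg j (ltnW jm); rewrite natrM in h.
      by apply: (scaled_height_bound _ _ _ om1 h); rewrite ?ler0n // ltW.
    + exact: vb (ltnW jm).
  - by rewrite scaler_eq0 negb_or Vb.
  - exact: intm_factor_l oU oV _ hb iW.
  - exact: onlyvZ.
  - exact: degleZ.
  - exact: le_trans (nrm_factor_l oU oV hb) nW.
have xm1 : (x < m.+1)%N by rewrite xm.
have eW2 : V * U = U * V by rewrite mulrC.
have [k hk hk0] := one_variable (r := fun i => (l * r i)%N) (s := s') (V := U@_a *: V) (vb x xm1)
  ltac:(by rewrite scaler_eq0 negb_or Ua) (onlyvZ oV1)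
  ltac:(by apply: (intm_factor_l oV1 oU2 ha); rewrite eW2) (degleZ dV)
  ltac:(by apply: le_trans (nrm_factor_l oV1 oU2 ha) _; rewrite eW2).
have tU0 : (tay f beta U)@_mu0 != 0.
  by move: hmu0; rewrite tayZ mcoeffZ mulf_eq0 negb_or => /andP[].
have tV0 : (tay f beta V)@_(U_(x) *+ k) != 0.
  by move: hk0; rewrite tayZ mcoeffZ mulf_eq0 negb_or => /andP[].
apply: NNPP => hno.
have iP' : indge f beta r eps P.
  move=> c hc; apply/eqP; apply: contraPT hno => h; case; exists c => //; exact: ltW.
pose eta := eps - om.
(* Row [i] loses at most [i / r x] through [nu i]. The derivations [mu j] have order at most [r x],
   and the earlier degrees are at least [r x / om], so they lose at most [om]. Negative bounds are
   replaced by 0. *)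
have iW' : indge f beta r (\sum_(i < l) Num.max 0 (eta - i%:R / (r x)%:R)) (U * V).
  rewrite -eW; apply: indge_det => i j; rewrite mxE.
  have [h|h] := leP (eta - i%:R / (r x)%:R) 0.
    exact: indge_neg.
  have wnu : wt r (nu i) <= i%:R / (r x)%:R.
    rewrite (wt_single _ (snu i)); apply: ler_pM2r_nat => //.
    by apply: leq_trans (hnu i); rewrite mdegE (bigD1 x) //= leq_addr.
  have wmu : wt r (mu j) <= om.
    have hj : (mdeg (mu j) <= r x)%N.
      by rewrite (leq_trans (hmu j)) // -ltnS (leq_trans (ltn_ord j)).
    apply: le_trans (wt_le_mdeg (c := om / (r x)%:R) _) _.
      move=> y my; have ym : A y by apply: contraNT my => /smu ->.
      apply: inv_le_of_le; [by rewrite ltr0n | by rewrite ltr0n r0 | apply: rdec; last by rewrite xm].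
      by move: ym; rewrite /= xm.
    by apply: mul_div_le; [rewrite ltr0n | exact: ltW | rewrite ler_nat].
  have iE := indge_hder (mu := mu j) (indge_hder (mu := nu i) iP').
  apply: (indge_le iE).
  rewrite /eta; exact: index_loss.
have smu0 i : ~~ A i -> mu0 i = 0%N.
  by move=> Ai; apply: (onlyv_tay (iota := f) (beta := beta) oU) Ai; rewrite mcoeff_msupp.
have hprod : (tay f beta (U * V))@_(mu0 + U_(x) *+ k) != 0.
  rewrite rmorphM (mcoeffM_sep (onlyv_tay oU) (onlyv_tay oV)) ?mulf_neq0 // => i Ai.
  rewrite mulmnE mnm1E; case: eqP => [e|_]; last by rewrite mul0n.
  by move: Ax; rewrite e Ai.
have hw : \sum_(i < l) Num.max 0 (eta - i%:R / (r x)%:R) <= wt r (mu0 + U_(x) *+ k).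
  by rewrite leNgt; apply: contra hprod => /iW' ->.
(* Weights relative to [r] are [l] times those relative to [l * r]. *)
have w1 : wt r mu0 <= l%:R * (eps ^+ 2 / 128).
  have -> : wt r mu0 = l%:R * wt (fun i => l * r i)%N mu0.
    rewrite /wt mulr_sumr; apply: eq_bigr => i _.
    by rewrite natrM invfM mulrCA mulVKf ?lt0r_neq0.
  by rewrite ler_pM2l.
have s0 : (0 < s)%N by apply: leq_trans rxs.
have gx0 : (0 < g x)%N.
  have [e|//] := posnP (g x); have := rg x xm1.
  by rewrite e mul0n mulr0 lern0 => /eqP e'; rewrite e' in s0.
have w2 : wt r (U_(x) *+ k) <= 12 * l%:R * om.
  rewrite (@wt_single _ _ x) => [|y yx]; last first.
    by rewrite mulmnE mnm1E eq_sym (negPf yx) mul0n.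
  rewrite mulmnE mnm1E eqxx mul1n.
  have hk' : (k * g x <= 12 * (l * s))%N by apply: leq_trans hk _; apply: order_bound_nat.
  move: hk'; rewrite -(ler_nat rat) !natrM => hk'.
  have h := rg x xm1; rewrite natrM in h.
  by apply: (order_ratio_bound _ _ _ hk' h); rewrite ?ltr0n.
have := sum_max_ge (r0 x) lr (eta_bounds e0 e1 (ltW omp) om2).
move=> /le_trans /(_ hw); rewrite wtD => h3.
by apply: (index_contradiction l0' e0 e1 (ltW omp) om2 (le_trans h3 (lerD w1 w2))).
Qed.

Theorem roth_lemma (m : nat) : (m <= n)%N -> forall eps : rat, 0 < eps <= 1 ->
  exists2 om, 0 < om <= 1 & roth_concl m eps om.
Proof.
elim: m => [|m ih] mn eps /andP[e0 e1].
  exists 1; rewrite ?ltr01 ?lexx // => beta r g s P _ P0 _ oP _ _.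
  have eP : P = (P@_0)%:MP.
    apply/mpolyP=> c; rewrite mcoeffC; have [->|c0] := eqVneq c 0%MM; first by rewrite mulr1.
    rewrite mulr0; apply/memN_msupp_eq0; apply: contraNN c0 => /oP h.
    by apply/eqP/mnmP=> i; rewrite h ?mnm0E.
  exists 0%MM; last by rewrite wt0 ltW.
  rewrite eP tayC mcoeffC eqxx mulr1 fmorph_eq0; apply: contraNneq P0 => h.
  by rewrite eP h mpolyC0.
have [om' ho IH] := ih (ltnW mn) _ (sqr128_bounds e0 e1); have /andP[o0 o1] := ho.
have [om [omp om1 om2 om3]] := omega_exists e0 o0 o1.
exists om; first by rewrite omp om1.
by apply: (@roth_step m eps (Ordinal mn) om om') => //; rewrite e0.
Qed.

End RothLemma.

(** * Resultants and Liouville's inequality *)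

(** A weak form of Hadamard's inequality, by expansion along the first row: deleting a column only
    lowers the other row sums. *)
Lemma normr_det_le (R : realDomainType) l (M : 'M[R]_l) (c : 'I_l -> R) :
  (forall i, \sum_j `|M i j| <= c i) -> `|\det M| <= \prod_i c i.
Proof.
elim: l M c => [|l ih] M c h; first by rewrite det_mx00 big_ord0 normr1.
rewrite (expand_det_row _ ord0) [leRHS]big_ord_recl.
have c0 : forall i, 0 <= c i by move=> i; apply: le_trans (_ : \sum_j `|M i j| <= _); [exact: sumr_ge0 | exact: h].
have hc j : `|cofactor M ord0 j| <= \prod_(i < l) c (lift ord0 i).
  rewrite /cofactor normrM normrX normrN1 expr1n mul1r; apply: ih => i.
  apply: le_trans (h (lift ord0 i)); rewrite [leRHS](bigD1_ord j) //= ler_wpDl //.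
  by apply: ler_sum => k _; rewrite !mxE.
apply: le_trans (ler_norm_sum _ _ _) _.
apply: (@le_trans _ _ (\sum_j `|M ord0 j| * \prod_(i < l) c (lift ord0 i))).
  by apply: ler_sum => j _; rewrite normrM ler_wpM2l.
by rewrite -mulr_suml ler_wpM2r // prodr_ge0.
Qed.

Section PolyNorm.
Variable R : realDomainType.
Implicit Types g : {poly R}.

Definition l1 g := \sum_(i < size g) `|g`_i|.

Lemma l1_ge0 g : 0 <= l1 g.
Proof. exact: sumr_ge0. Qed.

Lemma sum_coef_le_l1 g d : \sum_(i < d) `|g`_i| <= l1 g.
Proof.
rewrite /l1 -!(big_mkord xpredT (fun i => `|g`_i|)).
have [h|h] := leqP d (size g).
  by rewrite [leRHS](big_cat_nat _ h) //= lerDl sumr_ge0.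
rewrite (big_cat_nat _ (ltnW h)) //= [X in _ + X]big1_seq ?addr0 //= => i.
by rewrite mem_index_iota => /andP[hi _]; rewrite nth_default ?normr0.
Qed.

Lemma sum_shift_le_l1 g d k : \sum_(j < d) `|g`_(j - k) *+ (k <= j)%N| <= l1 g.
Proof.
apply: le_trans (sum_coef_le_l1 g (d - k)).
rewrite -(big_mkord xpredT (fun j => `|g`_(j - k) *+ (k <= j)%N|)).
have [h|h] := leqP k d; last first.
  rewrite big1_seq ?sumr_ge0 //= => j; rewrite mem_index_iota => /andP[_ hj].
  by rewrite leqNgt (ltn_trans hj h) mulr0n normr0.
rewrite (big_cat_nat _ h) //= big1_seq ?add0r => [|j]; last first.
  by rewrite /= mem_index_iota => /andP[_ hj]; rewrite leqNgt hj mulr0n normr0.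
rewrite -{1}[k]add0n big_addn big_mkord; apply: ler_sum => j _.
by rewrite addnK leq_addl.
Qed.

Lemma resultant_le (p q : {poly R}) :
  `|resultant p q| <= l1 p ^+ (size q).-1 * l1 q ^+ (size p).-1.
Proof.
pose c (i : 'I_((size q).-1 + (size p).-1)) := match split i with inl _ => l1 p | inr _ => l1 q end.
apply: le_trans (normr_det_le (c := c) _) _ => [i|].
  rewrite /c; case E: (split i) => [k|k].
    by under eq_bigr => j _ do rewrite Sylvester_mxE E; apply: sum_shift_le_l1.
  by under eq_bigr => j _ do rewrite Sylvester_mxE E; apply: sum_shift_le_l1.
rewrite big_split_ord /= (eq_bigr (fun=> l1 p)) => [|i _]; last first.
  by rewrite /c (unsplitK (inl i)).
rewrite [X in _ * X](eq_bigr (fun=> l1 q)) => [|i _]; last first.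
  by rewrite /c (unsplitK (inr i)).
by rewrite !prodr_const !card_ord.
Qed.

End PolyNorm.

Lemma low_coefM (R : nzRingType) (P Q : {poly R}) a b :
  (forall i, (i < a)%N -> P`_i = 0) -> (forall i, (i < b)%N -> Q`_i = 0) ->
  (P * Q)`_(a + b) = P`_a * Q`_b.
Proof.
move=> hP hQ; have ha : (a < (a + b).+1)%N by rewrite ltnS leq_addr.
rewrite coefM (bigD1 (Ordinal ha)) //= addKn big1 ?addr0 // => i ia.
have [h|h] := ltnP i a; first by rewrite hP ?mul0r.
have ne : (i : nat) != a by apply: contraNneq ia => e; apply/eqP/val_inj.
have hi : (a + b - i < b)%N by have := ltn_ord i; lia.
by rewrite (hQ _ hi) mulr0.
Qed.

Lemma first_coef (R : nzRingType) (P : {poly R}) : P != 0 ->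
  exists2 k, P`_k != 0 & forall i, (i < k)%N -> P`_i = 0.
Proof.
move=> P0; have h : exists k, P`_k != 0.
  by exists (size P).-1; rewrite -lead_coefE lead_coef_eq0.
exists (ex_minn h); case: ex_minnP => // k _ hk i ik; apply/eqP.
by apply: contraTT ik => /hk; rewrite -leqNgt.
Qed.

Section Valued.
Variables (p : nat) (K : fieldType) (v : K -> rat).

(** What the approximation argument uses of Q_p. The field [v_prod] is the product formula as a
    lower bound for nonzero integers, and [v_dense] is the density of Z in the unit ball. *)
Record valued : Prop := Valued {
  v_ge0 : forall x, 0 <= v x;
  v0 : v 0 = 0;
  v_eq0 : forall x, v x = 0 -> x = 0;
  vM : forall x y, v (x * y) = v x * v y;
  vD : forall x y, v (x + y) <= Num.max (v x) (v y);
  v_int : forall z : int, v z%:~R <= 1;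
  v_prod : forall z : int, z != 0 -> 1 <= `|z|%:~R * v z%:~R;
  v_p : v p%:R = p%:R^-1;
  v_dense : forall x, v x <= 1 -> forall N, exists a : int, v (x - a%:~R) <= p%:R^-1 ^+ N
}.

Hypothesis V : valued.

Lemma v1 : v 1 = 1.
Proof.
have := vM V 1 1; rewrite mulr1 => h; have := v_eq0 V (x := 1).
have [e|n0 _] := eqVneq (v 1) 0; first by move=> /(_ e)/eqP; rewrite oner_eq0.
by apply: (mulfI n0); rewrite mulr1 -h.
Qed.

End Valued.

Section ValuedTheory.
Variables (p : nat) (K : fieldType) (v : K -> rat).
Hypothesis V : valued p v.

Lemma v_gt0 x : x != 0 -> 0 < v x.
Proof.
move=> x0; rewrite lt_neqAle (v_ge0 V) andbT eq_sym; apply: contraNneq x0 => h.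
by rewrite (v_eq0 V h).
Qed.

Lemma vN x : v (- x) = v x.
Proof.
have h : v (-1) = 1.
  have := vM V (-1) (-1); rewrite mulrNN mulr1 (v1 V) => /esym /eqP.
  by rewrite -expr2 sqrf_eq1 => /orP[/eqP //|/eqP e]; have := v_ge0 V (-1); rewrite e.
by rewrite -mulN1r (vM V) h mul1r.
Qed.

Lemma v_sub_le x y c : v x <= c -> v y <= c -> v (x - y) <= c.
Proof.
by move=> hx hy; apply: le_trans (vD V _ _) _; rewrite vN ge_max hx.
Qed.

Lemma v_add_le x y c : v x <= c -> v y <= c -> v (x + y) <= c.
Proof. by move=> hx hy; apply: le_trans (vD V _ _) _; rewrite ge_max hx. Qed.

Lemma v_sum_le (I : Type) (s : seq I) (P : pred I) (F : I -> K) c :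
  0 <= c -> (forall i, P i -> v (F i) <= c) -> v (\sum_(i <- s | P i) F i) <= c.
Proof.
by move=> c0 h; apply: (big_ind (fun x => v x <= c)) => //; [rewrite (v0 V) | move=> x y; apply: v_add_le].
Qed.

Lemma v_prod_big (I : Type) (s : seq I) (P : pred I) (F : I -> K) :
  v (\prod_(i <- s | P i) F i) = \prod_(i <- s | P i) v (F i).
Proof. by rewrite (big_morph v (vM V) (v1 V)). Qed.

Lemma vX x k : v (x ^+ k) = v x ^+ k.
Proof. by elim: k => [|k ih]; rewrite ?expr0 ?(v1 V) // !exprS (vM V) ih. Qed.

Lemma vV x : v x^-1 = (v x)^-1.
Proof.
have [->|x0] := eqVneq x 0; first by rewrite invr0 (v0 V) invr0.
by apply: (mulfI (lt0r_neq0 (v_gt0 x0))); rewrite -(vM V) !mulfV ?(v1 V) ?lt0r_neq0 ?v_gt0.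
Qed.

Lemma v_mul_le1 x y c : v x <= 1 -> v y <= c -> v (x * y) <= c.
Proof.
move=> hx hy; rewrite (vM V); apply: le_trans hy.
by apply: ler_piMl => //; exact: (v_ge0 V).
Qed.

Lemma v_eq_of_sub x y : v (x - y) < v y -> v x = v y.
Proof.
move=> h; apply/le_anti/andP; split.
  by rewrite -[x](subrK y); apply: v_add_le => //; exact: ltW.
rewrite leNgt; apply/negP => h2.
have : v (x - (x - y)) < v y by apply: le_lt_trans (vD V _ _) _; rewrite vN gt_max h2.
by rewrite subKr ltxx.
Qed.

Lemma v_intr (z : int) : z != 0 -> z%:~R != 0 :> K.
Proof.
move=> z0; apply: contraTneq (v_prod V z0) => ->.
by rewrite (v0 V) mulr0 -ltNge.
Qed.

Lemma v_intr_eq0 (z : int) : (z%:~R == 0 :> K) = (z == 0).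
Proof. by apply/idP/idP => [|/eqP ->]; [exact/contraLR/v_intr | rewrite mulr0z]. Qed.

Definition zev (g : {poly int}) (x : K) := (map_poly intr g).[x].

Lemma zevM g h x : zev (g * h) x = zev g x * zev h x.
Proof. by rewrite /zev rmorphM hornerM. Qed.

Lemma zevD g h x : zev (g + h) x = zev g x + zev h x.
Proof. by rewrite /zev rmorphD hornerD. Qed.

Lemma zevC (c : int) x : zev c%:P x = c%:~R.
Proof. by rewrite /zev map_polyC hornerC. Qed.

Lemma zevE g x : zev g x = \sum_(i < size g) (g`_i)%:~R * x ^+ i.
Proof. by rewrite /zev horner_poly. Qed.

Lemma v_zev_le1 g x : v x <= 1 -> v (zev g x) <= 1.
Proof.
move=> hx; rewrite zevE; apply: v_sum_le => // i _.
apply: v_mul_le1; first exact: (v_int V).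
by rewrite vX; apply: exprn_ile1 => //; exact: (v_ge0 V).
Qed.

Lemma v_pow_sub_le x y k : v x <= 1 -> v y <= 1 -> v (x ^+ k - y ^+ k) <= v (x - y).
Proof.
move=> hx hy; rewrite subrXX mulrC; apply: v_mul_le1; last by [].
apply: v_sum_le => // i _; apply: v_mul_le1; rewrite vX; apply: exprn_ile1 => //; exact: (v_ge0 V).
Qed.

Lemma v_zev_sub_le g x y : v x <= 1 -> v y <= 1 -> v (zev g x - zev g y) <= v (x - y).
Proof.
move=> hx hy; rewrite !zevE -sumrB; apply: v_sum_le => [|i _]; first exact: (v_ge0 V).
by rewrite -mulrBr; apply: v_mul_le1; [exact: (v_int V) | exact: v_pow_sub_le].
Qed.

(** Minimality of the degree stands in for irreducibility over Q; [zprimitive F = F] is added where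
    divisibility over Z is wanted. *)
Definition min_zpoly (F : {poly int}) (x : K) :=
  [/\ F != 0, zev F x = 0 & forall q, q != 0 -> zev q x = 0 -> (size F <= size q)%N].

Lemma min_zpoly_exists (F : {poly int}) x : F != 0 -> zev F x = 0 ->
  exists G, [/\ min_zpoly G x, zprimitive G = G & (size G <= size F)%N].
Proof.
elim: {F}(size F) {-2}F (leqnn (size F)) => [|N ih] F hN F0 Fx.
  by move: hN; rewrite leqn0 size_poly_eq0 (negPf F0).
case: (classic (exists q, [/\ q != 0, zev q x = 0 & (size q < size F)%N])) => [[q [q0 qx hq]]|hno].
  have hqN : (size q <= N)%N by rewrite -ltnS; exact: leq_trans hq hN.
  have [G [h1 h2 h3]] := ih q hqN q0 qx.
  by exists G; split=> //; apply: leq_trans h3 (ltnW hq).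
exists (zprimitive F); rewrite zprimitive_id size_zprimitive; split=> //; split.
- by rewrite zprimitive_eq0.
- have := Fx; rewrite {1}[F]zpolyEprim -mul_polyC zevM zevC => /eqP.
  by rewrite mulf_eq0 v_intr_eq0 zcontents_eq0 (negPf F0) => /eqP.
move=> q q0 qx; rewrite size_zprimitive leqNgt; apply/negP => h.
by apply: hno; exists q.
Qed.

Section Minimal.
Variables (F : {poly int}) (x : K).
Hypotheses (hF : min_zpoly F x).

Lemma min_zpoly_size : (1 < size F)%N.
Proof.
have [F0 Fx _] := hF; rewrite ltnNge; apply/negP => h.
move: Fx F0; rewrite (size1_polyC h) zevC polyC_eq0 => /eqP.
by rewrite v_intr_eq0 => /eqP ->; rewrite eqxx.
Qed.

Lemma min_zpoly_dvd (g : {poly int}) : zev g x = 0 -> F %| g.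
Proof.
have [F0 Fx Fmin] := hF => gx; apply/modp_eq0P/eqP; apply: contraT => m0.
have mx : zev (g %% F) x = 0.
  have := congr1 (zev^~ x) (Pdiv.Idomain.divp_eq g F).
  by rewrite -mul_polyC zevD !zevM gx Fx !mulr0 add0r => <-.
by have := Fmin _ m0 mx; rewrite leqNgt ltn_modpN0.
Qed.

(** The gcd cannot vanish at [x], since [g] does not; were it nonconstant, its cofactor in [F] would
    be a smaller polynomial vanishing at [x]. *)
Lemma min_zpoly_gcd (g : {poly int}) : zev g x != 0 -> resultant F g != 0.
Proof.
have [F0 Fx Fmin] := hF => gx; rewrite resultant_eq0 -leqNgt leqNgt; apply/negP => hs.
have [[c q] /= c0 e] := Pdiv.Idomain.dvdpP _ _ (dvdp_gcdl F g).
have [[c' q'] /= c0' e'] := Pdiv.Idomain.dvdpP _ _ (dvdp_gcdr F g).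
have hx : zev (gcdp F g) x != 0.
  apply: contraNneq gx => h.
  have := congr1 (zev^~ x) e'; rewrite -mul_polyC !zevM zevC h mulr0 => /eqP.
  by rewrite mulf_eq0 v_intr_eq0 (negPf c0').
have q0 : q != 0.
  apply: contraNneq F0 => h; move: e; rewrite h mul0r => /eqP.
  by rewrite scale_poly_eq0 (negPf c0).
have qx : zev q x = 0.
  have := congr1 (zev^~ x) e; rewrite -mul_polyC !zevM Fx mulr0 => /esym/eqP.
  by rewrite mulf_eq0 (negPf hx) orbF => /eqP.
have g0 : gcdp F g != 0 by rewrite -size_poly_gt0; exact: ltn_trans hs.
have := congr1 (fun P : {poly int} => size P) e; rewrite size_scale // size_mul // => es.
have sq : (0 < size q)%N by rewrite size_poly_gt0.
have := Fmin q q0 qx; rewrite es; move: hs sq.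
by move: (size q) (size (gcdp F g)) => a b; lia.
Qed.

(** The resultant is a nonzero integer of the form [u F + w g], hence equal to [w(x) g(x)]. So [v]
    of it is at most [v] of [g(x)], while [v_prod] and [resultant_le] bound it from below. *)
Lemma min_zpoly_liouville (g : {poly int}) : v x <= 1 -> zev g x != 0 ->
  1 <= v (zev g x) * (l1 F ^+ (size g).-1 * l1 g ^+ (size F).-1)%:~R.
Proof.
move=> vx gx; have hF1 := min_zpoly_size.
have [hg|hg] := leqP (size g) 1.
  move: gx; rewrite (size1_polyC hg) zevC v_intr_eq0 => c0.
  have hs : size (g`_0)%:P = 1%N by rewrite size_polyC c0.
  rewrite hs expr0 mul1r /l1 hs big_ord1 coefC /= mulrC.
  have h1 := v_prod V c0; apply: le_trans h1 _.
  rewrite ler_wpM2r ?(v_ge0 V) // ler_int.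
  have : 1 <= `|g`_0| by rewrite -gtz0_ge1 normr_gt0.
  move: hF1; case: (size F) => [|[|m]] //= _ h; rewrite exprS ler_peMr //.
  by rewrite exprn_ege1.
have [[u w] /= _ e] := resultant_in_ideal hF1 hg.
have h0 := v_prod V (min_zpoly_gcd gx).
have eR : v (resultant F g)%:~R <= v (zev g x).
  have [_ Fx _] := hF.
  have := congr1 (zev^~ x) e; rewrite zevD !zevM Fx mulr0 add0r zevC => ->.
  by apply: v_mul_le1 => //; exact: v_zev_le1.
apply: le_trans h0 _; rewrite mulrC; apply: ler_pM; rewrite ?(v_ge0 V) ?ler0z //.
by rewrite ler_int; exact: resultant_le.
Qed.

End Minimal.

End ValuedTheory.

(** * Orders of vanishing and minimal polynomials *)

Section Shift.
Variable R : comNzRingType.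
Implicit Types P : {poly R}.

Definition shift (c : R) P := P \Po ('X + c%:P).

Lemma shiftM c P Q : shift c (P * Q) = shift c P * shift c Q.
Proof. exact: comp_polyM. Qed.

Lemma shiftX c P k : shift c (P ^+ k) = shift c P ^+ k.
Proof. by rewrite /shift rmorphXn. Qed.

Lemma shift_coef0 c P : (shift c P)`_0 = P.[c].
Proof. by rewrite -horner_coef0 horner_comp !hornerE. Qed.

Lemma shift_coef1 c P : (shift c P)`_1 = P^`().[c].
Proof.
have := coef_deriv (shift c P) 0; rewrite mulr1n => <-.
by rewrite deriv_comp derivD derivX derivC addr0 mulr1 -/(shift c P^`()) shift_coef0.
Qed.

Lemma shiftK c P : shift (- c) (shift c P) = P.
Proof.
rewrite /shift -comp_polyA comp_polyD comp_polyX comp_polyC polyCN addrNK.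
exact: comp_polyXr.
Qed.

Lemma shift_neq0 c P : P != 0 -> shift c P != 0.
Proof. by apply: contraNneq => h; rewrite -(shiftK c P) h /shift comp_poly0. Qed.

End Shift.

Lemma coef_shift_le (V : {poly int}) (t : int) (r e : nat) :
  `|t| <= 1 -> (size V <= r.+1)%N -> `|(shift t V)`_e| <= 2 ^+ r * \sum_(i < r.+1) `|V`_i|.
Proof.
move=> ht hr.
have h i j : `|(('X + t%:P) ^+ i)`_j| <= 2 ^+ i :> int.
  elim: i j => [|i ih] j; first by rewrite expr0 coef1; case: eqP.
  rewrite exprSr mulrDr coefD coefMX coefMC; apply: le_trans (ler_normD _ _) _.
  rewrite exprS mulr2n mulrDl mul1r lerD //.
    by case: eqP => _; rewrite ?normr0 ?exprn_ge0.
  by rewrite normrM; apply: le_trans (ih j); rewrite ler_piMr.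
rewrite /shift comp_polyE coef_sum mulr_sumr.
rewrite (big_ord_widen _ (fun i => (V`_i *: ('X + t%:P) ^+ i)`_e) hr).
rewrite [in leLHS]big_mkcond /=.
apply: le_trans (ler_norm_sum _ _ _) _; apply: ler_sum => i _.
case: ifP => _; last by rewrite normr0 mulr_ge0 ?exprn_ge0.
rewrite coefZ normrM mulrC ler_wpM2r //; apply: le_trans (h i e) _.
by rewrite ler_weXn2l // -ltnS.
Qed.

Section VanishBound.
Variables (p : nat) (K : fieldType) (v : K -> rat).
Hypothesis vK : valued p v.
Variables (F : {poly int}) (b : K).
Hypotheses (hF : min_zpoly F b) (primF : zprimitive F = F).

Lemma zev_deriv_neq0 : zev F^`() b != 0.
Proof.
have [F0 Fb Fmin] := hF; have hs := min_zpoly_size vK hF.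
have F'0 : F^`() != 0.
  apply/eqP => /polyP/(_ (size F).-2); rewrite coef_deriv coef0.
  have -> : (size F).-2.+1 = (size F).-1 by case: (size F) hs => [|[]].
  by apply/eqP; rewrite -lead_coefE mulrn_eq0 negb_or lead_coef_eq0 F0; case: (size F) hs => [|[]].
apply/eqP => h; have := Fmin _ F'0 h.
by rewrite leqNgt lt_size_deriv.
Qed.

(** Since [F'(b) != 0], each division by [F] lowers the order of vanishing by exactly one; as [F] is
    primitive, the quotients stay integral. *)
Lemma min_zpoly_exp_dvd k (W : {poly int}) :
  (forall i, (i < k)%N -> (shift b (map_poly intr W))`_i = 0) -> exists G, W = F ^+ k * G.
Proof.
have [F0 Fb Fmin] := hF.
elim: k W => [|k ih] W h; first by exists W; rewrite expr0 mul1r.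
have Wb : zev W b = 0 by rewrite -(h 0%N) // shift_coef0.
have [G eG] := dvdpP_int (min_zpoly_dvd hF Wb); rewrite primF in eG.
have [G' eG'] : exists G', G = F ^+ k * G'.
  apply: ih => i ik; apply/eqP; apply: contraT => hi.
  have G0 : shift b (map_poly intr G) != 0 by apply: contraNneq hi => ->; rewrite coef0.
  have [j hj jmin] := first_coef G0.
  have ji : (j <= i)%N by rewrite leqNgt; apply: contraNN hi => /jmin ->.
  have low i1 : (i1 < 1)%N -> (shift b (map_poly intr F))`_i1 = 0.
    by case: i1 => // _; rewrite shift_coef0.
  have := low_coefM low jmin.
  rewrite -shiftM -rmorphM -eG h ?add1n ?ltnS ?(leq_ltn_trans ji) // => /esym/eqP.
  by rewrite mulf_eq0 (negPf hj) orbF shift_coef1 deriv_map (negPf zev_deriv_neq0).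
by exists G'; rewrite eG eG' mulrA exprS.
Qed.

(** If [W] vanishes at [b] to order [k], then [F ^+ k] divides it, and [|F(t)| ^ k] is bounded
    through the coefficients of [W]. A large value of [F] at a small integer thus plays the role of
    a large height of [b]. *)
Lemma min_zpoly_vanish_bound (f : {rmorphism rat -> K}) (g : nat) (t : int) :
  `|t| <= 1 -> 2 ^+ g <= `|F.[t]| -> vanish_bound f b g.
Proof.
move=> ht hg W r s W0 iW hr hs.
have iW' : W \is a polyOver Num.int by apply/polyOverP.
have [W1 eW] := floorpP iW'.
have mapW : map_poly f W = map_poly intr W1.
  by rewrite eW -map_poly_comp; apply: eq_map_poly => z /=; rewrite rmorph_int.
have W10 : W1 != 0 by apply: contraNneq W0 => h; rewrite eW h rmorph0.
have fW0 : shift b (map_poly intr W1) != 0.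
  by apply: shift_neq0; rewrite -mapW map_poly_eq0.
have [k hk kmin] := first_coef fW0.
exists k; last by rewrite mapW.
have [G eG] := min_zpoly_exp_dvd kmin.
have G0 : G != 0 by apply: contraNneq W10 => h; rewrite eG h mulr0.
(* The cofactor may vanish at [t], so its first nonzero Taylor coefficient there, an integer, is
   used. *)
have [e he emin] := first_coef (shift_neq0 t G0).
have hr1 : (size W1 <= r.+1)%N.
  by move: hr; rewrite eW size_map_poly_id0 // intr_eq0 lead_coef_eq0.
have := coef_shift_le e ht hr1.
have low0 i1 : (i1 < 0)%N -> (shift t F ^+ k)`_i1 = 0 by [].
have := low_coefM low0 emin.
rewrite add0n -shiftX -shiftM -eG => -> h.
have h2 : 2 ^+ (g * k) <= `|(shift t (F ^+ k))`_0 * (shift t G)`_e|.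
  rewrite shift_coef0 horner_exp normrM normrX exprM -[leLHS]mulr1.
  apply: ler_pM; rewrite ?exprn_ge0 //; first by apply: lerXn2r; rewrite ?nnegrE ?exprn_ge0.
  by rewrite -gtz0_ge1 normr_gt0.
have h3 : \sum_(i < r.+1) `|W1`_i| <= 2 ^+ s :> int.
  rewrite -(ler_int rat) rmorph_sum /= rmorphXn /=; apply: le_trans hs.
  by apply: ler_sum => i _; rewrite eW coef_map /= intr_norm.
have : (2 : int) ^+ (g * k) <= 2 ^+ (r + s).
  apply: le_trans h2 _; apply: le_trans h _; rewrite exprD.
  by apply: ler_wpM2l; rewrite ?exprn_ge0.
rewrite ler_eXn2l // => h4; rewrite mulnC; apply: leq_trans h4 _; lia.
Qed.

End VanishBound.

(** * The auxiliary polynomial *)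

Section Count.
Variables (m M : nat) (r : 'I_m -> nat).
Hypotheses (r0 : forall i, (0 < r i)%N) (rM : forall i, (r i <= M)%N).
Variable R : realFieldType.

Definition box : {pred {ffun 'I_m -> 'I_M.+1}} := family (fun i => [pred j : 'I_M.+1 | (j <= r i)%N]).

Let y (i : 'I_m) (j : nat) : R := j%:R / (r i)%:R - 2^-1.

Lemma sum_ord_le (i : 'I_m) (G : nat -> R) : \sum_(j < M.+1 | (j <= r i)%N) G j = \sum_(j < (r i).+1) G j.
Proof. by rewrite (big_ord_widen M.+1 G) // ltnS rM. Qed.

Lemma sum_centered i : \sum_(j < M.+1 | (j <= r i)%N) y i j = 0.
Proof.
rewrite sum_ord_le; apply/eqP; rewrite -[_ == 0](mulrn_eq0 _ 2) /= mulr2n.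
(* The reflection [j -> r i - j] changes the sign of [y i j]. *)
rewrite {1}(reindex_inj rev_ord_inj) -big_split big1 //= => j _.
rewrite /y; have := ltn_ord j; rewrite ltnS => hj.
have -> : ((r i).+1 - j.+1)%:R = (r i)%:R - (j : nat)%:R :> R by rewrite subSS natrB.
have h : (r i)%:R != 0 :> R by rewrite pnatr_eq0 -lt0n r0.
by field.
Qed.

Lemma sum_cross (i j : 'I_m) : i != j -> \sum_(k in box) y i (k i) * y j (k j) = 0.
Proof.
move=> ij.
pose G (l : 'I_m) (a : 'I_M.+1) : R := if l == i then y i a else if l == j then y j a else 1.
transitivity (\sum_(k in box) \prod_l G l (k l)).
  apply: eq_bigr => k _; rewrite (bigD1 i) //= (bigD1 j) 1?eq_sym //= /G !eqxx.
  rewrite eq_sym (negPf ij) big1 ?mulr1 // => l /andP[li lj].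
  by rewrite (negPf li) (negPf lj).
rewrite -(bigA_distr_big_dep (fun l => [pred a : 'I_M.+1 | (a <= r l)%N]) G) (bigD1 i) //= /G eqxx.
by rewrite sum_centered mul0r.
Qed.

Lemma y_sqr_le i (j : 'I_M.+1) : (j <= r i)%N -> y i j ^+ 2 <= 4^-1.
Proof.
move=> h; rewrite /y; have r1 : 0 < (r i)%:R :> R by rewrite ltr0n.
have h1 : j%:R / (r i)%:R <= 1 :> R by rewrite ler_pdivrMr // mul1r ler_nat.
have h0 : 0 <= j%:R / (r i)%:R :> R by rewrite divr_ge0.
move: h0 h1; set x := _ / _ => h0 h1; have : 0 <= x * (1 - x) by rewrite mulr_ge0 // subr_ge0.
rewrite !expr2; lra.
Qed.

Lemma sum_sqr_le : \sum_(k in box) (\sum_i y i (k i)) ^+ 2 <= #|box|%:R * (m%:R / 4).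
Proof.
apply: (@le_trans _ _ (\sum_(k in box) \sum_i y i (k i) ^+ 2)).
  rewrite le_eqVlt; apply/orP; left; apply/eqP.
  transitivity (\sum_(k in box) \sum_i \sum_j y i (k i) * y j (k j)).
    apply: eq_bigr => k _; rewrite expr2 mulr_suml; apply: eq_bigr => i _.
    by rewrite mulr_sumr.
  rewrite exchange_big [RHS]exchange_big; apply: eq_bigr => i _ /=.
  rewrite exchange_big (bigD1 i) //= [X in _ + X]big1 ?addr0 => [|j ji]; last first.
    by rewrite sum_cross // eq_sym.
  by apply: eq_bigr => k _; rewrite expr2.
apply: (@le_trans _ _ (\sum_(k in box) (m%:R / 4))); last first.
  by rewrite sumr_const -[leLHS]mulr_natl.
apply: ler_sum => k /familyP kb; apply: (@le_trans _ _ (\sum_(i < m) 4^-1)).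
  by apply: ler_sum => i _; apply: y_sqr_le; exact: kb.
by rewrite sumr_const card_ord -[leLHS]mulr_natl.
Qed.

(** A weight below [m (1/2 - eta)] makes the centred sum at most [- eta m], while its mean square
    over the box is at most [m / 4], the coordinates being uncorrelated. *)
Lemma chebyshev_count (eta : R) : 0 < eta -> (0 < m)%N ->
  #|[pred k in box | \sum_i (k i)%:R / (r i)%:R < m%:R * (2^-1 - eta)]|%:R * (4 * eta ^+ 2 * m%:R)
    <= #|box|%:R.
Proof.
move=> e0 m0; set B := [pred k in box | _].
have m0' : 0 < m%:R :> R by rewrite ltr0n.
have h : #|B|%:R * (eta * m%:R) ^+ 2 <= #|box|%:R * (m%:R / 4).
  apply: le_trans sum_sqr_le; rewrite mulr_natl -sumr_const.
  rewrite [leRHS](bigID (mem B)) /= -[leLHS]addr0 lerD ?sumr_ge0 // => [|k _]; last by rewrite sqr_ge0.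
  have e k : (k \in box) && (k \in B) = (k \in B) by rewrite inE /= andb_idl // => /andP[].
  rewrite [leRHS](eq_bigl _ _ e); apply: ler_sum => k /andP[_ hk].
  have hs : \sum_i y i (k i) = \sum_i (k i)%:R / (r i)%:R - m%:R / 2.
    by rewrite /y sumrB sumr_const card_ord -[X in _ - X]mulr_natl.
  have hs2 : \sum_i y i (k i) <= - (eta * m%:R).
    rewrite hs; move: hk; set S := \sum_i _ => hk; apply/ltW; move: hk; nra.
  have h0 : 0 <= eta * m%:R by rewrite mulr_ge0 // ltW.
  by rewrite -[leRHS]sqrrN ler_sqr ?nnegrE //; lra.
rewrite -(ler_pM2r m0'); move: h; set b := #|B|%:R; set c := #|box|%:R => h.
rewrite exprMn in h; nra.
Qed.

Lemma card_box_le : (#|box| <= 2 ^ \sum_i r i)%N.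
Proof.
rewrite card_family foldrE big_map big_enum /= expn_sum; apply: leq_prod => i _.
apply: leq_trans (_ : (r i).+1 <= _)%N; last exact: ltn_expl.
have hw := @big_ord_widen _ 0%N addn (r i).+1 M.+1 (fun=> 1%N).
by rewrite -sum1_card -hw ?ltnS ?rM // sum1_card card_ord.
Qed.

End Count.

Lemma hderX n (m mu : 'X_{1..n}) : hder mu 'X_[m] = (mbin m mu)%:R *: 'X_[m - mu].
Proof.
rewrite /hder mderivmX ffact_mbin scalerA natrM mulrC -mulrA mulfV ?mulr1 //.
exact: mfact_neq0.
Qed.

Lemma mcoeff_tayX n (K : fieldType) (f : {rmorphism rat -> K}) (al : K) (m mu : 'X_{1..n}) :
  (tay f (fun=> al) 'X_[m])@_mu = (mbin m mu)%:R * al ^+ mdeg (m - mu).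
Proof.
rewrite -tay_hder0 hderX tayZ mcoeffZ rmorph_nat; congr (_ * _).
rewrite /tay mmapX /mmap1 rmorph_prod /= mdegE -prodrXr; apply: eq_bigr => i _.
by rewrite rmorphXn /= mcoeffD mcoeffX mcoeffC eqxx mulr1 mnm1_eq0 add0r.
Qed.

Lemma pigeonhole_ffun (A B : finType) (X Y : nat) (h : {ffun A -> 'I_X} -> {ffun B -> 'I_Y}) :
  (Y ^ #|B| < X ^ #|A|)%N -> exists c, exists2 c', c != c' & h c = h c'.
Proof.
move=> hlt; apply/injectivePn; apply/negP => /injectiveP /leq_card.
by rewrite !card_ffun !card_ord leqNgt hlt.
Qed.

Lemma modz_eq_dvd (P : nat) (x y : int) :
  (0 < P)%N -> `|(x %% P)%Z|%N = `|(y %% P)%Z|%N -> (P %| x - y)%Z.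
Proof.
move=> P0 h; rewrite -eqz_mod_dvd; apply/eqP.
have hP : P%:Z != 0 by rewrite eqz_nat -lt0n.
by rewrite -[LHS]gez0_abs ?modz_ge0 // -[RHS]gez0_abs ?modz_ge0 // h.
Qed.

Lemma sum1_count_ord_le n j : (\sum_(i < n) ((i : nat) == j) <= 1)%N.
Proof.
have [jn|jn] := ltnP j n; last first.
  by rewrite big1 // => i _; case: eqP => // e; move: (ltn_ord i); rewrite e ltnNge jn.
rewrite (bigD1 (Ordinal jn)) //= eqxx big1 // => i; rewrite -val_eqE /= => /negPf -> //.
Qed.

Lemma leq_exp2r_le a c n : (a <= c)%N -> (a ^ n <= c ^ n)%N.
Proof. by move=> h; case: n => // n; rewrite leq_exp2r. Qed.

Lemma mul_lt_of_le (F : realFieldType) (x y B c : F) : 0 < B -> x < y -> B * y <= c -> x * B < c.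
Proof. by move=> B0 xy h; apply: lt_le_trans h; rewrite mulrC ltr_pM2l. Qed.

Lemma normz_sub_lt (x y B : nat) : (x < B)%N -> (y < B)%N -> `|x%:Z - y%:Z| <= B%:Z.
Proof. lia. Qed.

Section Auxiliary.
Variables (p : nat) (K : fieldType) (v : K -> rat) (f : {rmorphism rat -> K}).
Hypotheses (vK : valued p v) (p1 : (1 < p)%N).
Variables (al : K) (F : {poly int}) (e : nat).
Hypotheses (val1 : v al <= 1) (hF : min_zpoly F al) (hFe : l1 F <= 2 ^+ e).
Variables (m : nat) (r : 'I_m -> nat).
Hypotheses (r0 : forall i, (0 < r i)%N).

Let S := (\sum_i r i)%N.
Let d := (size F).-1.
Let J := @box m S r.
Let JT := {k : {ffun 'I_m -> 'I_S.+1} | k \in J}.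

Definition box_mon (k : JT) : 'X_{1..m} := [multinom (val k i : nat) | i < m].

Lemma box_monE k i : box_mon k i = val k i.
Proof. by rewrite mnmE. Qed.

Lemma box_mon_le k i : (box_mon k i <= r i)%N.
Proof. by rewrite box_monE; have /familyP := valP k; apply. Qed.

Lemma box_mon_inj : injective box_mon.
Proof.
move=> k k' /mnmP h; apply/val_inj/ffunP => i; apply: val_inj.
by have := h i; rewrite !box_monE.
Qed.

Lemma mdeg_box_mon k : (mdeg (box_mon k) <= S)%N.
Proof. by rewrite mdegE; apply: leq_sum => i _; apply: box_mon_le. Qed.

Definition bpoly (c : JT -> int) : {mpoly rat[m]} := \sum_k (c k)%:~R *: 'X_[box_mon k].
(** All coordinates of the point are [al], so a divided derivative takes there the value of an
    integral polynomial in one variable. *)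
Definition gpoly (c : JT -> int) (mu : 'X_{1..m}) : {poly int} :=
  \sum_k (c k * (mbin (box_mon k) mu)%:Z) *: 'X^(mdeg (box_mon k - mu)).

Lemma tay_bpoly c mu : (tay f (fun=> al) (bpoly c))@_mu = zev (gpoly c mu) al.
Proof.
rewrite /bpoly rmorph_sum raddf_sum /zev /gpoly rmorph_sum horner_sum; apply: eq_bigr => k _ /=.
rewrite tayZ mcoeffZ mcoeff_tayX map_polyZ map_polyXn hornerZ hornerXn rmorph_int rmorphM /= mulrA.
by rewrite -pmulrn.
Qed.

Lemma mcoeff_bpoly c k : (bpoly c)@_(box_mon k) = (c k)%:~R.
Proof.
rewrite /bpoly raddf_sum (bigD1 k) //= mcoeffZ mcoeffX eqxx mulr1 big1 ?addr0 // => k' kk'.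
by rewrite mcoeffZ mcoeffX (inj_eq box_mon_inj) (negPf kk') mulr0.
Qed.

Lemma intm_bpoly c : intm (bpoly c).
Proof.
move=> mu; rewrite /bpoly raddf_sum rpred_sum // => k _ /=.
by rewrite mcoeffZ mcoeffX rpredM ?Num.Theory.intr_int ?Num.Theory.natr_int.
Qed.

Lemma degle_bpoly c : degle r (bpoly c).
Proof.
apply: degle_sum => k _; apply: degleZ => mu; rewrite msuppX inE => /eqP -> i.
exact: box_mon_le.
Qed.

Lemma card_JT : (#|{: JT}| <= 2 ^ S)%N.
Proof.
rewrite card_sig; apply: leq_trans (card_box_le (M := S) (r := r) _) => // i.
by rewrite /S (bigD1 i) //= leq_addr.
Qed.

Lemma nrm_bpoly c b : (forall k, `|c k| <= 2 ^+ b) -> nrm (bpoly c) <= 2 ^+ (S + b).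
Proof.
move=> h; apply: le_trans (nrm_sum _ _ _) _.
apply: (@le_trans _ _ (\sum_(k : JT) 2 ^+ b)).
  apply: ler_sum => k _; rewrite nrmZ nrmX mulr1 -intr_norm.
  by have := h k; rewrite -(ler_int rat) rmorphXn.
rewrite sumr_const -[leLHS]mulr_natl exprD ler_wpM2r ?exprn_ge0 // -natrX ler_nat.
exact: card_JT.
Qed.

Lemma size_gpoly c mu : (size (gpoly c mu) <= S.+1)%N.
Proof.
apply: leq_trans (size_sum _ _ _) _; apply/bigmax_leqP => k _.
apply: leq_trans (size_scale_leq _ _) _; rewrite size_polyXn ltnS.
by apply: leq_trans (mdegB _ _) _; apply: mdeg_box_mon.
Qed.

Lemma l1_gpoly c mu b : (forall k, `|c k| <= 2 ^+ b) -> l1 (gpoly c mu) <= 2 ^+ (2 * S + b).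
Proof.
move=> h; apply: (@le_trans _ _ (\sum_(k : JT) 2 ^+ (b + S))).
  rewrite /l1; apply: (@le_trans _ _ (\sum_(i < size (gpoly c mu)) \sum_k
      `|c k * (mbin (box_mon k) mu)%:Z| * ((i : nat) == mdeg (box_mon k - mu))%:R)).
    apply: ler_sum => i _; rewrite /gpoly coef_sum; apply: le_trans (ler_norm_sum _ _ _) _.
    by apply: ler_sum => k _; rewrite coefZ coefXn normrM [X in _ * X]ger0_norm.
  rewrite exchange_big; apply: ler_sum => k _ /=; rewrite -mulr_sumr.
  apply: (@le_trans _ _ `|c k * (mbin (box_mon k) mu)%:Z|).
    rewrite ler_piMr // -natr_sum -[1]/(1%:R) ler_nat sum1_count_ord_le.
    by [].
  rewrite normrM exprD; apply: ler_pM => //; rewrite ger0_norm // -natrX natz lez_nat.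
  by apply: mbin_le => i; apply: box_mon_le.
rewrite sumr_const -[leLHS]mulr_natl (_ : 2 * S + b = S + (b + S))%N; last by lia.
by rewrite (exprD _ S) ler_wpM2r ?exprn_ge0 // -natrX ler_nat card_JT.
Qed.

Lemma gpoly_sub c c' mu : gpoly (fun k => c k - c' k) mu = gpoly c mu - gpoly c' mu.
Proof. by rewrite /gpoly -sumrB; apply: eq_bigr => k _; rewrite mulrBl scalerBl. Qed.

(** [N] exceeds by one the exponent of 2 in Liouville's bound for [gpoly], and [b] is chosen so that
    [N = b * d.+1]; the pigeonhole condition then depends neither on [e] nor on [S]. *)
Let b := ((e + 2 * d) * S + 1)%N.
Let N := (e * S + (2 * S + b) * d + 1)%N.

(** A congruence modulo [p ^ N] at an integer [a] close to [al] makes the value at [al] at most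
    [p ^ (- N)], whereas a nonzero value is at least [2 ^ (- (N - 1))]. Vanishing at [al] thus
    becomes a congruence, open to the pigeonhole principle. *)
Lemma small_gpoly_eq0 c mu (a : int) : (forall k, `|c k| <= 2 ^+ b) ->
  v (al - a%:~R) <= p%:R^-1 ^+ N -> ((p ^ N)%:Z %| (gpoly c mu).[a])%Z ->
  zev (gpoly c mu) al = 0.
Proof.
move=> hc ha /dvdzP[q hq]; apply/eqP; apply: contraT => nz.
set D := gpoly c mu in hq nz *.
have p0 : 0 < p%:R :> rat by rewrite ltr0n; exact: ltn_trans p1.
have q0 : 0 <= p%:R^-1 ^+ N :> rat by rewrite exprn_ge0 // invr_ge0 ltW //.
have va : v a%:~R <= 1 by exact: (v_int vK).
have vDa : v (zev D (a%:~R : K)) <= p%:R^-1 ^+ N.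
  have eDa : zev D (a%:~R : K) = (q * (p ^ N)%:Z)%:~R.
    by rewrite -hq; exact: (horner_map (intmul 1) D a).
  rewrite eDa rmorphM /=; apply: (v_mul_le1 vK); first exact: (v_int vK).
  by rewrite -pmulrn natrX (vX vK) (v_p vK).
have vD : v (zev D al) <= p%:R^-1 ^+ N.
  rewrite -[zev D al](subrK (zev D (a%:~R : K))); apply: (v_add_le vK) => //.
  exact: le_trans (v_zev_sub_le vK _ val1 va) ha.
have hL := min_zpoly_liouville vK hF val1 nz.
have hB : (l1 F ^+ (size D).-1 * l1 D ^+ d) <= 2 ^+ N.-1 :> int.
  rewrite /N addn1 /= exprD; apply: ler_pM; rewrite ?exprn_ge0 ?l1_ge0 //.
    apply: (@le_trans _ _ ((2 ^+ e) ^+ (size D).-1)); first by apply: lerXn2r; rewrite ?nnegrE ?l1_ge0 ?exprn_ge0.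
    rewrite exprM ler_weXn2l ?exprn_ege1 //; have := size_gpoly c mu; rewrite -/D.
    by case: (size D).
  rewrite exprM; apply: lerXn2r; rewrite ?nnegrE ?l1_ge0 ?exprn_ge0 //.
  exact: l1_gpoly.
have : (1 : rat) <= p%:R^-1 ^+ N * 2 ^+ N.-1.
  apply: le_trans hL _; apply: ler_pM => //; first exact: (v_ge0 vK).
    by rewrite ler0z mulr_ge0 ?exprn_ge0 ?l1_ge0.
  have -> : (2 : rat) ^+ N.-1 = (2 ^+ N.-1 : int)%:~R by rewrite rmorphXn.
  by rewrite ler_int.
rewrite exprVn mulrC ler_pdivlMr ?exprn_gt0 // mul1r leNgt -!natrX ltr_nat => /negP; case.
rewrite /N addn1 /= expnS; apply: (@leq_trans (2 * 2 ^ (e * S + (2 * S + b) * d))).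
  by rewrite ltn_Pmull // expn_gt0.
apply: leq_mul => //; exact: leq_exp2r_le.
Qed.

Let low (eta : rat) := [pred k in J | \sum_i (k i)%:R / (r i)%:R < m%:R * (2^-1 - eta)].

Lemma low_count (eta : rat) : 0 < eta -> (0 < m)%N -> (d.+1 * p)%:R < 4 * eta ^+ 2 * m%:R ->
  ((p ^ N) ^ #|low eta| < (2 ^ b) ^ #|J|)%N.
Proof.
move=> eta0 m0 hm.
have rS i : (r i <= S)%N by rewrite /S (bigD1 i) //= leq_addr.
have J0 : (0 < #|J|)%N.
  by apply/card_gt0P; exists [ffun=> ord0]; apply/familyP => i; rewrite ffunE inE.
have hB : (d.+1 * p * #|low eta| < #|J|)%N.
  have [->|B0] := posnP #|low eta|; first by rewrite muln0.
  have hc := chebyshev_count r0 rS eta0 m0.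
  rewrite -(ltr_nat rat) natrM; apply: (mul_lt_of_le _ hm hc).
  by rewrite ltr0n.
(* The crude bound [p <= 2 ^ p] replaces a logarithm and accounts for the factor [p] in the
   hypothesis. *)
rewrite -!expnM; apply: (@leq_ltn_trans (2 ^ (p * (N * #|low eta|)))).
  by rewrite [leqRHS]expnM; apply: leq_exp2r_le; apply/ltnW/ltn_expl.
rewrite ltn_exp2l // (_ : N = b * d.+1)%N; last by rewrite /N /b; lia.
rewrite (_ : p * _ = b * (d.+1 * p * #|low eta|))%N; last by rewrite !mulnA; congr (_ * _)%N; lia.
by rewrite ltn_pmul2l // /b addn1.
Qed.

Lemma auxiliary_polynomial (eta : rat) :
  0 < eta -> (0 < m)%N -> (d.+1 * p)%:R < 4 * eta ^+ 2 * m%:R ->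
  exists P : {mpoly rat[m]}, [/\ P != 0, intm P, degle r P, nrm P <= 2 ^+ (S + b)
    & indge f (fun=> al) r (m%:R * (2^-1 - eta)) P].
Proof.
move=> eta0 m0 hm.
pose BT := {k : {ffun 'I_m -> 'I_S.+1} | k \in low eta}.
have [a ha] := v_dense vK val1 N.
have Y0 : (0 < p ^ N)%N by rewrite expn_gt0 (ltn_trans _ p1).
have Ylt (z : int) : (`|(z %% (p ^ N)%:Z)%Z| < p ^ N)%N.
  rewrite -ltz_nat gez0_abs ?modz_ge0 ?ltz_pmod //.
  by rewrite eqz_nat -lt0n.
pose bad_mon (k : BT) : 'X_{1..m} := [multinom (val k i : nat) | i < m].
pose toZ (c : {ffun JT -> 'I_(2 ^ b)}) (k : JT) : int := (c k : nat)%:Z.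
(* Residues at [a] of the derivatives of low weight; the difference of two coefficient vectors with
   equal residues is the vector sought. *)
pose h (c : {ffun JT -> 'I_(2 ^ b)}) : {ffun BT -> 'I_(p ^ N)} :=
  [ffun k => Ordinal (Ylt (gpoly (toZ c) (bad_mon k)).[a])].
have [c [c' cc' hcc']] : exists c, exists2 c', c != c' & h c = h c'.
  by apply: pigeonhole_ffun; rewrite !card_sig; apply: low_count.
pose D k := toZ c k - toZ c' k.
have hD k : `|D k| <= 2 ^+ b.
  have h1 := ltn_ord (c k); have h2 := ltn_ord (c' k).
  have -> : (2 : int) ^+ b = (2 ^ b)%N by rewrite -natrX natz.
  exact: normz_sub_lt.
have [k0 hk0] : exists k, D k != 0.
  case: (boolP [exists k, D k != 0]) => [/existsP //|/existsPn hn]; case/eqP: cc'.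
  apply/ffunP => k; apply: ord_inj.
  have := hn k; rewrite negbK subr_eq0 /toZ eqz_nat => /eqP h0; exact: h0.
exists (bpoly D); split.
- by apply: contraNneq hk0 => e0; have := mcoeff_bpoly D k0; rewrite e0 mcoeff0 => /esym/eqP; rewrite intr_eq0.
- exact: intm_bpoly.
- exact: degle_bpoly.
- exact: nrm_bpoly.
move=> mu wmu; rewrite tay_bpoly.
(* Outside the box the derivative is identically zero, so only indices in [low eta] impose
   conditions. *)
have [hr|/existsPn hr] := boolP [exists i, r i < mu i]%N.
  have [i hi] := existsP hr; rewrite (_ : gpoly D mu = 0) ?/zev ?rmorph0 ?horner0 //.
  rewrite /gpoly big1 // => k _; rewrite /mbin (bigD1 i) //= bin_small ?mul0n ?mulr0 ?scale0r //.
  exact: leq_ltn_trans (box_mon_le k i) hi.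
have rS i : (r i <= S)%N by rewrite /S (bigD1 i) //= leq_addr.
have muS i : (mu i < S.+1)%N by rewrite ltnS; apply: leq_trans (rS i); rewrite leqNgt hr.
pose k : {ffun 'I_m -> 'I_S.+1} := [ffun i => Ordinal (muS i)].
have kE i : (k i : nat) = mu i by rewrite ffunE.
have kJ : k \in J by apply/familyP => i; rewrite inE kE leqNgt hr.
have kB : k \in low eta.
  rewrite inE kJ /=; apply: le_lt_trans wmu; rewrite le_eqVlt; apply/orP; left; apply/eqP.
  by apply: eq_bigr => i _; rewrite kE.
have ek : bad_mon (Sub k kB) = mu by apply/mnmP => i; rewrite mnmE SubK.
apply: (small_gpoly_eq0 hD ha).
rewrite gpoly_sub hornerD hornerN; apply: modz_eq_dvd => //.
have := congr1 (fun u : {ffun BT -> 'I_(p ^ N)} => nat_of_ord (u (Sub k kB))) hcc'.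
by rewrite !ffunE ek.
Qed.

End Auxiliary.

Lemma mcoeff0_tay n (K : fieldType) (f : {rmorphism rat -> K}) (be : 'I_n -> K) (P : {mpoly rat[n]}) :
  (tay f be P)@_0 = \sum_(m <- msupp P) f P@_m * \prod_i be i ^+ m i.
Proof.
rewrite /tay /mmap rmorph_sum; apply: eq_bigr => m _; rewrite rmorphM /=.
rewrite mcoeffC eqxx mulr1 /mmap1 rmorph_prod /=; congr (_ * _); apply: eq_bigr => i _.
by rewrite rmorphXn /= mcoeffD mcoeffX mcoeffC eqxx mulr1 mnm1_eq0 add0r.
Qed.

Lemma leq_absD (x y : int) : (`|(x + y)%R| <= `|x| + `|y|)%N.
Proof. lia. Qed.

Lemma product_bound (a b a' b' x y : nat) :
  (a * a' + y * (b * b') + (a * b' + b * a' + x * (b * b')) <= (1 + x + y) * (a + b) * (a' + b'))%N.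
Proof. nia. Qed.

Lemma norm_bound (a b S x y : nat) : (a + b <= S)%N ->
  (a ^ 2 + x * (a * b) + y * b ^ 2 <= (1 + x + y) * S ^ 2)%N.
Proof.
move=> h; apply: (@leq_trans ((1 + x + y) * (a + b) ^ 2)); last by rewrite leq_mul2l leq_sqr h orbT.
by rewrite -!mulnn; nia.
Qed.

(** * Approximation by elements of a quadratic field *)

Section QuadraticSize.
Variables (p : nat) (K : fieldType) (v : K -> rat).
Hypothesis vK : valued p v.
Variables (de : K) (t u : int).
Hypotheses (quad : de ^+ 2 = t%:~R * de + u%:~R) (vde : v de <= 1).
Hypothesis irr : forall X Y : int, X%:~R + Y%:~R * de = 0 -> X = 0 /\ Y = 0.

(* The constant that makes the size [|X| + |Y|] of [X + Y de] submultiplicative. *)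
Let c := (1 + `|t| + `|u|)%N.

Definition sz (S : nat) (xi : K) := exists X Y : int,
  xi = X%:~R + Y%:~R * de /\ (`|X| + `|Y| <= S)%N.
(** Here the bound includes the constant [c], so that a long product of such elements has size at
    most the product of the bounds, with no constant lost per factor. *)
Definition csz (T : nat) (xi : K) := exists X Y : int,
  xi = X%:~R + Y%:~R * de /\ (c * (`|X| + `|Y|) <= T)%N.

Lemma szW S S' xi : (S <= S')%N -> sz S xi -> sz S' xi.
Proof. by move=> h [X [Y [e hS]]]; exists X, Y; split=> //; exact: leq_trans hS h. Qed.

Lemma sz_int (z : int) : sz `|z| z%:~R.
Proof. by exists z, 0; split; [rewrite mul0r addr0 | rewrite addn0]. Qed.

Lemma szD S S' xi xi' : sz S xi -> sz S' xi' -> sz (S + S') (xi + xi').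
Proof.
move=> [X [Y [-> hS]]] [X' [Y' [-> hS']]]; exists (X + X'), (Y + Y'); split.
  by rewrite !rmorphD /=; ring.
apply: leq_trans (leq_add (leq_absD X X') (leq_absD Y Y')) _.
by rewrite addnACA; apply: leq_add.
Qed.

Lemma quad_mul_bound (X Y X' Y' : int) :
  (`|(X * X' + u * (Y * Y'))%R| + `|(X * Y' + Y * X' + t * (Y * Y'))%R| <=
    c * (`|X| + `|Y|) * (`|X'| + `|Y'|))%N.
Proof.
have h1 := leq_absD (X * X') (u * (Y * Y')).
have h2 := leq_absD (X * Y' + Y * X') (t * (Y * Y')).
have h3 := leq_absD (X * Y') (Y * X').
rewrite (abszM X X') (abszM u) (abszM Y Y') in h1.
rewrite (abszM t) (abszM Y Y') in h2; rewrite (abszM X Y') (abszM Y X') in h3.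
apply: leq_trans (leq_add h1 (leq_trans h2 (leq_add h3 (leqnn _)))) _.
exact: product_bound.
Qed.

Lemma szM T S xi xi' : csz T xi -> sz S xi' -> sz (T * S) (xi * xi').
Proof.
move=> [X [Y [-> hT]]] [X' [Y' [-> hS]]].
exists (X * X' + u * (Y * Y')), (X * Y' + Y * X' + t * (Y * Y')); split.
  rewrite !(rmorphD, rmorphM) /=.
  transitivity (X%:~R * X'%:~R + (X%:~R * Y'%:~R + Y%:~R * X'%:~R) * de + Y%:~R * Y'%:~R * de ^+ 2).
    by ring.
  by rewrite quad; ring.
by apply: leq_trans (quad_mul_bound _ _ _ _) _; apply: leq_mul.
Qed.

Lemma szXM T S xi xi' k : csz T xi -> sz S xi' -> sz (T ^ k * S) (xi ^+ k * xi').
Proof.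
move=> h hS; elim: k => [|k ih]; first by rewrite expn0 mul1n expr0 mul1r.
by rewrite exprS expnS -mulrA -mulnA; apply: szM.
Qed.

Lemma sz_sum (I : eqType) (s : seq I) (F : I -> K) (B : I -> nat) :
  (forall i, i \in s -> sz (B i) (F i)) -> sz (\sum_(i <- s) B i) (\sum_(i <- s) F i).
Proof.
elim: s => [|i s ih] h; first by rewrite !big_nil; exact: (sz_int 0).
rewrite !big_cons; apply: szD; first by apply: h; rewrite inE eqxx.
by apply: ih => j js; apply: h; rewrite inE js orbT.
Qed.

(** The norm of [xi] is a nonzero integer and the conjugate factor lies in the unit ball, so [v] of
    the norm is at most [v xi]. The square is the cost of the quadratic field. *)
Lemma sz_norm S xi : sz S xi -> xi != 0 -> 1 <= v xi * (c * S ^ 2)%:R.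
Proof.
move=> [X [Y [exi hS]]] nz.
pose Nm : int := X ^+ 2 + t * (X * Y) - u * Y ^+ 2.
have eN : Nm%:~R = xi * (X%:~R + t%:~R * Y%:~R - Y%:~R * de).
  rewrite exi /Nm !(rmorphB, rmorphD, rmorphM, rmorphXn) /=.
  transitivity (X%:~R ^+ 2 + t%:~R * (X%:~R * Y%:~R) + t%:~R * de * Y%:~R ^+ 2 - Y%:~R ^+ 2 * de ^+ 2).
    by rewrite quad; ring.
  by ring.
have Nz : Nm != 0.
  rewrite -(v_intr_eq0 vK) eN mulf_neq0 //; apply: contraNneq nz => h.
  have := @irr (X + t * Y) (- Y); rewrite rmorphD rmorphM rmorphN /= mulNr h => /(_ erefl)[].
  move=> h1 h2; have Y0 : Y = 0 by rewrite -[Y]opprK h2 oppr0.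
  have X0 : X = 0 by rewrite -h1 Y0 mulr0 addr0.
  by rewrite exi X0 Y0 mul0r addr0.
have h0 := v_prod vK Nz.
have hv : v Nm%:~R <= v xi.
  rewrite eN mulrC; apply: (v_mul_le1 vK) => //.
  apply: (v_sub_le vK); last by apply: (v_mul_le1 vK) => //; exact: (v_int vK).
  apply: (v_add_le vK); first exact: (v_int vK).
  by apply: (v_mul_le1 vK); exact: (v_int vK).
have hN : (`|Nm| <= c * S ^ 2)%N.
  have h1 := leq_absD (X ^+ 2 + t * (X * Y)) (- (u * Y ^+ 2)).
  have h2 := leq_absD (X ^+ 2) (t * (X * Y)).
  rewrite abszN (abszM u) abszX in h1; rewrite abszX (abszM t) (abszM X) in h2.
  apply: leq_trans h1 _; apply: leq_trans (leq_add h2 (leqnn _)) _.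
  exact: norm_bound.
apply: le_trans h0 _; rewrite mulrC; apply: ler_pM; rewrite ?(v_ge0 vK) ?ler0z //.
by rewrite -abszE -pmulrn ler_nat.
Qed.

End QuadraticSize.

Section Evaluation.
Variables (p : nat) (K : fieldType) (v : K -> rat) (f : {rmorphism rat -> K}).
Hypotheses (vK : valued p v) (p1 : (1 < p)%N).
Variables (de : K) (t u : int).
Hypotheses (quad : de ^+ 2 = t%:~R * de + u%:~R) (vde : v de <= 1).
Hypothesis irr : forall X Y : int, X%:~R + Y%:~R * de = 0 -> X = 0 /\ Y = 0.
Variables (m : nat) (r : 'I_m -> nat).
Implicit Types (Q : {mpoly rat[m]}).

Lemma szZ (z : int) S xi : sz de S xi -> sz de (`|z| * S) (z%:~R * xi).
Proof.
move=> [X [Y [-> hS]]]; exists (z * X), (z * Y); split; first by rewrite !rmorphM /=; ring.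
by rewrite (abszM z X) (abszM z Y) -mulnDr leq_mul2l hS orbT.
Qed.

Lemma sz_prod_pow (num den : 'I_m -> K) (T : 'I_m -> nat) (k : 'I_m -> nat) :
  (forall j, csz de t u (T j) (num j)) -> (forall j, csz de t u (T j) (den j)) ->
  (forall j, (k j <= r j)%N) ->
  sz de (\prod_j T j ^ r j) (\prod_j (num j ^+ k j * den j ^+ (r j - k j))).
Proof.
move=> hn hd hk; elim/big_rec2: _ => [|j xi S _ ih]; first exact: (sz_int de 1).
rewrite -mulrA -{1}(subnKC (hk j)) expnD -mulnA.
by apply: (szXM quad); rewrite //; apply: (szXM quad).
Qed.

(** Multiplication by all [den j ^+ r j] turns every monomial into a product of exactly [r j]
    factors of size [T j] for each [j]. *)
Lemma sz_eval (be num den : 'I_m -> K) (T : 'I_m -> nat) s Q :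
  (forall j, csz de t u (T j) (num j)) -> (forall j, csz de t u (T j) (den j)) ->
  (forall j, be j * den j = num j) -> intm Q -> degle r Q -> nrm Q <= 2 ^+ s ->
  sz de (2 ^ s * \prod_j T j ^ r j) ((tay f be Q)@_0 * \prod_j den j ^+ r j).
Proof.
move=> hn hd hb iQ dQ nQ.
pose z k := Num.floor Q@_k.
have zE k : Q@_k = (z k)%:~R by rewrite floorK.
have hs : (\sum_(k <- msupp Q) `|z k| <= 2 ^ s)%N.
  rewrite -(ler_nat rat) natr_sum natrX; apply: le_trans nQ.
  by apply: ler_sum => k _; rewrite zE -intr_norm -abszE pmulrn.
apply: (@szW _ _ (\sum_(k <- msupp Q) `|z k| * \prod_j T j ^ r j)%N).
  by rewrite -big_distrl /= leq_mul2r hs orbT.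
rewrite mcoeff0_tay mulr_suml; apply: sz_sum => k hk.
rewrite zE rmorph_int -mulrA -big_split /=; apply: szZ.
have -> : \prod_j (be j ^+ k j * den j ^+ r j) = \prod_j (num j ^+ k j * den j ^+ (r j - k j)).
  apply: eq_bigr => j _; rewrite -hb exprMn -mulrA -exprD subnKC //; exact: dQ.
by apply: sz_prod_pow => // j; apply: dQ.
Qed.

Lemma v_tay_le1 al Q mu : v al <= 1 -> intm Q -> v (tay f (fun=> al) Q)@_mu <= 1.
Proof.
move=> val1 iQ; rewrite -tay_hder0 mcoeff0_tay; apply: (v_sum_le vK) => // k _.
have iH := intm_hder mu iQ.
rewrite -(floorK (iH k)) rmorph_int; apply: (v_mul_le1 vK); first exact: (v_int vK).
rewrite (v_prod_big vK); apply: prodr_ile1 => i _; rewrite (vX vK) exprn_ge0 ?(v_ge0 vK) //=.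
by rewrite exprn_ile1 ?(v_ge0 vK).
Qed.

Lemma v_eval_le (al : K) (be : 'I_m -> K) (ex : 'I_m -> nat) (th : rat) (E : nat) Q :
  v al <= 1 -> (forall j, v (be j - al) <= p%:R^-1 ^+ ex j) -> intm Q ->
  indge f (fun=> al) r th Q -> (forall mu, th <= wt r mu -> (E <= \sum_j ex j * mu j)%N) ->
  v (tay f be Q)@_0 <= p%:R^-1 ^+ E.
Proof.
move=> val1 hbe iQ hQ hE.
have p0 : 0 <= p%:R^-1 :> rat by rewrite invr_ge0.
have p01 : p%:R^-1 <= 1 :> rat by rewrite invf_le1 ?ler1n ?ltr0n ltnW.
(* Taylor expansion around the diagonal point: terms of weight below [th] vanish, and the others are
   small by [hE]. *)
have -> : (tay f be Q)@_0 = (tay f (fun=> al) Q).@[fun i => be i - al].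
  rewrite mcoeff0_tay meval_tay; apply: eq_bigr => k _; congr (_ * _).
  by apply: eq_bigr => i _; rewrite subrK.
rewrite mevalE; apply: (v_sum_le vK) => [|mu _]; first by rewrite exprn_ge0.
have [h|h] := ltP (wt r mu) th; first by rewrite hQ // mul0r (v0 vK) exprn_ge0.
apply: (v_mul_le1 vK); first exact: v_tay_le1.
rewrite (v_prod_big vK); apply: (@le_trans _ _ (p%:R^-1 ^+ (\sum_j ex j * mu j)%N)).
  rewrite -prodrXr; apply: ler_prod => i _; rewrite (vX vK) exprn_ge0 ?(v_ge0 vK) //=.
  by rewrite exprM; apply: lerXn2r; rewrite ?nnegrE ?exprn_ge0 ?(v_ge0 vK).
exact: ler_wiXn2l (hE mu h).
Qed.

End Evaluation.

Section Heights.
Variables (K : fieldType) (de : K) (t u : int).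
Hypotheses (quad : de ^+ 2 = t%:~R * de + u%:~R).
Hypothesis irr : forall X Y : int, X%:~R + Y%:~R * de = 0 -> X = 0 /\ Y = 0.

Lemma norm_factor (a b : int) :
  (a%:~R + b%:~R * de) * (a%:~R + t%:~R * b%:~R - b%:~R * de) =
  (a ^+ 2 + t * (a * b) - u * b ^+ 2)%:~R.
Proof.
rewrite !(rmorphB, rmorphD, rmorphM, rmorphXn) /=.
transitivity (a%:~R ^+ 2 + t%:~R * (a%:~R * b%:~R) + t%:~R * de * b%:~R ^+ 2 - b%:~R ^+ 2 * de ^+ 2).
  by ring.
by rewrite quad; ring.
Qed.

(** From [be * den = X + Y de] and [den = Z + W de] follows [(X - Z be) + (Y - W be) de = 0]; [G] is
    the norm form of this relation with [be] replaced by the variable. *)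
Lemma quadratic_zpoly (be den : K) T : csz de t u T (be * den) -> csz de t u T den -> den != 0 ->
  exists G : {poly int}, [/\ G != 0, zev G be = 0 & (size G <= 3)%N].
Proof.
move=> [X [Y [eN _]]] [Z [W [eD _]]] nz.
pose A : {poly int} := X%:P - Z *: 'X; pose B : {poly int} := Y%:P - W *: 'X.
pose G := A ^+ 2 + t *: (A * B) - u *: B ^+ 2.
have sA : (size A <= 2)%N.
  rewrite (leq_trans (size_polyD _ _)) // size_polyN geq_max (leq_trans (size_polyC_leq1 _)) //=.
  by rewrite (leq_trans (size_scale_leq _ _)) // size_polyX.
have sB : (size B <= 2)%N.
  rewrite (leq_trans (size_polyD _ _)) // size_polyN geq_max (leq_trans (size_polyC_leq1 _)) //=.
  by rewrite (leq_trans (size_scale_leq _ _)) // size_polyX.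
have sM (P Q : {poly int}) : (size P <= 2)%N -> (size Q <= 2)%N -> (size (P * Q)%R <= 3)%N.
  by move=> hP hQ; apply: leq_trans (size_polyMleq _ _) _; lia.
have evA : zev A be = X%:~R - Z%:~R * be by rewrite /zev rmorphB /= map_polyC map_polyZ map_polyX !hornerE.
have evB : zev B be = Y%:~R - W%:~R * be by rewrite /zev rmorphB /= map_polyC map_polyZ map_polyX !hornerE.
have root0 : zev A be + zev B be * de = 0.
  rewrite evA evB; transitivity ((X%:~R + Y%:~R * de) - be * (Z%:~R + W%:~R * de)); first by ring.
  by rewrite -eN -eD subrr.
exists G; split.
(* If [G] were zero, both coordinates would vanish at every integer [x]; the cases 0 and 1 force
   [den = 0]. *)
- apply: contraNneq nz => G0.
  have key (x : int) : X - Z * x = 0 /\ Y - W * x = 0.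
    have hA : A.[x] = X - Z * x by rewrite /A !hornerE.
    have hB : B.[x] = Y - W * x by rewrite /B !hornerE.
    have h : A.[x] ^+ 2 + t * (A.[x] * B.[x]) - u * B.[x] ^+ 2 = 0.
      by rewrite -[RHS](horner0 x) -G0 /G !(hornerD, hornerN, hornerZ, hornerM, horner_exp).
    rewrite hA hB in h.
    have h2 : ((X - Z * x)%:~R + (Y - W * x)%:~R * de) *
        ((X - Z * x)%:~R + t%:~R * (Y - W * x)%:~R - (Y - W * x)%:~R * de) = 0 :> K.
      by rewrite norm_factor h.
    move/eqP: h2; rewrite mulf_eq0 => /orP[/eqP/irr //|/eqP h3].
    have := @irr (X - Z * x + t * (Y - W * x)) (- (Y - W * x)).
    rewrite rmorphD (rmorphM _ t) rmorphN /= mulNr h3 => /(_ erefl)[h4 h5].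
    have h6 : Y - W * x = 0 by rewrite -[LHS]opprK h5 oppr0.
    by split=> //; move: h4; rewrite h6 mulr0 addr0.
  have [hX hY] := key 0; have [hX1 hY1] := key 1.
  have Z0 : Z = 0 by lia.
  have W0 : W = 0 by lia.
  by rewrite eD Z0 W0 mul0r addr0.
- clearbody A B.
  have -> : G = A * A + t%:P * (A * B) + (- u)%:P * (B * B).
    by rewrite /G polyCN mulNr !mul_polyC !expr2.
  rewrite !(zevD, zevM, zevC).
  have -> : zev A be = - (zev B be * de) by apply/eqP; rewrite -addr_eq0 root0.
  transitivity (zev B be ^+ 2 * (de ^+ 2 - t%:~R * de - u%:~R)); first by rewrite rmorphN /=; ring.
  by rewrite quad; ring.
rewrite /G (leq_trans (size_polyD _ _)) // geq_max size_polyN; apply/andP; split.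
  rewrite (leq_trans (size_polyD _ _)) // geq_max expr2 sM //=.
  by apply: leq_trans (size_scale_leq _ _) _; exact: sM.
by apply: leq_trans (size_scale_leq _ _) _; rewrite expr2 sM.
Qed.

End Heights.

(** If the values at 0, 1 and -1 are all below [w], interpolation bounds the coefficients by [w],
    [w] and [2 w], hence the sum by [4 w]. *)
Lemma large_value (G : {poly int}) g : (size G <= 3)%N -> 2 ^+ g.+2 <= l1 G ->
  exists2 x : int, `|x| <= 1 & 2 ^+ g <= `|G.[x]|.
Proof.
move=> sG; have e1 : l1 G = `|G`_0| + `|G`_1| + `|G`_2|.
  have h : l1 G = \sum_(i < 3) `|G`_i|.
    rewrite /l1 (big_ord_widen _ (fun i => `|G`_i|) sG) big_mkcond; apply: eq_bigr => i _.
    by case: ltnP => // h; rewrite nth_default ?normr0.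
  by rewrite h !big_ord_recl big_ord0 /= addr0 addrA.
have ev (x : int) : G.[x] = G`_0 + G`_1 * x + G`_2 * x ^+ 2.
  rewrite (horner_coef_wide _ sG) !big_ord_recl big_ord0 /= expr0 mulr1 addr0 addrA.
  by rewrite expr1.
rewrite e1 !exprS; have := ev 0; have := ev 1; have := ev (-1); set w := 2 ^+ g.
rewrite !(mulr0, expr0n, mulr1, expr1n, sqrrN, mulrN1, addr0) /= => e2 e3 e4 h.
have [h0|h0] := leP w `|G.[0]|; first by exists 0.
have [h1|h1] := leP w `|G.[1]|; first by exists 1.
exists (-1) => //; move: h h0 h1; rewrite e2 e3 e4.
by move: (G`_0) (G`_1) (G`_2) w; lia.
Qed.

Lemma expn_bound_contra (d n g l e : nat) : (0 < d)%N -> (2 * d <= n)%N -> (e <= n)%N ->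
  (g * d <= n)%N -> (2 ^ (8 * n) <= l ^ d * (2 ^ e) ^ 2)%N -> (2 ^ g.+2 <= l)%N.
Proof.
move=> d0 dn en gd h; rewrite leqNgt; apply/negP => hl.
have h1 : (l ^ d <= 2 ^ (g.+2 * d))%N by rewrite expnM; apply: leq_exp2r_le; exact: ltnW.
have h2 : (2 ^ (8 * n) <= 2 ^ (g.+2 * d + e * 2))%N.
  by rewrite expnD expnM -expnM; apply: leq_trans h _; rewrite -expnM leq_mul2r h1 orbT.
by rewrite leq_exp2l // in h2; lia.
Qed.

Section Core.
Variables (p : nat) (K : fieldType) (v : K -> rat) (f : {rmorphism rat -> K}).
Hypotheses (vK : valued p v) (p1 : (1 < p)%N).
Variables (de : K) (t u : int).
Hypotheses (quad : de ^+ 2 = t%:~R * de + u%:~R) (vde : v de <= 1).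
Hypothesis irr : forall X Y : int, X%:~R + Y%:~R * de = 0 -> X = 0 /\ Y = 0.
Variable al : K.
Hypothesis val1 : v al <= 1.

(* The approximation [be = num / den] has size [T] slightly below [p ^ (2 n)], by the factor
   [p ^ (n / q)] that decides the final comparison, and error at most [p ^ (- 8 n)]. *)
Definition good (q n : nat) (be : K) := exists num den : K, exists T : nat,
  [/\ be * den = num, den != 0, csz de t u T num /\ csz de t u T den,
      (T ^ q <= p ^ ((2 * q).-1 * n))%N & v (be - al) <= p%:R^-1 ^+ (8 * n) /\ be != al].

Lemma p_inv_le1 : 0 <= (p%:R^-1 : rat) <= 1.
Proof. by rewrite invr_ge0 ler0n invf_le1 ?ler1n ?ltr0n ltnW. Qed.

Lemma good_v_le1 q n be : good q n be -> v be <= 1.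
Proof.
move=> [num [den [T [_ _ _ _ [h _]]]]]; have /andP[h0 h1] := p_inv_le1.
by rewrite -[be](subrK al); apply: (v_add_le vK) => //; apply: le_trans h _; rewrite exprn_ile1.
Qed.

Section Algebraic.
Variables (F : {poly int}) (e : nat).
Hypotheses (hF : min_zpoly F al) (hFe : l1 F <= 2 ^+ e) (primF : zprimitive F = F).
Let d := (size F).-1.

Lemma d_gt0 : (0 < d)%N.
Proof. by have := min_zpoly_size vK hF; rewrite /d; case: (size F) => [|[]]. Qed.

(** Other roots of [F] keep a distance from [al]: the difference quotient [W] vanishes at [be],
    equals [F'(al)] at [al], and does not expand distances. *)
Lemma v_deriv_le be : v be <= 1 -> be != al -> zev F be = 0 -> v (zev F^`() al) <= v (be - al).
Proof.
move=> vbe ne Fbe; have [F0 Fal _] := hF.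
pose W (x : K) := \sum_(i < size F) (F`_i)%:~R * \sum_(j < i) x ^+ (i.-1 - j) * al ^+ j.
have W0 : W be = 0.
  have : zev F be - zev F al = 0 by rewrite Fbe Fal subr0.
  rewrite !zevE -sumrB => h; have : (be - al) * W be = 0.
    rewrite -[RHS]h /W mulr_sumr; apply: eq_bigr => i _; by rewrite -mulrBr subrXX mulrCA.
  by move/eqP; rewrite mulf_eq0 subr_eq0 (negPf ne) => /eqP.
have W1 : W al = zev F^`() al.
  rewrite /zev -deriv_map -[map_poly intr F]coefK poly_def size_map_poly_id0; last first.
    by rewrite (v_intr_eq0 vK) lead_coef_eq0.
  rewrite raddf_sum horner_sum /W; apply: eq_bigr => i _ /=.
  rewrite derivZ derivXn hornerZ hornerMn hornerXn coef_map /=; congr (_ * _).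
  rewrite (eq_bigr (fun=> al ^+ i.-1)) => [|j _]; first by rewrite sumr_const card_ord.
  by rewrite -exprD subnK // -ltnS (leq_trans (ltn_ord j)) // leqSpred.
rewrite -W1 -[W al]subr0 -W0 /W -sumrB; apply: (v_sum_le vK) => [|i _]; first exact: (v_ge0 vK).
rewrite -mulrBr; apply: (v_mul_le1 vK); first exact: (v_int vK).
rewrite -sumrB; apply: (v_sum_le vK) => [|j _]; first exact: (v_ge0 vK).
rewrite -mulrBl mulrC; apply: (v_mul_le1 vK).
  by rewrite (vX vK) exprn_ile1 ?(v_ge0 vK).
by rewrite -(vN vK (be - al)) opprB; apply: (v_pow_sub_le vK).
Qed.

(** An element very close to [al] that is not a root of [F] has large height: Liouville's inequality
    for [F] at [be] bounds from below the coefficients of the minimal polynomial [G] of [be]. *)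
Lemma good_vanish_bound q n be : good q n be -> p%:R^-1 ^+ (8 * n) < v (zev F^`() al) ->
  (2 * d <= n)%N -> (e <= n)%N -> vanish_bound f be (n %/ d).
Proof.
move=> hg hn dn en; have vbe := good_v_le1 hg.
have [num [den [T [eN nz [cN cD] hT [vb ne]]]]] := hg.
rewrite -eN in cN.
have [G0 [G0z G0r sG0]] := quadratic_zpoly quad irr cN cD nz.
have [G [hG primG sG]] := min_zpoly_exists vK G0z G0r.
have Fbe : zev F be != 0.
  apply: contraTneq hn => h; rewrite -leNgt; apply: le_trans vb.
  exact: v_deriv_le.
have [F0 Fal _] := hF; have d0 := d_gt0.
have hL := min_zpoly_liouville vK hG vbe Fbe.
have vF : v (zev F be) <= p%:R^-1 ^+ (8 * n).
  rewrite -[zev F be]subr0 -Fal; exact: le_trans (v_zev_sub_le vK _ vbe val1) vb.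
have hl1 : l1 G = `|l1 G|%N :> int by rewrite gez0_abs ?l1_ge0.
have lG : (2 ^ (n %/ d).+2 <= `|l1 G|)%N.
  apply: (@expn_bound_contra d n _ _ e) => //; first by rewrite leq_trunc_div.
  have h2 : 1 <= p%:R^-1 ^+ (8 * n) * (l1 F ^+ (size G).-1 * l1 G ^+ d)%:~R :> rat.
    apply: le_trans hL _; rewrite mulrC [leRHS]mulrC; apply: ler_pM => //.
    + by rewrite ler0z mulr_ge0 ?exprn_ge0 ?l1_ge0.
    + exact: (v_ge0 vK).
    + by rewrite ler_int mulrC.
  move: h2; rewrite exprVn mulrC ler_pdivlMr ?exprn_gt0 ?ltr0n ?(ltn_trans _ p1) // mul1r => h2.
  have h3 : (p ^ (8 * n) <= `|l1 F| ^ (size G).-1 * `|l1 G| ^ d)%N.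
    rewrite -(ler_nat rat) natrX; apply: le_trans h2 _.
    rewrite [leRHS]pmulrn ler_int -[leRHS]natz natrM !natrX !natz.
    by rewrite !gez0_abs ?l1_ge0.
  rewrite [leqRHS]mulnC; apply: leq_trans (leq_exp2r_le _ p1) _; apply: leq_trans h3 _.
  rewrite leq_mul2r; apply/orP; right.
  apply: (@leq_trans ((2 ^ e) ^ (size G).-1)).
    apply: leq_exp2r_le; rewrite -lez_nat gez0_abs ?l1_ge0 //; apply: le_trans hFe _.
    by rewrite -natz natrX.
  rewrite leq_pexp2l ?expn_gt0 //; have := leq_trans sG sG0.
  by case: (size G) => [|[|[|[]]]].
have hlG : 2 ^+ (n %/ d).+2 <= l1 G.
  by rewrite hl1 (_ : 2 ^+ _ = (2 ^ (n %/ d).+2)%N%:Z) ?lez_nat // -natrX natz.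
have [x hx hxg] := large_value (leq_trans sG sG0) hlG.
exact: (min_zpoly_vanish_bound vK hG primG f hx hxg).
Qed.

End Algebraic.
End Core.

(** * The comparison of exponents *)

Lemma lacunary_sequence (A : nat -> Prop) (B N1 m : nat) :
  (forall N, exists2 n, (N <= n)%N & A n) ->
  exists nn : nat -> nat, forall j, (j < m)%N ->
    [/\ A (nn j), (N1 <= nn j)%N & forall i, (i < j)%N -> (B * nn i <= nn j)%N].
Proof.
move=> hA; elim: m => [|m [nn ih]]; first by exists (fun=> 0%N).
have [x hx Ax] := hA (N1 + \sum_(i < m) B * nn i)%N.
exists (fun j => if (j < m)%N then nn j else x) => j; rewrite ltnS => jm.
have [hj|hj] := ltnP j m.
  have [h1 h2 h3] := ih j hj; split=> // i ij.
  by rewrite (ltn_trans ij hj); exact: h3.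
split=> //; first exact: leq_trans (leq_addr _ _) hx.
move=> i ij; have im : (i < m)%N by exact: leq_trans ij jm.
rewrite im; apply: leq_trans hx; apply: leq_trans (leq_addl _ _).
by rewrite (bigD1 (Ordinal im)) //= leq_addr.
Qed.

Lemma prod_expn m (F : 'I_m -> nat) q : ((\prod_j F j) ^ q = \prod_j F j ^ q)%N.
Proof. by rewrite (big_morph (fun x => x ^ q)%N (fun x y => expnMn x y q) (exp1n q)). Qed.

Lemma exponent_bound (p q m E s e c R : nat) (n r T : 'I_m -> nat) :
  (1 < p)%N -> (c <= 2 ^ e)%N -> (forall j, (T j ^ q <= p ^ ((2 * q).-1 * n j))%N) ->
  (forall j, (n j * r j = R)%N) -> (p ^ E <= c * (2 ^ s * \prod_j T j ^ r j) ^ 2)%N ->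
  (E * q <= e * q + 2 * (s * q + (2 * q).-1 * R * m))%N.
Proof.
move=> p1 hc hT hR h; rewrite -(leq_exp2l _ _ p1).
have hX : ((\prod_j T j ^ r j) ^ q <= p ^ ((2 * q).-1 * R * m))%N.
  rewrite expnM -[X in (_ <= _ ^ X)%N]card_ord -prod_nat_const prod_expn; apply: leq_prod => j _.
  rewrite expnAC -(hR j) mulnA [leqRHS]expnM; exact: (leq_exp2r_le _ (hT j)).
have h2 x : (2 ^ x <= p ^ x)%N by exact: (@leq_exp2r_le 2 p x p1).
rewrite expnM; apply: leq_trans (leq_exp2r_le q h) _.
rewrite expnMn expnD; apply: leq_mul.
  by apply: leq_trans (leq_exp2r_le q hc) _; rewrite -expnM.
rewrite expnAC [X in (_ <= _ ^ X)%N]mulnC [leqRHS]expnM; apply: leq_exp2r_le; rewrite expnMn expnD; apply: leq_mul => //.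
by rewrite -expnM.
Qed.

(** The main terms [64 q^2 A m] cancel. The saving in [T] leaves [32 q A m], the loss of index takes
    at most half of it, and the size of [N1] makes [s + e] too small to absorb the rest. *)
Lemma exponent_contra (q m A s e N1 C : nat) :
  (0 < q)%N -> (0 < m)%N -> (0 < A)%N -> (0 < C)%N ->
  (8 * A * (8 * q * m - (m + 1)) * q <=
     e * q + 2 * (s * q + (2 * q).-1 * (16 * q * A) * m))%N ->
  ((s + e) * N1 <= C * m * (16 * q * A))%N -> (8 * q * C <= N1)%N -> False.
Proof.
move=> q0 m0 A0 C0 h1 h2 h3.
have h4 : (8 * A * (8 * q * m - (m + 1)) <= e + 2 * s + 2 * ((2 * q).-1 * (16 * A) * m))%N.
  rewrite -(leq_pmul2r q0); apply: leq_trans h1 _.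
  by move: (2 * q).-1 => w; lia.
have h5 : (8 * A * (8 * q * m - (m + 1)) + 8 * A * (m + 1) = 8 * A * (8 * q * m))%N.
  rewrite -mulnDr subnK //; have := leq_mul q0 (leqnn m); lia.
have h6 : ((2 * q).-1 * (16 * A) * m + 16 * A * m = 2 * q * (16 * A) * m)%N.
  have e1 : ((2 * q).-1 + 1 = 2 * q)%N by rewrite addn1 prednK // muln_gt0.
  by rewrite -e1; move: (2 * q).-1 => w; lia.
have h7 : (32 * A * m <= 8 * A * (m + 1) + e + 2 * s)%N by lia.
have h8 : (16 * A * m <= 2 * (s + e))%N by have := leq_mul (leqnn A) m0; lia.
have h9 : (16 * A * m * N1 <= 32 * C * m * q * A)%N.
  apply: (@leq_trans (2 * (s + e) * N1)); first by rewrite leq_mul2r h8 orbT.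
  by lia.
have h10 : (16 * A * m * (8 * q * C) <= 32 * C * m * q * A)%N.
  by apply: leq_trans h9; rewrite leq_mul2l h3 orbT.
have : (0 < C * m * q * A)%N by rewrite !muln_gt0 C0 m0 q0 A0.
lia.
Qed.

Lemma height_cond (s N1 R Cm B g r n d : nat) :
  (0 < Cm)%N -> (0 < d)%N -> (s * N1 <= Cm * R)%N -> (2 * d * Cm * B <= N1)%N ->
  (n * r = R)%N -> (n <= 2 * d * g)%N -> (s * B <= g * r)%N.
Proof.
move=> C0 d0 h1 h2 h3 h4.
have : (s * (2 * d * Cm * B) <= Cm * (2 * d * g * r))%N.
  apply: leq_trans (leq_mul (leqnn s) h2) _; apply: leq_trans h1 _; rewrite leq_mul2l -h3.
  by rewrite leq_mul2r h4 !orbT.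
rewrite (_ : s * (2 * d * Cm * B) = (2 * d * Cm) * (s * B))%N; last by lia.
rewrite (_ : Cm * (2 * d * g * r) = (2 * d * Cm) * (g * r))%N; last by lia.
by rewrite leq_pmul2l // !muln_gt0 d0.
Qed.

Lemma archimedean_bound (F : archiRealFieldType) (om : F) : 0 < om ->
  exists2 B : nat, (0 < B)%N & 1 <= om * B%:R.
Proof.
move=> o0; exists (Num.trunc om^-1).+1 => //.
rewrite -(ler_pM2l (_ : 0 < om^-1)) ?invr_gt0 // mulr1 mulKf ?lt0r_neq0 //.
by apply/ltW/truncnS_gt.
Qed.

Lemma small_power (p : nat) (w : rat) : (1 < p)%N -> 0 < w ->
  exists n1, forall n, (n1 <= n)%N -> p%:R^-1 ^+ (8 * n) < w.
Proof.
move=> p1 w0; have [B B0 hB] := archimedean_bound w0; exists B => n hn.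
have p0 : 0 < p%:R :> rat by rewrite ltr0n ltnW.
rewrite exprVn; apply: (@lt_le_trans _ _ (B%:R^-1)); last first.
  by rewrite -(ler_pM2r (_ : 0 < B%:R)) ?ltr0n // mulVf // pnatr_eq0 -lt0n.
have hB2 : (B < p ^ (8 * n))%N.
  apply: leq_ltn_trans hn _; apply: leq_trans (ltn_expl n p1) _.
  by rewrite leq_exp2l // leq_pmull.
have h3 : B%:R < p%:R ^+ (8 * n) :> rat by rewrite -natrX ltr_nat.
have B0' : 0 < B%:R :> rat by rewrite ltr0n.
by rewrite ltf_pV2 // posrE exprn_gt0.
Qed.

(** The deviation from [m / 2] and Roth's parameter are both [1 / (16 q)]; [16 q] times the
    remaining index is then the integer [8 q m - (m + 1)]. *)
Lemma index_level (F : realFieldType) (q m A : nat) (w mu0 : F) : (0 < q)%N -> (0 < m)%N ->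
  mu0 <= (16 * q)%:R^-1 -> m%:R * (2^-1 - (16 * q)%:R^-1) - mu0 <= w ->
  (8 * A * (8 * q * m - (m + 1)))%:R <= (8 * (16 * q * A))%:R * w.
Proof.
move=> q0 m0 h1 h2.
have q0' : 0 < q%:R :> F by rewrite ltr0n.
have e1 : (8 * q * m - (m + 1))%:R = 8 * q%:R * m%:R - (m%:R + 1) :> F.
  rewrite natrB ?natrD ?natrM //; have := leq_mul q0 (leqnn m); lia.
have e2 : (16 * q)%:R^-1 * (16 * q%:R) = 1 :> F by rewrite natrM mulVf // mulf_neq0 // lt0r_neq0.
set h := (16 * q)%:R^-1 in h1 h2 e2.
rewrite natrM e1 !natrM.
have h3 : 8 * q%:R * m%:R - (m%:R + 1) <= 16 * q%:R * w.
  have h4 : m%:R * (2^-1 - h) - h <= w by lra.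
  have h5 : 16 * q%:R * (m%:R * (2^-1 - h) - h) <= 16 * q%:R * w.
    by rewrite ler_pM2l // mulr_gt0.
  apply: le_trans h5; rewrite le_eqVlt; apply/orP; left; apply/eqP.
  transitivity (8 * q%:R * m%:R - (m%:R + 1) * (h * (16 * q%:R))); last by field.
  by rewrite e2 mulr1.
rewrite [leRHS](_ : _ = 8 * A%:R * (16 * q%:R * w)); last by ring.
by rewrite ler_wpM2l // mulr_ge0.
Qed.

Lemma quotient_bound n d : (0 < d)%N -> (2 * d <= n)%N -> (n <= 2 * d * (n %/ d))%N.
Proof.
move=> d0 h; have h1 : (1 <= n %/ d)%N by rewrite divn_gt0 //; lia.
have := ltn_ceil n d0; have := leq_mul h1 (leqnn d); lia.
Qed.

(** The factor [64 q ^ 2] is the inverse of [4 / (16 q) ^ 2]. *)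
Lemma many_variables (F : realFieldType) (D q : nat) : (0 < q)%N ->
  D%:R < 4 * ((16 * q)%:R^-1) ^+ 2 * (D * (64 * q ^ 2)).+1%:R :> F.
Proof.
move=> q0; have q0' : 0 < q%:R :> F by rewrite ltr0n.
have e : 4 * ((16 * q)%:R^-1) ^+ 2 * (64 * q%:R ^+ 2) = 1 :> F.
  by rewrite natrM; field; rewrite lt0r_neq0.
rewrite -[X in _ < _ * X]natr1 (natrM F D) (natrM F 64) natrX mulrDr mulr1 [D%:R * _]mulrC mulrA e mul1r ltrDl.
by rewrite mulr_gt0 // exprn_gt0 // invr_gt0 ltr0n muln_gt0.
Qed.

Lemma inv16_bounds (F : realFieldType) (q : nat) : (0 < q)%N -> 0 < ((16 * q)%:R^-1 : F) <= 1.
Proof.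
by move=> q0; rewrite invr_gt0 ltr0n muln_gt0 q0 invf_le1 ?ltr0n ?ler1n muln_gt0 q0.
Qed.

Lemma ratio_cond (F : realFieldType) (a b B : nat) (om : F) :
  0 < om -> 1 <= om * B%:R -> (a * B <= b)%N -> a%:R <= om * b%:R.
Proof.
move=> o0 h1 h2; have h3 : a%:R * B%:R <= b%:R :> F by rewrite -natrM ler_nat.
apply: (@le_trans _ _ (om * (a%:R * B%:R))); last by rewrite ler_pM2l.
by rewrite mulrCA ler_peMr.
Qed.

Lemma level_term (F : realFieldType) (n r x : nat) :
  (0 < r)%N -> (8 * (n * r))%:R * (x%:R / r%:R) = (8 * n * x)%:R :> F.
Proof.
move=> r0; have r0' : r%:R != 0 :> F by rewrite pnatr_eq0 -lt0n.
by rewrite !natrM; field.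
Qed.

Lemma pow_bound (p E c : nat) (w : rat) : (1 < p)%N -> 1 <= w * c%:R -> w <= p%:R^-1 ^+ E ->
  (p ^ E <= c)%N.
Proof.
move=> p1 h1 h2; have p0 : 0 < p%:R ^+ E :> rat by rewrite exprn_gt0 // ltr0n ltnW.
rewrite -(ler_nat rat) natrX -[leLHS]mulr1 -ler_pdivlMl // -exprVn.
by apply: le_trans h1 _; rewrite ler_wpM2r.
Qed.

Section CoreTheorem.
Variables (p : nat) (K : fieldType) (v : K -> rat) (f : {rmorphism rat -> K}).
Hypotheses (vK : valued p v) (p1 : (1 < p)%N).
Variables (de : K) (t u : int).
Hypotheses (quad : de ^+ 2 = t%:~R * de + u%:~R) (vde : v de <= 1).
Hypothesis irr : forall X Y : int, X%:~R + Y%:~R * de = 0 -> X = 0 /\ Y = 0.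
Variable al : K.
Hypothesis val1 : v al <= 1.

Lemma csz_v_le1 T x : csz de t u T x -> v x <= 1.
Proof.
move=> [X [Y [-> _]]]; apply: (v_add_le vK); first exact: (v_int vK).
by apply: (v_mul_le1 vK) => //; exact: (v_int vK).
Qed.

Lemma good_many_false (F : {poly int}) (e q m A B : nat) (om : rat) (n g : 'I_m -> nat)
    (be : 'I_m -> K) :
  let d := (size F).-1 in
  let cc := (1 + `|t| + `|u|)%N in
  let C := (e + 2 * d + 3 + cc)%N in
  let R := (16 * q * A)%N in
  let N1 := (8 * q * C + 2 * d * (C * m) * B)%N in
  min_zpoly F al -> l1 F <= 2 ^+ e -> (0 < q)%N -> (0 < m)%N -> (0 < A)%N ->
  (d.+1 * p)%:R < 4 * ((16 * q)%:R^-1) ^+ 2 * m%:R :> rat ->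
  @roth_concl m K f m ((16 * q)%:R^-1) om -> 0 < om -> 1 <= om * B%:R ->
  (forall j, good p v de t u al q (n j) (be j)) -> (forall j, vanish_bound f (be j) (g j)) ->
  (forall j, n j %| A)%N -> (forall j, (N1 <= n j)%N) -> (forall j, (n j <= 2 * d * g j)%N) ->
  (forall i j : 'I_m, (i < j)%N -> (B * n i <= n j)%N) -> False.
Proof.
move=> d cc C R N1 hF hFe q0 m0 A0 hm RL om0 omB hgood hvan ndvd hN1 ng hB.
have C0 : (0 < C)%N by rewrite /C addn_gt0 addn_gt0 orbT.
have n0 j : (0 < n j)%N.
  by apply: leq_trans (hN1 j); rewrite /N1 addn_gt0 !muln_gt0 q0 C0.
(* Degrees inversely proportional to [n j]: all approximations contribute the same [R], and rapidly
   growing [n j] give rapidly falling degrees. *)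
pose r j := (16 * q * (A %/ n j))%N.
have nr j : (n j * r j = R)%N by rewrite /r mulnCA [(n j * _)%N]mulnC divnK.
have r0 j : (0 < r j)%N.
  have : (0 < n j * r j)%N by rewrite nr /R !muln_gt0 q0 A0.
  by rewrite muln_gt0 => /andP[].
have [P [P0 iP dP nP hP]] := auxiliary_polynomial f vK p1 val1 hF hFe r0
  (proj1 (andP (inv16_bounds rat q0))) m0 hm.
set S := (\sum_i r i)%N in nP.
set s0 := (S + _)%N in nP.
pose s := (S + s0)%N.
have S0 : (0 < S)%N.
  by rewrite /S (bigD1 (Ordinal m0)) //= addn_gt0 r0.
have hsC : (s + cc <= C * S)%N.
  rewrite /s /s0 /C -/d; move: (leq_mul (leqnn cc) S0); lia.
have hSR : (S * N1 <= m * R)%N.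
  rewrite /S big_distrl /=; apply: (@leq_trans (\sum_(i < m) R)).
    by apply: leq_sum => j _; rewrite -(nr j) mulnC leq_mul2r hN1 orbT.
  by rewrite sum_nat_const card_ord.
have hsR : ((s + cc) * N1 <= C * m * R)%N.
  apply: leq_trans (leq_mul hsC (leqnn N1)) _.
  by rewrite -!mulnA leq_mul2l hSR orbT.
have d0 : (0 < d)%N by exact: (d_gt0 vK hF).
have s0B j : (s0 * B <= g j * r j)%N.
  apply: (@height_cond s0 N1 R (C * m) B _ _ (n j) d) => //; first by rewrite muln_gt0 C0.
  - apply: leq_trans hsR; rewrite leq_mul2r; apply/orP; right.
    by rewrite /s addnAC leq_addl.
  - by rewrite /N1 leq_addl.
have hyp : roth_hyp f m om be r g s0.
  split=> // [|i j ij _|j _].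
  - exact: leq_addr.
  - have hji : (r j * B <= r i)%N.
      rewrite -(leq_pmul2l (n0 i)) nr -(nr j).
      have -> : (n i * (r j * B) = B * n i * r j)%N by ring.
      by rewrite leq_mul2r (hB i j ij) orbT.
    exact: ratio_cond om0 omB hji.
  - exact: ratio_cond om0 omB (s0B j).
have oP : onlyv [pred i : 'I_m | (i < m)%N] P by move=> mu _ i /=; rewrite ltn_ord.
have [mu hmu wmu] := RL be r g s0 P hyp P0 iP oP dP nP.
pose Q := hder mu P.
have iQ : intm Q := intm_hder mu iP.
have dQ : degle r Q by apply: degle_hder.
have nQ : nrm Q <= 2 ^+ s.
  apply: le_trans (nrm_hder mu dP) _; rewrite /s exprD; apply: ler_wpM2l nP.
  by rewrite exprn_ge0.
have hQ := indge_hder (mu := mu) hP; rewrite -/Q in hQ.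
have [x hx] := fin_all_exists hgood.
have [y hy] := fin_all_exists hx.
have [T hT] := fin_all_exists hy.
pose E := (8 * A * (8 * q * m - (m + 1)))%N.
have vbe j : v (be j) <= 1 by exact: (good_v_le1 vK p1 val1 (hgood j)).
have hE nu : m%:R * (2^-1 - (16 * q)%:R^-1) - wt r mu <= wt r nu -> (E <= \sum_j 8 * n j * nu j)%N.
  move=> h; rewrite -(ler_nat rat).
  apply: le_trans (index_level A q0 m0 wmu h) _.
  rewrite natr_sum /wt mulr_sumr; apply: ler_sum => j _.
  by rewrite -/R -(nr j) level_term.
have hex j : v (be j - al) <= p%:R^-1 ^+ (8 * n j) by case: (hT j) => _ _ _ _ [].
have vQ := v_eval_le vK p1 val1 hex iQ hQ hE.
have Qnz : (tay f be Q)@_0 != 0 by rewrite tay_hder0.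
have den0 : \prod_j y j ^+ r j != 0.
  by apply/prodf_neq0 => j _; rewrite expf_neq0 //; case: (hT j).
have hcx j : csz de t u (T j) (x j) by case: (hT j) => _ _ [].
have hcy j : csz de t u (T j) (y j) by case: (hT j) => _ _ [].
have hxy j : be j * y j = x j by case: (hT j).
have hsz := sz_eval f quad hcx hcy hxy iQ dQ nQ.
have hn := sz_norm vK quad vde irr hsz (mulf_neq0 Qnz den0).
have vden : v (\prod_j y j ^+ r j) <= 1.
  rewrite (v_prod_big vK); apply: prodr_ile1 => j _; rewrite (vX vK) exprn_ge0 ?(v_ge0 vK) //=.
  rewrite exprn_ile1 ?(v_ge0 vK) //; exact: csz_v_le1 (hcy j).
have hpE : (p ^ E <= cc * (2 ^ s * \prod_j T j ^ r j) ^ 2)%N.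
  apply: (pow_bound p1 hn); rewrite mulrC; exact: (v_mul_le1 vK).
apply: (exponent_contra q0 m0 A0 C0 (N1 := N1) (s := s) (e := cc)).
- apply: (exponent_bound p1 _ _ nr hpE); first by exact/ltnW/ltn_expl.
  by move=> j; case: (hT j).
- exact: hsR.
- by rewrite /N1 leq_addr.
Qed.

End CoreTheorem.

Theorem good_infinitely_often_false (p : nat) (K : fieldType) (v : K -> rat)
  (f : {rmorphism rat -> K}) (de al : K) (t u : int) (q : nat) (F0 : {poly int}) :
  valued p v -> (1 < p)%N -> de ^+ 2 = t%:~R * de + u%:~R -> v de <= 1 ->
  (forall X Y : int, X%:~R + Y%:~R * de = 0 -> X = 0 /\ Y = 0) ->
  v al <= 1 -> F0 != 0 -> zev F0 al = 0 -> (0 < q)%N ->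
  (forall N, exists2 n, (N <= n)%N & exists be, good p v de t u al q n be) -> False.
Proof.
move=> vK p1 quad vde irr val1 F00 F0al q0 hgood.
have [F [hF primF _]] := min_zpoly_exists vK F00 F0al.
pose d := (size F).-1; pose e := `|l1 F|%N.
have hFe : l1 F <= 2 ^+ e.
  rewrite -[l1 F]gez0_abs ?l1_ge0 // -/e -[leRHS]/((2%:R : int) ^+ e) -natrX natz lez_nat.
  exact/ltnW/ltn_expl.
pose m := (d.+1 * p * (64 * q ^ 2)).+1.
have hm := many_variables rat (d.+1 * p) q0; rewrite -/m in hm.
have [om /andP[om0 _] RL] := @roth_lemma m K f m (leqnn m) _ (inv16_bounds rat q0).
have [B B0 omB] := archimedean_bound om0.
(* Beyond [n1] an approximation is closer to [al] than any other root of [F] in the unit ball, so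
   [F] does not vanish at it. *)
have [n1 hn1] := small_power p1 (v_gt0 vK (zev_deriv_neq0 vK hF)).
pose C := (e + 2 * d + 3 + (1 + `|t| + `|u|))%N.
pose N0 := (8 * q * C + 2 * d * (C * m) * B)%N.
have [nn hnn] := lacunary_sequence B (N0 + (2 * d + (e + n1))) m hgood.
have hb (j : 'I_m) : exists be, good p v de t u al q (nn j) be by case: (hnn j (ltn_ord j)).
have [be hbe] := fin_all_exists hb.
have hN (j : 'I_m) : (N0 + (2 * d + (e + n1)) <= nn j)%N by case: (hnn j (ltn_ord j)).
have hd (j : 'I_m) : (2 * d <= nn j)%N by have := hN j; lia.
have he (j : 'I_m) : (e <= nn j)%N by have := hN j; lia.
have h1 (j : 'I_m) : (n1 <= nn j)%N by have := hN j; lia.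
have h0 (j : 'I_m) : (N0 <= nn j)%N by have := hN j; lia.
have d0 : (0 < d)%N by exact: (d_gt0 vK hF).
have n0 (j : 'I_m) : (0 < nn j)%N by have := hd j; lia.
apply: (@good_many_false p K v f vK p1 de t u quad vde irr al val1 F e q m (\prod_(j < m) nn j)%N B om
  (fun j => nn j) (fun j => nn j %/ d)%N be hF hFe q0 _ _ hm RL om0 omB hbe) => //.
- by apply: prodn_gt0 => j; apply: n0.
- move=> j; exact: (good_vanish_bound f vK p1 quad irr val1 hF hFe (hbe j) (hn1 _ (h1 j)) (hd j) (he j)).
- by move=> j; rewrite (bigD1 j) //= dvdn_mulr.
- by move=> j; apply: quotient_bound.
- by move=> i j ij; have [_ _] := hnn j (ltn_ord j); apply.
Qed.

(** * Models of the p-adic numbers *)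

Section RationalEmbedding.
Variable K : fieldType.
Hypothesis char0 : forall z : int, z != 0 -> z%:~R != 0 :> K.

Lemma ratr_frac (a b : int) : b != 0 -> ratr (a%:~R / b%:~R) = a%:~R / b%:~R :> K.
Proof.
move=> b0; set x := _ / _ : rat.
have e : numq x * b = a * denq x.
  apply: (@intr_inj rat); rewrite !rmorphM /= numqE /x.
  have : b%:~R != 0 :> rat by rewrite intr_eq0.
  by move: (denq _) => dd h; field.
apply/eqP; rewrite /ratr eqr_div ?char0 ?denq_neq0 // -!rmorphM /= e.
by [].
Qed.

Lemma ratr_num_den (x : rat) : exists a b : int, b != 0 /\ x = a%:~R / b%:~R.
Proof. by exists (numq x), (denq x); rewrite denq_neq0 divq_num_den. Qed.

Lemma ratr_rmorphism : exists f : {rmorphism rat -> K}, f =1 ratr.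
Proof.
have hz : zmod_morphism (@ratr K).
  move=> x y; have [a [b [b0 ->]]] := ratr_num_den x; have [c [d [d0 ->]]] := ratr_num_den y.
  have e : a%:~R / b%:~R - c%:~R / d%:~R = (a * d - c * b)%:~R / (b * d)%:~R :> rat.
    rewrite rmorphB !rmorphM /=; field.
    by rewrite !intr_eq0 b0 d0.
  rewrite e !ratr_frac ?mulf_neq0 // rmorphB !rmorphM /=; field.
  by rewrite !char0.
have hm : monoid_morphism (@ratr K).
  split=> [|x y]; first by rewrite -[1]/(1%:~R) ratr_int.
  have [a [b [b0 ->]]] := ratr_num_den x; have [c [d [d0 ->]]] := ratr_num_den y.
  have e : a%:~R / b%:~R * (c%:~R / d%:~R) = (a * c)%:~R / (b * d)%:~R :> rat.
    by rewrite !rmorphM /=; field; rewrite !intr_eq0 b0 d0.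
  by rewrite e !ratr_frac ?mulf_neq0 // !rmorphM /=; field; rewrite !char0.
pose aM := GRing.isZmodMorphism.Build rat K (@ratr K) hz.
pose mM := GRing.isMonoidMorphism.Build rat K (@ratr K) hm.
pose phi : {rmorphism rat -> K} := HB.pack (@ratr K) aM mM.
by exists phi.
Qed.

End RationalEmbedding.

Lemma padic_abs_int (p : nat) (z : int) : z != 0 -> padic_abs p z%:~R = p%:R^-1 ^+ logn p `|z|.
Proof.
move=> z0; rewrite /padic_abs intr_eq0 (negPf z0) numq_int denq_int logn1 expr0 mul1r.
by rewrite exprVn.
Qed.

Section Model.
Variables (p : nat) (K : fieldType) (v : K -> rat).
Hypotheses (pr : prime p) (model : Qp_model p v).

Lemma model_v_int (z : int) : z != 0 -> v z%:~R = p%:R^-1 ^+ logn p `|z|.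
Proof. by move=> z0; have [_ _ _ _ [h _ _]] := model; rewrite -ratr_int h padic_abs_int. Qed.

Lemma model_v0 : v 0 = 0.
Proof.
have [_ _ _ _ [h _ _]] := model.
by have := h 0; rewrite -[0 : rat]/(0%:~R) ratr_int /padic_abs eqxx.
Qed.

Lemma p_gt0 : 0 < p%:R :> rat.
Proof. by rewrite ltr0n prime_gt0. Qed.

Lemma p_gt1 : 1 < p%:R :> rat.
Proof. by rewrite ltr1n prime_gt1. Qed.

Lemma model_char0 (z : int) : z != 0 -> z%:~R != 0 :> K.
Proof.
move=> z0; apply/eqP => h; have := model_v_int z0; rewrite h model_v0 => /esym/eqP.
by rewrite expf_eq0 invr_eq0 (gt_eqF p_gt0) andbF.
Qed.

Lemma model_dvd (z : int) k : v z%:~R <= p%:R^-1 ^+ k -> (p ^ k %| `|z|)%N.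
Proof.
have [->|z0] := eqVneq z 0; first by rewrite dvdn0.
rewrite model_v_int // pfactor_dvdn ?absz_gt0 // leqNgt => h; apply/negP => h2.
have : (p%:R^-1 : rat) ^+ k < p%:R^-1 ^+ logn p `|z|.
  by rewrite !exprVn ltf_pV2 ?posrE ?exprn_gt0 ?p_gt0 // ltr_eXn2l ?p_gt1.
by rewrite ltNge h.
Qed.

Lemma model_dvd_le (z : int) k : (p ^ k %| `|z|)%N -> v z%:~R <= p%:R^-1 ^+ k.
Proof.
have [->|z0] := eqVneq z 0; first by rewrite model_v0 exprn_ge0 // invr_ge0 ltW // p_gt0.
rewrite pfactor_dvdn ?absz_gt0 // => h; rewrite model_v_int //.
by apply: ler_wiXn2l h; rewrite ?invr_ge0 ?(ltW p_gt0) // invf_le1 ?p_gt0 // ltW // p_gt1.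
Qed.

Lemma model_dense (x : K) : v x <= 1 -> forall N, exists a : int, v (x - a%:~R) <= p%:R^-1 ^+ N.
Proof.
have [g0 _ hM hD [hq hd _]] := model.
move=> vx N.
have pN : 0 < (p%:R^-1 : rat) ^+ N by rewrite exprn_gt0 // invr_gt0 p_gt0.
have pN1 : (p%:R^-1 : rat) ^+ N <= 1.
  by rewrite exprn_ile1 ?invr_ge0 ?(ltW p_gt0) // invf_le1 ?p_gt0 // ltW // p_gt1.
have [y hy] := hd x _ pN.
have vm1 : v (-1) = 1.
  have := @model_v_int (-1) isT; rewrite rmorphN /= => ->; by rewrite logn1 expr0.
have vy : v (ratr y) <= 1.
  have -> : ratr y = x + -1 * (x - ratr y) by ring.
  apply: le_trans (hD _ _) _; rewrite ge_max vx hM vm1 mul1r.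
  exact: le_trans (ltW hy) pN1.
have dz : (denq y)%:~R != 0 :> K by rewrite model_char0 ?denq_neq0.
have cop : coprime p `|denq y|.
  rewrite prime_coprime //; apply/negP => hdv.
  have hn : ~~ (p %| `|numq y|)%N.
    rewrite -prime_coprime // coprime_sym; apply: coprime_dvdr hdv _.
    exact: coprime_num_den.
  have n0 : numq y != 0 by apply: contraNneq hn => ->.
  have : 1 < padic_abs p y.
    rewrite /padic_abs -numq_eq0 (negPf n0) (@lognE p `|numq y|) (negPf hn) !andbF expr0 divr1.
    by rewrite exprn_egt1 ?p_gt1 // -lt0n logn_gt0 mem_primes pr absz_gt0 denq_neq0.
  by rewrite -hq ltNge vy.
(* The denominator of [y] is invertible modulo [p ^ N]; its inverse [s] gives the integer
   [s * numq y]. *)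
have copN : coprimez (denq y) (p ^ N)%:Z.
  by rewrite coprimezE /= coprime_sym coprimeXl.
have [[s r] /= hsr] := coprimezP _ _ copN.
exists (s * numq y).
have h1 : v (ratr y - (s * numq y)%:~R) <= p%:R^-1 ^+ N.
  have -> : ratr y - (s * numq y)%:~R = (r * (p ^ N)%:Z * numq y)%:~R / (denq y)%:~R :> K.
    have -> : r * (p ^ N)%:Z = 1 - s * denq y by rewrite -hsr addrAC subrr add0r.
    rewrite /ratr !(rmorphM, rmorphB) /=; field; exact: dz.
  have vd : v (denq y)%:~R = 1.
    rewrite model_v_int ?denq_neq0 // logn_coprime ?expr0 //.
  have vdi : v ((denq y)%:~R)^-1 = 1.
    have := hM (denq y)%:~R (denq y)%:~R^-1; rewrite mulfV // vd mul1r => <-.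
    by have := @model_v_int 1 isT; rewrite logn1.
  rewrite hM vdi mulr1; apply: model_dvd_le.
  by rewrite !abszM /= mulnAC dvdn_mull.
rewrite -[x](subrK (ratr y)) -addrA; apply: le_trans (hD _ _) _.
by rewrite ge_max h1 (ltW hy).
Qed.

Lemma model_valued : valued p v.
Proof.
have [g0 z0 hM hD _] := model; split=> //.
- exact: model_v0.
- move=> z; have [->|nz] := eqVneq z 0; first by rewrite model_v0.
  by rewrite model_v_int // exprn_ile1 ?invr_ge0 ?(ltW p_gt0) // invf_le1 ?p_gt0 // ltW // p_gt1.
- move=> z nz; rewrite model_v_int // exprVn ler_pdivlMr ?exprn_gt0 ?p_gt0 // mul1r.
  rewrite -abszE -pmulrn -natrX ler_nat dvdn_leq ?absz_gt0 //.
  exact: pfactor_dvdnn.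
- have := @model_v_int p%:Z; rewrite -pmulrn /= => ->; last by rewrite eqz_nat -lt0n prime_gt0.
  by rewrite logn_prime // eqxx expr1.
- exact: model_dense.
Qed.

End Model.

(** * Continued fractions with partial quotients of absolute value p *)

Section ContinuedFractions.
Variables (p : nat) (K : fieldType) (v : K -> rat).
Hypotheses (pr : prime p) (p3 : (2 < p)%N) (model : Qp_model p v).
Let vK := model_valued pr model.
Let pK : K := p%:R.

Lemma pK_neq0 : pK != 0.
Proof. by rewrite /pK pmulrn (model_char0 pr model) // eqz_nat -lt0n prime_gt0. Qed.

Lemma v_pK : v pK = p%:R^-1.
Proof. exact: (v_p vK). Qed.

Lemma v_p_neq0 y : v y = p%:R -> y != 0.
Proof.
by move=> h; apply/eqP => y0; move: (p_gt0 pr); rewrite -h y0 (v0 vK) ltxx.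
Qed.

(* The numerators [c] of Browkin partial quotients [c / p] of absolute value [p]. *)
Definition letter (c : int) : bool := ~~ (p %| `|c|)%N && (2 * `|c| < p ^ 2)%N.

Lemma v_letter c : letter c -> v c%:~R = 1.
Proof.
case/andP=> hc _; have c0 : c != 0 by apply: contraNneq hc => ->.
by rewrite (model_v_int model) // lognE (negPf hc) !andbF.
Qed.

Lemma letter_inj c c' : letter c -> letter c' -> v (c - c')%:~R <= p%:R^-1 ^+ 2 -> c = c'.
Proof.
move=> /andP[_ h] /andP[_ h'] hv.
have hd := model_dvd pr model hv; apply/eqP; rewrite -subr_eq0 -absz_eq0.
apply: contraTT hd => hne; rewrite gtnNdvd ?lt0n //.
move: (p ^ 2)%N h h' => P; lia.
Qed.

Definition step (c : int) (x : K) : K := c%:~R / pK + x^-1.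
Definition cfev (s : seq int) (x : K) : K := foldr step x s.

Lemma v_step c x : letter c -> v x = p%:R -> v (step c x) = p%:R.
Proof.
move=> hc vx; have vc : v (c%:~R / pK) = p%:R.
  by rewrite (vM vK) (vV vK) v_pK (v_letter hc) mul1r invrK.
rewrite -vc; apply: (v_eq_of_sub vK); rewrite /step addrAC subrr add0r vc (vV vK) vx.
apply: lt_trans (p_gt1 pr); rewrite invf_lt1 ?p_gt0 //; exact: p_gt1.
Qed.

Lemma v_inv_sub x y : v x = p%:R -> v y = p%:R -> v (x^-1 - y^-1) = p%:R^-1 ^+ 2 * v (x - y).
Proof.
move=> vx vy; have x0 := v_p_neq0 vx; have y0 := v_p_neq0 vy.
have -> : x^-1 - y^-1 = (x^-1 * y^-1) * - (x - y) by field; rewrite x0 y0.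
by rewrite !(vM vK) !(vV vK) (vN vK) vx vy expr2.
Qed.

Lemma v_step_sub c x y : v x = p%:R -> v y = p%:R ->
  v (step c x - step c y) = p%:R^-1 ^+ 2 * v (x - y).
Proof.
move=> vx vy; rewrite -(v_inv_sub vx vy); congr v; rewrite /step; ring.
Qed.

(** The numbers [c / p] and [c' / p] differ by a difference of inverses of elements of absolute
    value [p], so [p ^ 2] divides [c - c']. *)
Lemma step_inj c c' x y : letter c -> letter c' -> v x = p%:R -> v y = p%:R ->
  step c x = step c' y -> c = c' /\ x = y.
Proof.
move=> hc hc' vx vy e.
have ec : c = c'.
  apply: letter_inj => //.
  have -> : (c - c')%:~R = pK * (y^-1 - x^-1).
    have -> : y^-1 - x^-1 = c%:~R / pK - c'%:~R / pK.
      by move: e; rewrite /step => e; rewrite -[y^-1](addKr (c'%:~R / pK)) -e; ring.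
    rewrite rmorphB /=; field; exact: pK_neq0.
  rewrite (vM vK) v_pK expr2 ler_pM2l ?invr_gt0 ?p_gt0 //.
  by apply: (v_sub_le vK); rewrite (vV vK) ?vx ?vy.
by split=> //; move: e; rewrite /step ec => /addrI /invr_inj.
Qed.

Lemma v_cfev s x : all letter s -> v x = p%:R -> v (cfev s x) = p%:R.
Proof. by elim: s => [|c s IH] //= /andP[hc hs] vx; apply: v_step => //; apply: IH. Qed.

Lemma v_cfev_sub s x y : all letter s -> v x = p%:R -> v y = p%:R ->
  v (cfev s x - cfev s y) = p%:R^-1 ^+ (2 * size s) * v (x - y).
Proof.
move=> + vx vy; elim: s => [|c s IH] /=; first by rewrite muln0 expr0 mul1r.
move=> /andP[_ hs]; rewrite v_step_sub ?v_cfev // IH // mulrA -exprD; congr (_ ^+ _ * _); lia.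
Qed.

Lemma cfev_inj s x y : all letter s -> v x = p%:R -> v y = p%:R ->
  cfev s x = cfev s y -> x = y.
Proof.
move=> hs vx vy e; have := v_cfev_sub hs vx vy; rewrite e subrr (v0 vK) => /esym/eqP.
rewrite mulf_eq0 expf_eq0 invr_eq0 (gt_eqF (p_gt0 pr)) andbF /= => /eqP h.
by apply/eqP; rewrite -subr_eq0; apply/eqP; exact: (v_eq0 vK).
Qed.

Lemma v_sub_le_p x y : v x = p%:R -> v y = p%:R -> v (x - y) <= p%:R.
Proof. by move=> vx vy; apply: (v_sub_le vK); rewrite ?vx ?vy. Qed.

Lemma pinv_pow_le i j : (i <= j)%N -> (p%:R^-1 : rat) ^+ j <= p%:R^-1 ^+ i.
Proof.
by move=> h; apply: ler_wiXn2l h; rewrite ?invr_ge0 ?ler0n // invf_le1 ?p_gt0 // ltW // p_gt1.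
Qed.

Lemma pinv_pow_ge0 i : 0 <= (p%:R^-1 : rat) ^+ i.
Proof. by rewrite exprn_ge0 // invr_ge0 ler0n. Qed.

Lemma pinv_pow_small (eps : rat) : 0 < eps -> exists N, p%:R * p%:R^-1 ^+ N < eps.
Proof.
move=> e0; have h : 0 < eps / p%:R by rewrite divr_gt0 ?p_gt0.
have [N hN] := small_power (prime_gt1 pr) h.
exists (8 * N)%N; rewrite mulrC -ltr_pdivlMr ?p_gt0 //; exact: hN.
Qed.

Lemma eq_of_v_small x y : (forall eps : rat, 0 < eps -> v (x - y) < eps) -> x = y.
Proof.
move=> h; apply/eqP; rewrite -subr_eq0; apply/eqP/(v_eq0 vK)/eqP.
rewrite eq_le (v_ge0 vK) andbT leNgt; apply/negP => hp.
by have := h _ hp; rewrite ltxx.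
Qed.

(** [cfev w] contracts the sphere of radius [p]; completeness gives a limit of its iterates, started
    at [1 / p], which lies on that sphere. *)
Lemma cfev_fixed_point w : w != [::] -> all letter w -> exists2 x, v x = p%:R & cfev w x = x.
Proof.
move=> w0 hw; pose u j := iter j (cfev w) pK^-1.
have vu j : v (u j) = p%:R.
  by elim: j => [|j IH] /=; [rewrite (vV vK) v_pK invrK | exact: v_cfev].
have s0 : (0 < size w)%N by case: (w) w0.
have hu j r : v (u (j + r)%N - u j) <= p%:R * p%:R^-1 ^+ j.
  elim: j => [|j IH]; first by rewrite expr0 mulr1 v_sub_le_p.
  rewrite addSn /= v_cfev_sub // exprSr mulrA mulrC.
  apply: ler_pM; rewrite ?pinv_pow_ge0 ?(v_ge0 vK) //.
  by rewrite -[leRHS]expr1; apply: pinv_pow_le; rewrite muln_gt0.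
have [_ _ _ _ [_ _ comp]] := model.
have [l hl] : exists l : K, forall eps : rat, 0 < eps ->
    exists N, forall n, (N <= n)%N -> v (u n - l) < eps.
  apply: comp => eps /pinv_pow_small [N hN]; exists N => i j hi hj.
  apply: le_lt_trans hN; rewrite -[u i](subrK (u N)) -addrA.
  apply: (v_add_le vK); first by rewrite -(subnKC hi).
  by rewrite -(vN vK) opprB -(subnKC hj).
have vl : v l = p%:R.
  have [N hN] := hl 1 ltr01; rewrite -(vu N); apply: (v_eq_of_sub vK).
  by rewrite -(vN vK) opprB vu; apply: lt_trans (hN _ (leqnn _)) (p_gt1 pr).
exists l => //; apply: eq_of_v_small => eps e0; have [N hN] := hl _ e0.
have -> : cfev w l - l = - (cfev w (u N) - cfev w l) + (u N.+1 - l) by rewrite /=; ring.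
apply: le_lt_trans (vD vK _ _) _; rewrite gt_max (hN N.+1) // andbT (vN vK) v_cfev_sub //.
apply: le_lt_trans (hN N (leqnn _)); rewrite ler_piMl ?(v_ge0 vK) //.
by rewrite -[leRHS](expr0 p%:R^-1); apply: pinv_pow_le.
Qed.

Section FixedPoint.
Variables (w : seq int) (de : K).
Hypotheses (w0 : w != [::]) (hw : all letter w) (vde : v de = p%:R) (fix_de : cfev w de = de).

Lemma descent_bound (P N c M M' : nat) : (2 < P)%N -> (0 < N)%N -> (2 * c < P)%N ->
  (P * M' <= N + c * M)%N -> (M + 2 * M' < N + 2 * M)%N.
Proof. nia. Qed.

(* The continued fraction algorithm sends a rational value N/(pM) to
   M/(pM') with a smaller weight |N| + 2|M|. *)
Lemma cfev_irrational s (N M : int) : all letter s -> M != 0 ->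
  cfev s de * (pK * M%:~R) = N%:~R -> False.
Proof.
have [k] := ubnP (`|N| + 2 * `|M|)%N; elim: k s N M => // k IH s N M hk hs M0 e.
(* An empty [s] is replaced by [w], which leaves the value unchanged as [de] is fixed: there is
   always a next letter for the descent. *)
wlog [c [s' es]] : s hs e / exists c s', s = c :: s'.
  move=> H; case: s hs e => [|c s'] hs e; last by apply: (H _ hs e); exists c, s'.
  apply: (H w) => //; first by rewrite fix_de.
  by case: (w) w0 => // c s' _; exists c, s'.
move: hs e; rewrite es /= => /andP[hc hs']; set y := cfev s' de => e.
have vy : v y = p%:R by exact: v_cfev.
have y0 := v_p_neq0 vy; have MK := model_char0 pr model M0.
have N0 : N != 0.
  apply/eqP => N0; move: e; rewrite N0 => /eqP; apply/negP.
  by rewrite !mulf_neq0 ?pK_neq0 // v_p_neq0 // v_step.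
have e2 : y * (N - c * M)%:~R = pK * M%:~R.
  by rewrite rmorphB rmorphM /= -e /step; field; rewrite ?pK_neq0 ?y0.
(* As [v y = p], relation [e2] makes [N - c * M] divisible by [p ^ 2]; the quotient is the next
   [M']. *)
have hd : (p ^ 2 %| `|(N - c * M)%R|)%N.
  apply: (model_dvd pr model); move: (congr1 v e2); rewrite !(vM vK) vy v_pK => e3.
  rewrite expr2 -(ler_pM2l (p_gt0 pr)) e3 !mulrA mulfV ?gt_eqF ?p_gt0 // mul1r.
  by rewrite ler_piMr ?invr_ge0 ?ler0n //; exact: (v_int vK).
have [M' eM'] : exists M' : int, N - c * M = (p ^ 2)%N%:Z * M'.
  by have /dvdzP[M' ->] : (((p ^ 2)%N%:Z) %| (N - c * M)%R)%Z; [exact: hd | exists M'; rewrite mulrC].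
have e4 : y * (pK * M'%:~R) = M%:~R.
  apply: (mulfI pK_neq0); rewrite -e2 eM' rmorphM /= -pmulrn natrX; ring.
have M'0 : M' != 0.
  by apply/eqP => h; move: e4; rewrite h !mulr0 => /esym/eqP; apply/negP.
apply: (IH s' M M' _ hs' M'0 e4).
rewrite ltnS in hk; apply: leq_trans hk.
have [_ hc2] := andP hc.
apply: (@descent_bound (p ^ 2) _ `|c|) => //.
- by apply: leq_trans p3 _; rewrite -mulnn leq_pmulr // prime_gt0.
- by rewrite absz_gt0.
- have := congr1 absz eM'; rewrite abszM /= => <-.
  by rewrite -abszM; lia.
Qed.

Lemma fixed_irr (X Y : int) : X%:~R + Y%:~R * de = 0 -> X = 0 /\ Y = 0.
Proof.
move=> e; have [Y0|Y0] := eqVneq Y 0.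
  split=> //; apply/eqP/negPn/negP => X0; move: e; rewrite Y0 mul0r addr0 => /eqP.
  by rewrite (negPf (model_char0 pr model X0)).
case: (@cfev_irrational [::] (- (p%:Z * X)) Y) => //=.
rewrite rmorphN rmorphM /= -pmulrn -/pK.
have -> : X%:~R = - (Y%:~R * de) by apply/eqP; rewrite -subr_eq0 opprK e.
ring.
Qed.

End FixedPoint.

End ContinuedFractions.

(** Origin of [3 p^2 / 4]: the letter contributes at most [p^2 / 2], and the second row, bounded by
    [2 / p] times the first, adds at most [p^2 / 4] because [8 <= p^2]. *)
Lemma mobius_step_bound (p c N M A B : nat) : (2 < p)%N -> (2 * c < p ^ 2)%N ->
  (A * N <= p * B)%N -> (A * M <= 2 * B)%N ->
  (4 * A * (c * N + p * M) <= p * (3 * p ^ 2 * B))%N /\ (4 * A * (p * N) <= 2 * (3 * p ^ 2 * B))%N.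
Proof.
move=> p3 hc hN hM; split.
  have h1 : (4 * A * (c * N) <= 2 * p ^ 2 * (p * B))%N.
    rewrite (_ : 4 * A * (c * N) = 2 * (2 * c) * (A * N))%N; last by ring.
    by rewrite leq_mul // leq_mul // ltnW.
  have h2 : (4 * A * (p * M) <= p ^ 2 * (p * B))%N.
    apply: (@leq_trans (4 * p * (2 * B))); last by rewrite -mulnn; nia.
    by rewrite (_ : 4 * A * (p * M) = 4 * p * (A * M))%N; [rewrite leq_mul | ring].
  lia.
apply: (@leq_trans (4 * p * (p * B))); last by rewrite -mulnn; nia.
by rewrite (_ : 4 * A * (p * N) = 4 * p * (A * N))%N; [rewrite leq_mul | ring].
Qed.

(** With [P = p ^ 2] this gives [(3/4)^q <= p^(-2)] for [q = 3 p^2], the value at which [good] is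
    applied. *)
Lemma bernoulli_4_3 (P : nat) : (3 ^ (3 * P) * P.+1 <= 4 ^ (3 * P))%N.
Proof.
elim: P => [|P IH] //.
rewrite (mulnS 3 P) !(expnD _ 3 (3 * P)).
move: (3 ^ (3 * P))%N (4 ^ (3 * P))%N IH => x y IH.
rewrite (_ : 3 ^ 3 = 27)%N // (_ : 4 ^ 3 = 64)%N //.
apply: (@leq_trans (64 * (x * P.+1))%N); last by rewrite leq_mul2l IH orbT.
nia.
Qed.

(** Over [j] letters the factor [3/4] saves [p ^ (2 j)] in the [q]-th power; one half pays for the
    constant [(G p) ^ q], the other is the saving demanded by [good]. *)
Lemma height_bound (p j T G q : nat) : (1 < p)%N -> (0 < q)%N -> (3 ^ q * p ^ 2 <= 4 ^ q)%N ->
  (4 ^ j * T <= G * p * (3 * p ^ 2) ^ j)%N -> ((G * p) ^ q <= j)%N ->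
  (T ^ q <= p ^ ((2 * q).-1 * j.+1))%N.
Proof.
move=> p1 q0 h1 hT hj; have p0 : (0 < p)%N by exact: ltnW.
have h2 : (3 ^ (j * q) * p ^ (2 * j) <= 4 ^ (j * q))%N.
  by rewrite (mulnC j q) !expnM -expnMn; apply: leq_exp2r_le.
have h3 : (4 ^ (j * q) * T ^ q <= (G * p) ^ q * (3 ^ (j * q) * p ^ (2 * j * q)))%N.
  by have := leq_exp2r_le q hT; rewrite !expnMn -!expnM -(mulnA 2) mul2n -addnn expnD.
have h4 : (T ^ q * p ^ (2 * j) <= (G * p) ^ q * p ^ (2 * j * q))%N.
  have t0 : (0 < 3 ^ (j * q))%N by rewrite expn_gt0.
  rewrite -(leq_pmul2l t0); apply: leq_trans (_ : 4 ^ (j * q) * T ^ q <= _)%N; last first.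
    by apply: leq_trans h3 _; rewrite mulnCA.
  by rewrite mulnCA mulnC leq_mul2r h2 orbT.
have h5 : ((G * p) ^ q <= p ^ j)%N.
  by apply: leq_trans hj _; apply: ltnW; apply: ltn_expl.
have p2j : (0 < p ^ (2 * j))%N by rewrite expn_gt0 p0.
rewrite -(leq_pmul2r p2j); apply: leq_trans h4 _.
apply: leq_trans (leq_mul h5 (leqnn _)) _; rewrite -!expnD leq_exp2l //.
case: q q0 {h1 hT hj h2 h3 h5} => // q _; rewrite (_ : (2 * q.+1).-1 = (2 * q).+1)%N; lia.
Qed.

Lemma abs_comb_le (p : nat) (c x z : int) : (`|(c * x + p%:Z * z)%R| <= `|c| * `|x| + p * `|z|)%N.
Proof. by apply: leq_trans (leq_absD _ _) _; rewrite (abszM c x) (abszM p%:Z z). Qed.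

(** * Approximations attached to a repeated block *)

Section Approximation.
Variables (p : nat) (K : fieldType) (v : K -> rat).
Hypotheses (pr : prime p) (p3 : (2 < p)%N) (model : Qp_model p v).
Let vK := model_valued pr model.
Let pK : K := p%:R.

Lemma mobius (s : seq int) : all (letter p) s -> exists X Y Z W : int,
  [/\ forall y, v y = p%:R -> Z%:~R * y + W%:~R != 0 /\
        cfev p s y * (Z%:~R * y + W%:~R) = X%:~R * y + Y%:~R,
      (4 ^ size s * (`|X| + `|Y|) <= p * (3 * p ^ 2) ^ size s)%N
    & (4 ^ size s * (`|Z| + `|W|) <= 2 * (3 * p ^ 2) ^ size s)%N].
Proof.
elim: s => [_|c s IH] /=.
  exists 1, 0, 0, 1; split=> [y vy||] /=; rewrite ?mul1n ?muln1 ?(ltnW (ltnW p3)) //.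
  by rewrite mul0r add0r mulr1 mul1r addr0 oner_eq0.
move=> /andP[hc hs]; have [X [Y [Z [W [h hX hZ]]]]] := IH hs.
exists (c * X + p%:Z * Z), (c * Y + p%:Z * W), (p%:Z * X), (p%:Z * Y).
have [_ hc2] := andP hc.
have [b1 b2] := mobius_step_bound p3 hc2 hX hZ.
split=> [y vy||].
- have [n0 e] := h y vy; set u := cfev p s y in e *.
  have u0 : u != 0 by apply: (v_p_neq0 pr model); exact: v_cfev.
  have e1 : (p%:Z * X)%:~R * y + (p%:Z * Y)%:~R = pK * (u * (Z%:~R * y + W%:~R)).
    by rewrite e !rmorphM /= -pmulrn; ring.
  have pK0 := pK_neq0 pr model.
  rewrite e1; split; first by rewrite !mulf_neq0.
  rewrite !rmorphD !rmorphM /= -pmulrn.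
  have -> : (c%:~R * X%:~R + p%:R * Z%:~R) * y + (c%:~R * Y%:~R + p%:R * W%:~R) =
     c%:~R * (X%:~R * y + Y%:~R) + p%:R * (Z%:~R * y + W%:~R) :> K by ring.
  rewrite -e /step; field; by rewrite u0 pK0.
- rewrite (expnS 4) (expnS (3 * p ^ 2)); apply: leq_trans b1; rewrite leq_mul2l; apply/orP; right.
  apply: leq_trans (leq_add (abs_comb_le p c X Z) (abs_comb_le p c Y W)) _.
  by rewrite addnACA -!mulnDr.
- rewrite (expnS 4) (expnS (3 * p ^ 2)); apply: leq_trans b2; rewrite leq_mul2l; apply/orP; right.
  by rewrite (abszM p%:Z X) (abszM p%:Z Y) -mulnDr.
Qed.

Section Word.
Variables (w : seq int) (de : K).
Hypotheses (w0 : w != [::]) (hw : all (letter p) w) (vde : v de = p%:R) (fix_de : cfev p w de = de).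

(** Scaling by the leading coefficient [Z] makes the fixed point equation monic, so [Z de] is
    integral and lies in the unit ball. *)
Lemma fixed_quadratic : exists Z t u : int, [/\ Z != 0,
  (Z%:~R * de) ^+ 2 = t%:~R * (Z%:~R * de) + u%:~R & v (Z%:~R * de) <= 1].
Proof.
have [X [Y [Z [W [h _ _]]]]] := mobius hw.
have [_ e] := h de vde; rewrite fix_de in e.
have [Z0|Z0] := eqVneq Z 0; last first.
  have quad : (Z%:~R * de) ^+ 2 = (X - W)%:~R * (Z%:~R * de) + (Z * Y)%:~R.
    rewrite !(rmorphB, rmorphM) /=; transitivity (Z%:~R * (de * (Z%:~R * de + W%:~R) - W%:~R * de)); last rewrite e; ring.
  exists Z, (X - W), (Z * Y); split=> //.
  rewrite leNgt; apply/negP => h1; have v0 : 0 < v (Z%:~R * de) by exact: lt_trans h1.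
  have : v ((Z%:~R * de) ^+ 2) <= v (Z%:~R * de).
    rewrite quad; apply: (v_add_le vK); last by apply: le_trans (v_int vK _) (ltW h1).
    by rewrite (vM vK) ler_piMl ?(ltW v0) ?(v_int vK).
  by rewrite (vX vK) expr2 ger_pMl // leNgt h1.
(* With [Z = 0], the irrationality of [de] makes [cfev w] the identity on the sphere, which
   contradicts its contracting the distance from [de] to [- de]. *)
exfalso; rewrite Z0 mul0r add0r in e.
have [eY eW] : - Y = 0 /\ W - X = 0.
  apply: (fixed_irr pr p3 model w0 hw vde fix_de).
  rewrite rmorphN rmorphB /= mulrBl [_ * de]mulrC e; ring.
have eWX : W = X by apply/eqP; rewrite -subr_eq0 eW.
have fix_all y : v y = p%:R -> cfev p w y = y.
  move=> vy; have [] := h y vy; rewrite Z0 mul0r add0r eWX => X0.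
  by rewrite -[Y]opprK eY oppr0 addr0 mulrC; apply: mulfI.
have vn : v (- de) = p%:R by rewrite (vN vK).
have e2 := v_cfev_sub pr p3 model hw vde vn; rewrite !fix_all // in e2.
have : v (de - - de) = 0.
  have w1 : (0 < size w)%N by case: (w) w0.
  apply/eqP; rewrite eq_le (v_ge0 vK) andbT leNgt; apply/negP => h1.
  have : v (de - - de) < v (de - - de); last by rewrite ltxx.
  rewrite {1}e2 gtr_pMl // exprn_ilt1 ?muln_eq0 -?lt0n ?w1 ?invr_ge0 ?ler0n //.
  by rewrite invf_lt1 ?p_gt0 // p_gt1.
move/(v_eq0 vK); rewrite opprK -mulr2n -mulr_natl => /eqP; apply/negP; rewrite mulf_neq0 //.
  by rewrite pmulrn (model_char0 pr model).
exact: (v_p_neq0 pr model vde).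
Qed.

(** The level is [(size s).+1] because the expansion begins with the partial quotient 0, whence the
    inverse. [G] absorbs the constant of [csz] and the passage from [de] to [Z de]. *)
Lemma fixed_good (Z t u : int) : Z != 0 -> exists N, forall s al, all (letter p) s ->
  (N <= size s)%N -> v ((cfev p s de)^-1 - al) <= p%:R^-1 ^+ (8 * (size s).+1) ->
  (cfev p s de)^-1 != al ->
  good p v (Z%:~R * de) t u al (3 * p ^ 2) (size s).+1 (cfev p s de)^-1.
Proof.
move=> Z0; set G := ((1 + `|t| + `|u|) * `|Z|)%N.
exists ((G * p) ^ (3 * p ^ 2))%N => s al hs hN hv ne.
have [X [Y [Z1 [W1 [h hX hZ]]]]] := mobius hs.
have [n0 e] := h de vde; have ve := v_cfev pr model hs vde.
have e0 := v_p_neq0 pr model ve; have ZK := model_char0 pr model Z0.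
pose T := (G * maxn (`|X| + `|Y|) (`|Z1| + `|W1|))%N.
have csz_intro (a b : int) : (`|a| + `|b| <= maxn (`|X| + `|Y|) (`|Z1| + `|W1|))%N ->
    csz (Z%:~R * de) t u T (Z%:~R * (a%:~R * de + b%:~R)).
  move=> hab; exists (b * Z), a; split; first by rewrite rmorphM /=; ring.
  rewrite /T /G -mulnA leq_mul2l; apply/orP; right.
  apply: leq_trans (leq_mul (leqnn _) hab); rewrite (abszM b Z) mulnDr addnC [(_ * `|Z|)%N]mulnC.
  by rewrite leq_add2r leq_pmull // absz_gt0.
exists (Z%:~R * (Z1%:~R * de + W1%:~R)), (Z%:~R * (X%:~R * de + Y%:~R)), T; split=> //.
- by rewrite -e; field; rewrite e0.
- by rewrite -e !mulf_neq0.
- by split; apply: csz_intro; rewrite leq_max leqnn ?orbT.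
- have q1 : (3 ^ (3 * p ^ 2) * p ^ 2 <= 4 ^ (3 * p ^ 2))%N.
    by apply: leq_trans (bernoulli_4_3 (p ^ 2)); rewrite leq_mul2l leqnSn orbT.
  apply: (height_bound (prime_gt1 pr) _ q1 _ hN); first by rewrite muln_gt0 /= expn_gt0 prime_gt0.
  rewrite /T mulnCA -mulnA leq_mul2l; apply/orP; right.
  rewrite maxnMr geq_max hX (leq_trans hZ) // leq_mul2r ltnW ?orbT //.
Qed.

(** Only one letter per period is counted, which is enough for [lam > 3 n]. *)
Lemma v_iter_cfev_sub r x y : v x = p%:R -> v y = p%:R ->
  v (iter r (cfev p w) x - iter r (cfev p w) y) <= p%:R^-1 ^+ (2 * r) * v (x - y).
Proof.
move=> vx vy; have w1 : (0 < size w)%N by case: (w) w0.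
have vi z : v z = p%:R -> v (iter r (cfev p w) z) = p%:R.
  by move=> vz; elim: r => [|r IH] //=; apply: (v_cfev pr model).
elim: r vi => [|r IH] vi /=; first by rewrite muln0 expr0 mul1r.
have vi' z : v z = p%:R -> v (iter r (cfev p w) z) = p%:R.
  by move=> vz; elim: (r) => [|i IHi] //=; apply: (v_cfev pr model).
rewrite (v_cfev_sub pr p3 model) ?vi' // mulnS exprD -mulrA.
apply: ler_pM (IH vi'); rewrite ?exprn_ge0 ?invr_ge0 ?ler0n ?(v_ge0 vK) //.
by apply: pinv_pow_le => //; rewrite leq_pmulr.
Qed.

End Word.

Section Expansion.
Variables (c : nat -> int) (A : nat -> K).
Hypothesis hA : forall j, (0 < j)%N ->
  [/\ letter p (c j), v (A j) = p%:R & A j = step p (c j) (A j.+1)].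

Definition word (n k : nat) : seq int := [seq c j | j <- iota n k].

Lemma size_word n k : size (word n k) = k.
Proof. by rewrite size_map size_iota. Qed.

Lemma letter_word n k : (0 < n)%N -> all (letter p) (word n k).
Proof.
move=> n0; apply/allP => x /mapP[j]; rewrite mem_iota => /andP[nj _] ->.
by have [] := hA (leq_trans n0 nj).
Qed.

Lemma tail_word n k : (0 < n)%N -> A n = cfev p (word n k) (A (n + k)%N).
Proof.
elim: k n => [|k IH] n n0; first by rewrite addn0.
by have [_ _ ->] := hA n0; rewrite /= (IH n.+1) // addSnnS.
Qed.

Section Block.
Variables n k lam : nat.
Hypothesis n0 : (0 < n)%N.
Hypothesis per : forall h, (n <= h)%N -> (h < n + (lam - 1) * k)%N -> c (h + k)%N = c h.

(** [per] only shifts indices below [n + (lam - 1) * k], which yields [lam] copies of the block. *)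
Lemma block_shift r j : (r < lam)%N -> (j < k)%N -> c (n + r * k + j)%N = c (n + j)%N.
Proof.
move=> + jk; elim: r => [|r IH] hr; first by rewrite mul0n addn0.
have -> : (n + r.+1 * k + j = n + r * k + j + k)%N by lia.
rewrite per ?IH ?(ltnW hr) //; first by lia.
rewrite -addnA ltn_add2l; apply: (@leq_trans (r.+1 * k)); first by rewrite mulSn addnC ltn_add2r.
by rewrite leq_mul2r; lia.
Qed.

Lemma block_tail r : (r <= lam)%N -> A n = iter r (cfev p (word n k)) (A (n + r * k)%N).
Proof.
elim: r => [|r IH] hr; first by rewrite addn0.
rewrite IH ?(ltnW hr) // iterSr; congr iter.
rewrite (@tail_word (n + r * k) k) ?addn_gt0 ?n0 //; congr (cfev p _ (A _)); last by lia.
rewrite /word -[in LHS](addn0 (n + _)%N) -[in RHS](addn0 n) !iotaDl -!map_comp.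
by apply/eq_in_map => j; rewrite mem_iota /= => jk; rewrite block_shift.
Qed.

End Block.

Lemma tail_inj i j m : (0 < i)%N -> (0 < j)%N -> A i = A j ->
  A (i + m)%N = A (j + m)%N /\ c (i + m)%N = c (j + m)%N.
Proof.
move=> i0 j0 e.
have step1 a b : (0 < a)%N -> (0 < b)%N -> A a = A b -> c a = c b /\ A a.+1 = A b.+1.
  move=> a0 b0; have [la _ ->] := hA a0; have [lb _ ->] := hA b0.
  have [_ va _] := hA (ltn0Sn a); have [_ vb _] := hA (ltn0Sn b).
  exact: (step_inj pr p3 model).
have eA : A (i + m)%N = A (j + m)%N.
  elim: m => [|m IH]; first by rewrite !addn0.
  by rewrite !addnS; apply: (step1 _ _ _ _ IH).2; rewrite addn_gt0 ?i0 ?j0.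
by split=> //; apply: (step1 _ _ _ _ eA).1; rewrite addn_gt0 ?i0 ?j0.
Qed.

Lemma block_good (w : seq int) (de : K) (Z t u : int) : w != [::] -> all (letter p) w ->
  v de = p%:R -> cfev p w de = de -> Z != 0 ->
  ~ (exists N T, (0 < T)%N /\ forall n, (N <= n)%N -> c (n + T)%N = c n) ->
  exists N, forall n lam, (N < n)%N -> (3 * n < lam)%N -> word n (size w) = w ->
    (forall h, (n <= h)%N -> (h < n + (lam - 1) * size w)%N -> c (h + size w)%N = c h) ->
    exists be, good p v (Z%:~R * de) t u (A 1)^-1 (3 * p ^ 2) n be.
Proof.
move=> w0 hw vde fix_de Z0 nper; have [N hN] := fixed_good vde t u Z0.
have w1 : (0 < size w)%N by case: (w) w0.
exists N => n lam Nn hlam ew per; have n0 : (0 < n)%N by exact: leq_ltn_trans Nn.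
set s := word 1 n.-1; have ls : all (letter p) s by exact: letter_word.
have eA1 : A 1%N = cfev p s (A n) by rewrite (tail_word n.-1 (ltn0Sn 0)) add1n prednK.
have [_ vAn _] := hA n0; have [_ vA1 _] := hA (ltn0Sn 0).
have vs : v (cfev p s de) = p%:R by exact: (v_cfev pr model).
exists (cfev p s de)^-1; rewrite -[X in good _ _ _ _ _ _ _ X](prednK n0) -(size_word 1 n.-1).
apply: hN => //.
- by rewrite size_word -ltnS prednK.
(* The inverse contributes 2, the [n - 1] letters [2 (n - 1)], the repetitions [2 lam - 1]; as
   [lam >= 3 n + 1], the sum exceeds [8 n]. *)
- rewrite size_word prednK // (v_inv_sub pr model) // eA1 (v_cfev_sub pr p3 model) // size_word.
  have vAl : v (A (n + lam * size w)%N) = p%:R.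
    by have [] := hA (leq_trans n0 (leq_addr (lam * size w) n)).
  have hd : v (de - A n) <= p%:R^-1 ^+ (2 * lam) * p%:R.
    rewrite (@block_tail n (size w) lam n0 per lam (leqnn _)) ew.
    have {1}-> : de = iter lam (cfev p w) de by elim: (lam) => // i /= <-; rewrite fix_de.
    apply: le_trans (v_iter_cfev_sub w0 hw _ vde vAl) _.
    by rewrite ler_wpM2l ?(v_sub_le_p pr model) ?exprn_ge0 ?invr_ge0 ?ler0n.
  rewrite mulrA -exprD; apply: le_trans (ler_wpM2l _ hd) _.
    by rewrite exprn_ge0 ?invr_ge0 ?ler0n.
  have e8 : p%:R^-1 ^+ (2 * lam) * p%:R = p%:R^-1 ^+ (2 * lam).-1 :> rat.
    rewrite -[in LHS](@prednK (2 * lam)) ?muln_gt0 ?(leq_ltn_trans _ hlam) // exprSr mulfVK //.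
    by rewrite gt_eqF // p_gt0.
  by rewrite e8 -exprD; apply: pinv_pow_le => //; lia.
(* Equality would make [A n] the fixed point [de], hence equal to [A (n + size w)], and the
   expansion eventually periodic. *)
- apply/eqP => /invr_inj h; rewrite eA1 in h.
  have eAn : de = A n by exact: (cfev_inj pr p3 model ls vde vAn h).
  have nk0 : (0 < n + size w)%N by rewrite addn_gt0 n0.
  have [_ vAk _] := hA nk0.
  have eAk : A n = A (n + size w)%N.
    apply: (cfev_inj pr p3 model hw) => //.
    by rewrite -eAn fix_de -{1}ew -tail_word.
  apply: nper; exists n, (size w); split=> // m hm.
  have [_] := tail_inj (m - n) n0 nk0 eAk; rewrite subnKC // => ->.
  by congr c; lia.
Qed.

Lemma infinite_pigeonhole (T : finType) (g : nat -> T) : exists x, forall N, exists2 i, (N <= i)%N & g i = x.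
Proof.
apply: NNPP => h.
have h2 x : exists N, forall i, (N <= i)%N -> g i != x.
  apply: NNPP => h3; apply: h; exists x => N; apply: NNPP => h4; apply: h3; exists N => i Ni.
  by apply/eqP => e; apply: h4; exists i.
have [f hf] := fin_all_exists h2.
by have := hf _ (\max_x f x) (leq_bigmax (g (\max_x f x))); rewrite eqxx.
Qed.

Lemma word_pigeonhole (n k : nat -> nat) (B : nat) : (forall i, 0 < n i)%N -> (forall i, k i <= B)%N ->
  exists w, forall N, exists2 i, (N <= i)%N & size w = k i /\ word (n i) (k i) = w.
Proof.
move=> n0 kB.
(* Letters lie between [- p ^ 2] and [p ^ 2], so after the shift [inord] is faithful on them. *)
pose code (x : int) : 'I_(2 * p ^ 2).+1 := inord `|x + (p ^ 2)%N%:Z|.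
have code_inj x y : letter p x -> letter p y -> code x = code y -> x = y.
  move=> /andP[_ hx] /andP[_ hy] /(congr1 val); rewrite /= !inordK; move: (p ^ 2)%N hx hy => P; lia.
have [[k0 g] hx] := infinite_pigeonhole
  (fun i => (inord (k i) : 'I_B.+1, [ffun j : 'I_B => code (c (n i + j)%N)])).
have [i0 _ [ek0 eg0]] := hx 0%N.
exists (word (n i0) (k i0)) => N; have [i Ni [ek eg]] := hx N; exists i => //.
have ki : k i = k i0 by have := congr1 val (etrans ek (esym ek0)); rewrite /= !inordK ?ltnS ?kB.
rewrite size_word ki; split=> //.
rewrite /word -[in LHS](addn0 (n i)) -[in RHS](addn0 (n i0)) !iotaDl -!map_comp.
apply/eq_in_map => j; rewrite mem_iota /= add0n => jk.
have jB : (j < B)%N by exact: leq_trans jk (kB i0).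
have := congr1 (fun f : {ffun 'I_B -> _} => f (Ordinal jB)) (etrans eg (esym eg0)).
rewrite !ffunE /=; apply: code_inj.
  by have [] := hA (leq_trans (n0 i) (leq_addr j _)).
by have [] := hA (leq_trans (n0 i0) (leq_addr j _)).
Qed.

Theorem quasi_periodic_not_algebraic (n k lam : nat -> nat) (B : nat) (F : {poly int}) :
  (forall i, (0 < k i <= B)%N) -> (forall i, (i < n i)%N) ->
  (exists N, forall i, (N <= i)%N -> (3 * n i < lam i)%N) ->
  (forall i h, (n i <= h)%N -> (h < n i + (lam i - 1) * k i)%N -> c (h + k i)%N = c h) ->
  ~ (exists N T, (0 < T)%N /\ forall m, (N <= m)%N -> c (m + T)%N = c m) ->
  F != 0 -> zev F (A 1)^-1 != 0.
Proof.
move=> hk hn [N1 hlam] per nper F0; apply/eqP => FA.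
have [||w hw] := @word_pigeonhole n k B; [by move=> i; exact: leq_ltn_trans (hn i) | by move=> i; have /andP[] := hk i |].
have [i0 _ [sw ew]] := hw 0%N.
have w0 : w != [::] by rewrite -size_eq0 sw -lt0n; have /andP[] := hk i0.
have lw : all (letter p) w by rewrite -ew letter_word // (leq_ltn_trans _ (hn i0)).
have [de vde fix_de] := cfev_fixed_point pr p3 model w0 lw.
have [Z [t [u [Z0 quad vZ]]]] := fixed_quadratic w0 lw vde fix_de.
have [N2 hN2] := block_good t u w0 lw vde fix_de Z0 nper.
have [f _] := ratr_rmorphism (model_char0 pr model).
have [_ vA1 _] := hA (ltn0Sn 0).
apply: (good_infinitely_often_false f vK (prime_gt1 pr) quad vZ _ _ F0 FA (q := 3 * p ^ 2)).
- move=> X Y; rewrite mulrA -rmorphM /= => /(fixed_irr pr p3 model w0 lw vde fix_de) [-> /eqP].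
  by rewrite mulf_eq0 (negPf Z0) orbF => /eqP.
- by rewrite (vV vK) vA1 invf_le1 ?p_gt0 // ltW // p_gt1.
- by rewrite muln_gt0 /= expn_gt0 prime_gt0.
move=> N; have [i hi [ek ew']] := hw (N + N1 + N2)%N.
have hni := hn i; exists (n i); first by lia.
rewrite -ek in ew'.
apply: (hN2 (n i) (lam i)) => //; first by lia.
  by apply: hlam; lia.
by rewrite ek; apply: per.
Qed.

End Expansion.

End Approximation.

(** * The hypothesis on Fibonacci numbers *)

Lemma fib_ge n : (0 < fib n.+1)%N /\ (n <= fib n.+1)%N.
Proof.
suff: [/\ 0 < fib n.+1, n <= fib n.+1, 0 < fib n.+2 & n.+1 <= fib n.+2]%N by case.
elim: n => [|n [h1 h2 h3 h4]] //; have -> : fib n.+3 = (fib n.+2 + fib n.+1)%N by [].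
split=> //; lia.
Qed.

Lemma int_sq_ge1 (F : realFieldType) (x : int) : x != 0 -> 1 <= (x%:~R : F) ^+ 2.
Proof.
move=> x0; rewrite -rmorphXn /= -[1]/(1%:~R) ler_int.
by move: x0; case: x => [[|x]|x] // _; nia.
Qed.

Lemma fib_sq_lt (F : realFieldType) (x : F) (f q m : nat) : 1 <= x ->
  14%:R * x * f%:R ^+ 2 < 3%:R * q%:R ^+ m -> (f ^ 2 < 3 * q ^ m)%N.
Proof.
move=> x1 h; rewrite -(ltr_nat F) natrM !natrX; apply: le_lt_trans h.
have := exprn_ge0 2 (ler0n F f); move: (f%:R ^+ 2) => y; nra.
Qed.

Lemma digit_bound (F : realFieldType) (c : int) (q : nat) :
  `|c|%:~R < q%:R / 2 * q%:R :> F -> (2 * `|c| < q ^ 2)%N.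
Proof.
have <- : (`|c|%N)%:R = `|c|%:~R :> F by rewrite pmulrn abszE.
move=> h; rewrite -(ltr_nat F) natrM natrX; lra.
Qed.

(* The bound of condition (4) at an index where a_j <> 1 fails for m large, by growth of
   the Fibonacci numbers; hence all a_j are 1. *)
Lemma cond4_exponent (p : nat) (b : nat -> rat) (n : nat -> nat) : prime p ->
  (forall i, i < n i)%N -> (forall i, cond4 p b (n i)) -> forall j, (0 < j)%N ->
  cf_a b p j = 1%N /\ b j = (numq (b j))%:~R / p%:R.
Proof.
move=> pr hn c4 j j0; have p0 := prime_gt0 pr.
have jn i : (j <= i)%N -> (1 <= j <= n i)%N by have := hn i; lia.
have [ha hb] := (c4 j).1 _ (jn j (leqnn j)).
suff a1 : cf_a b p j = 1%N by split=> //; rewrite {1}hb a1.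
apply/eqP/negPn/negP => a1.
(* The minimum [a] never exceeds the fixed exponent [a_j], so [F_(m+1) >= m > i] violates the bound
   for this [i]. *)
pose i := (j + 3 * p ^ (2 * cf_a b p j))%N; set m := n i.
have jm := jn i (leq_addr _ _).
pose Q a := [exists j1 : 'I_m.+1, [&& (0 < j1)%N, cf_a b p j1 != 1%N & a == cf_a b p j1]].
have Qj j1 : (1 <= j1 <= m)%N -> cf_a b p j1 != 1%N -> Q (cf_a b p j1).
  move=> /andP[h1 h2] h3; rewrite -ltnS in h2.
  by apply/existsP; exists (Ordinal h2); rewrite /= h1 h3 eqxx.
have exQ : exists a, Q a by exists (cf_a b p j); exact: Qj.
have [_ /(_ (ex_minn exQ))] := c4 i; case: ex_minnP => a /existsP[j1 /and3P[j10 aj1 /eqP ea]] amin.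
have hj1 : (1 <= j1 <= n i)%N by rewrite j10 -ltnS ltn_ord.
have bj : b j != p%:R^-1.
  apply: contraNneq a1; rewrite /cf_a => ->.
  rewrite pmulrn denqVz ?eqz_nat -?lt0n // absz_id -[`|p%:Z|%N]/p.
  by rewrite logn_prime // eqxx.
move=> bound; have {bound} := bound (ex_intro _ _ (And3 hj1 aj1 ea)) (fun j' h1 h2 => amin _ (Qj j' h1 h2)) j jm bj.
have x0 : cf_bhat b j != 0.
  apply: contraTneq ha; rewrite /cf_bhat /cf_a => /eqP; rewrite numq_eq0 => /eqP ->.
  by rewrite (_ : denq 0 = 1) // logn1.
move/(fib_sq_lt (int_sq_ge1 rat x0)) => h2.
have aj : (a <= cf_a b p j)%N by apply: amin; exact: Qj.
have h3 : (p ^ (2 * a) <= p ^ (2 * cf_a b p j))%N by rewrite leq_pexp2l // leq_mul2l.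
have [f0 hf] := fib_ge m; have hm := hn i; rewrite -/m in hm.
have hi : (3 * p ^ (2 * cf_a b p j) <= i)%N by exact: leq_addl.
suff : (fib m.+1 < i)%N by rewrite ltnNge (ltnW (leq_trans hm hf)).
apply: (@leq_ltn_trans (fib m.+1 ^ 2)); first by rewrite -mulnn leq_pmulr.
by apply: leq_trans h2 _; apply: leq_trans hi; rewrite leq_mul2l h3 orbT.
Qed.

Theorem theorem4 (p : nat) (K : fieldType) (v : K -> rat)
  (alpha : K) (b : nat -> rat) (D : rat) (n k lam : nat -> nat) :
  prime p -> odd p ->
  Qp_model p v ->
  b 0%N = 0 ->
  browkin_cf p v alpha b ->
  ~ eventually_periodic b ->
  (exists M : rat, forall i, (1 <= i)%N -> padic_abs p (b i) <= M) ->
  (exists i, (1 <= i)%N /\ padic_abs p (b i) = D) ->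
  (forall i, (1 <= i)%N -> padic_abs p (b i) <= D) ->
  (forall i, (0 < n i)%N /\ (0 < k i)%N /\ (0 < lam i)%N) ->
  (exists B, forall i, (k i <= B)%N) ->
  (forall i, (n i + lam i * k i <= n i.+1)%N) ->
  (exists C : rat,
     (forall e : int, D = p%:R ^ e -> 4%:R * e%:~R - 1 < C) /\
     (exists N, forall i, (N <= i)%N -> C * (n i)%:R < (lam i)%:R)) ->
  (forall i h, (n i <= h)%N -> (h < n i + (lam i - 1) * k i)%N ->
     b (h + k i)%N = b h) ->
  (forall i, cond4 p b (n i)) ->
  (forall P : {poly rat}, P != 0 -> (map_poly ratr P).[alpha] != 0)
  \/ ((forall q : rat, alpha != ratr q) /\
      exists P : {poly rat}, size P = 3%N /\ root (map_poly ratr P) alpha).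
Proof.
move=> pr op model b0 [al [al0 hal]] nper _ [iD [iD0 eD]] _ pos [B kB] hn [C [hC [N hN]]] per c4.
left => P P0; have vK := model_valued pr model; have p0 := prime_gt0 pr.
have p3 : (2 < p)%N by case/even_prime: (pr) op (prime_gt1 pr) => [->|] //; case: (p) => [|[|[]]].
have nlt i : (i < n i)%N.
  elim: i => [|i IH]; first by have [] := pos 0%N.
  have [_ [ki li]] := pos i; apply: leq_trans (hn i).
  by rewrite -addn1 leq_add // muln_gt0 li.
have hexp := cond4_exponent pr nlt c4.
(* In lowest terms a denominator divisible by [p] keeps [p] out of the numerator; the digit
   condition [|b j| < p / 2] bounds it. *)
have hc j : (0 < j)%N -> letter p (numq (b j)).
  move=> j0; have [aj bj] := hexp j j0; have [[[_ babs] _] _ _] := hal j.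
  apply/andP; split.
    have : (p %| `|denq (b j)|)%N.
      by apply: contraTT isT => h; move: aj; rewrite /cf_a lognE (negPf h) !andbF.
    move=> hd; rewrite -prime_coprime // coprime_sym; apply: coprime_dvdr hd _.
    exact: coprime_num_den.
  move: babs; rewrite {1}bj normrM normfV normr_nat ltr_pdivrMr ?ltr0n // -intr_norm => h.
  exact: digit_bound h.
have pp : p%:R = p%:Z%:~R :> rat by [].
have pK0 : p%:Z%:~R != 0 :> K by rewrite (model_char0 pr model) // eqz_nat -lt0n.
have rb j : (0 < j)%N -> ratr (b j) = (numq (b j))%:~R / p%:R :> K.
  move=> j0; have [_ bj] := hexp j j0; rewrite {1}bj pp (ratr_frac (model_char0 pr model)) //.
  by rewrite eqz_nat -lt0n.
have vrb j : (0 < j)%N -> v (ratr (b j)) = p%:R.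
  by move=> j0; rewrite (rb j j0) (vM vK) (vV vK) (v_p vK) (v_letter model (hc j j0)) mul1r invrK.
have hA j : (0 < j)%N ->
    [/\ letter p (numq (b j)), v (al j) = p%:R & al j = step p (numq (b j)) (al j.+1)].
  move=> j0; have [[_ h] _ e] := hal j; split; first exact: hc.
    rewrite -(vrb j j0); apply: (v_eq_of_sub vK); rewrite vrb //.
    exact: lt_trans h (p_gt1 pr).
  by rewrite /step e invrK -(rb j j0) addrC subrK.
have alE : alpha = (al 1%N)^-1.
  have [_ _ ->] := hal 0%N; rewrite invrK al0 b0 (_ : ratr 0 = 0 :> K) ?subr0 //.
  by rewrite -[0 : rat]/(0%:~R) ratr_int.
have C3 : 3%:R < C.
  have [_ _ _ _ [vq _ _]] := model.
  have Dp : D = p%:R ^ 1 by rewrite -eD -vq vrb.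
  by have := hC 1 Dp; rewrite mulr1 (_ : 4%:R - 1 = 3%:R).
have hlam : exists N, forall i, (N <= i)%N -> (3 * n i < lam i)%N.
  exists N => i /hN h; rewrite -(ltr_nat rat) natrM; apply: le_lt_trans h.
  by rewrite ler_wpM2r ?ler0n // ltW.
(* Beyond index 0 all denominators are [p], so the numerators determine the partial quotients. *)
have nperc : ~ (exists N T, (0 < T)%N /\
    forall m, (N <= m)%N -> numq (b (m + T)%N) = numq (b m)).
  move=> [N' [T [T0 h]]]; apply: nper; exists N'.+1, T; split=> // m hm.
  have m0 : (0 < m)%N by exact: leq_ltn_trans hm.
  have [_ ->] := hexp _ m0; have [_ ->] := hexp _ (leq_trans m0 (leq_addr T m)).
  by rewrite h // ltnW.
have [F [a a0 eP]] := rat_poly_scale P.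
have F0 : F != 0 by apply: contraNneq P0 => F0; rewrite eP F0 map_poly0 scaler0.
have [f hf] := ratr_rmorphism (model_char0 pr model).
have aK : ratr (a%:~R^-1) != 0 :> K.
  by rewrite -hf fmorph_eq0 invr_eq0 intr_eq0.
rewrite -(eq_map_poly hf) eP map_polyZ hornerZ /= hf mulf_neq0 // -map_poly_comp.
have -> : map_poly (f \o intr) F = map_poly intr F :> {poly K}.
  by apply: eq_map_poly => z; rewrite /= rmorph_int.
rewrite alE; apply: (quasi_periodic_not_algebraic pr p3 model hA (n := n) (k := k) (lam := lam) (B := B)) => //.
- by move=> i; have [_ [-> _]] := pos i; rewrite kB.
- by move=> i h h1 h2; rewrite (per i).
Qed.
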